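(* The two following statements hold. (i) If $\alpha_{2,3}^-<t<\alpha_{3,4}^-$, then $I_d(t)$ is a strictly increasing function of $d$ over the positive integers, where $\alpha_{3,4}^-$ is the solution of $$ 16-9\sqrt{3}-12\bigl(8-3\sqrt{3}\bigr)t^2+96t^3=0 $$ such that $0.144137<\alpha_{3,4}^-<0.144138$, and $\alpha_{2,3}^-$ is equal to $$ \frac{2-\sqrt{31-12\sqrt{6}}}{6\sqrt{3}} $$ and satisfies $0.0705012<\alpha_{2,3}^-<0.0705013$. (ii) If $\alpha_{3,4}^\circ<t\leq1/2$, then $I_d(t)$ is a strictly decreasing function of $d$ over the positive integers, where $\alpha_{3,4}^\circ$ is the solution of $$ 32-27\sqrt{3}+108t-12\bigl(16+3\sqrt{3}\bigr)t^2+192t^3=0 $$ such that $0.407452<\alpha_{3,4}^\circ<0.407453$.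
   Context: For a positive integer $d$ and a non-negative real number $t$, $I_d(t)$ denotes the $(d-1)$-dimensional volume of $H\cap[0,1]^d$ where $H$ is a hyperplane of $\mathbb{R}^d$ that is orthogonal to a diagonal of the hypercube $[0,1]^d$ (a segment joining two opposite vertices, for instance the one in direction $(1,\ldots,1)$) and whose Euclidean distance to the center of $[0,1]^d$ is equal to $t$. By symmetry, this does not depend on the choice of such an $H$. The volume is $0$ when the intersection is empty. When $d=1$, the $0$-dimensional volume is the counting measure, so that $I_1(t)=1$ if $0\leq t\leq1/2$ and $I_1(t)=0$ if $t>1/2$. *)

(* Defs.v *)
From HB Require Import structures.
From mathcomp Require Import all_boot all_order all_algebra.
From mathcomp Require Import all_classical all_reals all_analysis.

Set Implicit Arguments.
Unset Strict Implicit.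
Unset Printing Implicit Defensive.

Import Order.TTheory GRing.Theory Num.Theory.

Local Open Scope classical_set_scope.
Local Open Scope ring_scope.

(* Coordinates are taken in n.-tuple because, unlike 'rV[R]_n, it carries the
   library's product sigma-algebra. *)
Notation Rtuple R n := (n.-tuple (measurableTypeR R)).

Definition tcons (R : realType) (n : nat)
    (p : measurableTypeR R * Rtuple R n) : Rtuple R n.+1 :=
  [tuple of p.1 :: p.2].

Lemma measurable_tcons (R : realType) (n : nat) :
  measurable_fun [set: measurableTypeR R * Rtuple R n] (@tcons R n).
Proof. exact: measurable_cons. Qed.

HB.instance Definition _ (R : realType) (n : nat) :=
  isMeasurableFun.Build _ _ _ _ (@tcons R n) (@measurable_tcons R n).

Section lebesgue_succ.
Context (R : realType) (n : nat).
Variable mu : {sigma_finite_measure set (Rtuple R n) -> \bar R}.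

Definition lebesgue_succ : set (Rtuple R n.+1) -> \bar R :=
  pushforward (@lebesgue_measure R \x mu)%E (@tcons R n).

Let lebesgue_succ0 : lebesgue_succ set0 = 0%E.
Proof. exact: measure0. Qed.

Let lebesgue_succ_ge0 A : (0 <= lebesgue_succ A)%E.
Proof. exact: measure_ge0. Qed.

Let lebesgue_succ_sigma_additive : semi_sigma_additive lebesgue_succ.
Proof. exact: measure_semi_sigma_additive. Qed.

HB.instance Definition _ := isMeasure.Build _ _ _ lebesgue_succ
  lebesgue_succ0 lebesgue_succ_ge0 lebesgue_succ_sigma_additive.

Let lebesgue_succ_sigma_finite : sigma_finite setT lebesgue_succ.
Proof.
have /sigma_finiteP[F [FT ndF Foo]] := sigma_finiteT (@lebesgue_measure R).
have /sigma_finiteP[G [GT ndG Goo]] := sigma_finiteT mu.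
pose rest (v : Rtuple R n.+1) : Rtuple R n := [tuple of behead v].
have rest_tcons p : rest (tcons p) = p.2 by exact: val_inj.
exists (fun k => (@thead n _) @^-1` F k `&` rest @^-1` G k).
  apply/esym/seteqP; split => // v _.
  have : [set: measurableTypeR R] (thead v) by [].
  have : [set: Rtuple R n] (rest v) by [].
  rewrite {1}FT {1}GT => -[j _ Gj] [i _ Fi]; exists (maxn i j) => //; split.
    by have /subsetPset := ndF _ _ (leq_maxl i j); exact.
  by have /subsetPset := ndG _ _ (leq_maxr i j); exact.
move=> k; have [mF Fk] := Foo k; have [mG Gk] := Goo k; split.
  apply: measurableI; rewrite -[X in measurable X]setTI.
    exact: measurable_tnth.
  exact: measurable_behead.
rewrite /lebesgue_succ /pushforward.
rewrite (_ : _ @^-1` _ = F k `*` G k).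
  by rewrite product_measure1E// lte_mul_pinfty// ge0_fin_numE.
by apply/seteqP; split => p /=; rewrite rest_tcons theadE.
Qed.

HB.instance Definition _ := Measure_isSigmaFinite.Build _ _ _ lebesgue_succ
  lebesgue_succ_sigma_finite.

End lebesgue_succ.

(* The Lebesgue measure on R^n; for n = 0 it is the counting measure on the
   one-point space R^0. *)
Fixpoint lebesgue_tuple (R : realType) (n : nat) :
    {sigma_finite_measure set (Rtuple R n) -> \bar R} :=
  match n with
  | 0 => \d_([tuple] : Rtuple R 0)
  | m.+1 => lebesgue_succ (lebesgue_tuple R m)
  end.

Definition dotmul (R : realType) (d : nat) (u v : 'rV[R]_d) : R :=
  \sum_i u 0 i * v 0 i.

Definition enorm (R : realType) (d : nat) (u : 'rV[R]_d) : R :=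
  Num.sqrt (dotmul u u).

Definition set_edist (R : realType) (d : nat) (x : 'rV[R]_d) (A : set 'rV[R]_d) : R :=
  inf [set enorm (x - y) | y in A].

Definition hypercube (R : realType) (d : nat) : set 'rV[R]_d :=
  [set x | forall i, 0 <= x 0 i <= 1].
Arguments hypercube : clear implicits.

Definition hypercube_center (R : realType) (d : nat) : 'rV[R]_d :=
  const_mx 2^-1.
Arguments hypercube_center : clear implicits.

Definition vertex (R : realType) (d : nat) (v : 'rV[R]_d) : Prop :=
  forall i, v 0 i = 0 \/ v 0 i = 1.

Definition opposite_vertex (R : realType) (d : nat) (v : 'rV[R]_d) : 'rV[R]_d :=
  const_mx 1 - v.

Definition hyperplane (R : realType) (d : nat) (u : 'rV[R]_d) (b : R) :
    set 'rV[R]_d :=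
  [set x | dotmul x u = b].

Definition orthogonal_to_diagonal (R : realType) (d : nat) (H : set 'rV[R]_d) :
    Prop :=
  exists v b, vertex v /\ H = hyperplane (opposite_vertex v - v) b.

Definition row_of_tuple (R : realType) (n : nat) (y : Rtuple R n) : 'rV[R]_n :=
  \row_i tnth y i.

(* [flat_volume k H A v]: H is a k-dimensional affine subspace and v is the
   k-dimensional volume of A inside H, that is, the Lebesgue measure of A in
   Cartesian coordinates y |-> p + y *m B on H (the rows of B are orthonormal).
   The value does not depend on the choice of p and B when A is a Borel set. *)
Definition flat_volume (R : realType) (k d : nat) (H A : set 'rV[R]_d)
    (v : \bar R) : Prop :=
  exists (p : 'rV[R]_d) (B : 'M[R]_(k, d)),
    [/\ B *m B^T = 1%:M,
        H = [set p + y *m B | y in [set: 'rV[R]_k]] &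
        v = lebesgue_tuple R k
              [set y : Rtuple R k | A (p + row_of_tuple y *m B)]].

Definition is_section_volume (R : realType) (d : nat) (t : R) (v : \bar R) :
    Prop :=
  exists H : set 'rV[R]_d,
    [/\ orthogonal_to_diagonal H, set_edist (hypercube_center R d) H = t &
        flat_volume d.-1 H (H `&` hypercube R d) v].

(* I_d(t). By the symmetries of the hypercube all suitable H give the same
   value, which xget picks; the default 0 is only used when there is no suitable
   H (d = 0 or t < 0). *)
Definition section_volume (R : realType) (d : nat) (t : R) : \bar R :=
  xget 0%E [set v | is_section_volume d t v].

(* Main.v *)
Require Import Defs.
From HB Require Import structures.
From mathcomp Require Import all_boot all_order all_algebra.
From mathcomp Require Import all_classical all_reals all_analysis.
From mathcomp Require Import measurable_realfun ring lra ssrZ zify.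
From Stdlib Require BinInt QArith_base Qreduction.

(* Slicing the cube orthogonally to a diagonal gives
   I_d(t) = sqrt d * f_d(d/2 + t sqrt d), where f_d is the Irwin-Hall density,
   a piecewise polynomial, and f_d is the cosine transform of sinc^d. After the
   substitution y = sqrt(3/d) xi this reads
     pi/2 * I_d(t) = sqrt 3 * int_0^oo cos(2 sqrt 3 t xi) phi_d(xi) dxi,
     phi_d(xi) = sinc(sqrt(3/d) xi)^d = exp(-xi^2/2 - xi^4/(20 d) - ...).
   Hence phi_{d+1} - phi_d is close to xi^4 exp(-xi^2/2) / (20 d (d+1)), and the
   sign of I_{d+1}(t) - I_d(t) is that of
   int_0^oo cos(2 sqrt 3 t xi) xi^4 exp(-xi^2/2) dxi once d >= 12: positive when t
   is small, negative when t is close to 1/2. (The constant pi/2 never has to be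
   evaluated: it appears as the integral of sinc^2.) For 4 <= d <= 11 the explicit
   polynomials are compared by certified interval computations, and for d <= 3 by
   hand: the comparisons of I_2 with I_3 and of I_3 with I_4 produce the
   algebraic thresholds. *)

Set Implicit Arguments.
Unset Strict Implicit.
Unset Printing Implicit Defensive.

Import Order.TTheory GRing.Theory Num.Theory.
Import numFieldNormedType.Exports.

Local Open Scope classical_set_scope.
Local Open Scope ring_scope.

(** The definition of the section volume leaves the hyperplane, the base point and the orthonormal
    frame free, so the slicing formula must hold for every choice. This rests on orthogonal
    invariance of the tuple measure, obtained from the uniqueness of translation-invariant measures
    rather than from a determinant formula. The scale sqrt(3/d) makes the quadratic term of -ln
    phi_d equal to xi^2/2 for every d, so the quartic terms decide. The gain is only of order 1/d^2;
    therefore the remainder of -ln sinc is controlled in its variation and not only in size, and all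
    errors are bounded by polynomials, whose Gaussian integrals are rational multiples of the zeroth
    moment. The start d = 12 is the least d for which the zone y <= 5/2 of the expansion and the
    zone y >= 12/5 of the tail bound cover the half-line for d and d + 1 at once. In (i) only the
    pairs (2,3) and (3,4) are tight, in (ii) only (3,4): their differences vanish at the thresholds.
    Every other comparison holds on a rational interval containing the range of t. *)

Section line.
Context (R : realType).
Local Notation mu := (@lebesgue_measure R).

Definition affine (a b : R) (x : measurableTypeR R) : measurableTypeR R :=
  a * x + b.

Lemma measurable_affine (a b : R) : measurable_fun setT (affine a b).
Proof.
apply: measurable_funD; last exact: measurable_cst.
by apply: measurable_funM => //; exact: measurable_cst.
Qed.

HB.instance Definition _ (a b : R) := isMeasurableFun.Build _ _ _ _
  (affine a b) (measurable_affine a b).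

(** Both sides are measures in [A], and Lebesgue measure is determined by its values on half-open
    intervals. *)
Lemma lebesgue_measure_affine (a b : R) (A : set (measurableTypeR R)) :
  0 < a -> measurable A ->
  (mu A = a%:E * mu (affine a b @^-1` A))%E.
Proof.
move=> a0 mA.
have := @lebesgue_measure_unique R
  (mscale (PosNum a0)%:num%:nng (pushforward mu (affine a b))).
rewrite /mscale /=; apply => // X [[x y] _ <-].
rewrite /mscale /= /pushforward.
have -> : affine a b @^-1` `]x, y] = `](x - b) / a, (y - b) / a]%classic.
  apply/seteqP; split => z; rewrite /affine /= !in_itv /= ltr_pdivrMr // ler_pdivlMr //.
    by rewrite mulrC => /andP[h1 h2]; apply/andP; split; lra.
  by rewrite mulrC => /andP[h1 h2]; apply/andP; split; lra.
rewrite !lebesgue_measure_itv /= !lte_fin ltr_pM2r ?invr_gt0 // ltrD2r.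
case: ifPn => _; last by rewrite mule0.
by rewrite -!EFinB -EFinM; congr EFin; field; rewrite gt_eqF.
Qed.

Lemma ge0_integral_affine (a b : R) (f : measurableTypeR R -> \bar R) :
  0 < a -> measurable_fun [set: measurableTypeR R] f -> (forall x, 0 <= f x)%E ->
  (\int[mu]_x f x = a%:E * \int[mu]_x f (a * x + b)%R)%E.
Proof.
move=> a0 mf f0.
rewrite (_ : (\int[mu]_x f (a * x + b)%R)%E = (\int[mu]_(x in affine a b @^-1` setT) (f \o affine a b) x)%E); last first.
  by rewrite preimage_setT.
rewrite -(ge0_integral_pushforward (measurable_affine a b)) //.
have -> : a%:E = (PosNum a0)%:num%:nng%:num%:E by [].
rewrite -ge0_integral_mscale //.
apply: eq_measure_integral => A mA _.
exact: lebesgue_measure_affine.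
Qed.

End line.

(** * Lebesgue measure on R^n: slicing, translations, uniqueness up to a factor *)

Section tuple_measure.
Context (R : realType).
Local Notation mu := (@lebesgue_measure R).
Local Notation lam := (lebesgue_tuple R).

Lemma lebesgue_tupleS k (A : set (Rtuple R k.+1)) :
  (lam k.+1 A = \int[mu]_x lam k [set y | A (tcons (x, y))])%E.
Proof.
apply: eq_integral => x _ /=; congr (lam k _).
by rewrite xsectionE.
Qed.

(** Either iterated integral defines the product measure, which is unique: Tonelli for an
    indicator. *)
Lemma product_measureC d1 d2 (T1 : measurableType d1) (T2 : measurableType d2)
    (m1 : {sigma_finite_measure set T1 -> \bar R})
    (m2 : {sigma_finite_measure set T2 -> \bar R}) (X : set (T1 * T2)) :
  measurable X ->
  (\int[m1]_x m2 [set y | X (x, y)] = \int[m2]_y m1 [set x | X (x, y)])%E.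
Proof.
move=> mX; have := @product_measure_unique _ _ _ _ R m1 m2 (m1 \x^ m2)%E _ X mX.
move=> /(_ (product_measure2E m1 m2)) E.
rewrite (_ : (\int[m1]_x _)%E = (m1 \x m2)%E X); last first.
  by apply: eq_integral => x _ /=; congr (m2 _); rewrite xsectionE.
by rewrite E; apply: eq_integral => x _ /=; congr (m1 _); rewrite ysectionE.
Qed.

Lemma lebesgue_tupleS' k (A : set (Rtuple R k.+1)) : measurable A ->
  (lam k.+1 A = \int[lam k]_y mu [set x | A (tcons (x, y))])%E.
Proof.
move=> mA; rewrite lebesgue_tupleS.
rewrite (@product_measureC _ _ _ _ mu (lam k) (@tcons R k @^-1` A)) //.
by rewrite -[X in measurable X]setTI; exact: measurable_tcons.
Qed.

Lemma row_of_tupleK n (v : 'rV[R]_n) :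
  row_of_tuple ([tuple v 0 i | i < n] : Rtuple R n) = v.
Proof. by apply/rowP => i; rewrite mxE tnth_mktuple. Qed.

(** Matrices act on row vectors while the measure lives on tuples; this carries affine maps over to
    tuples. *)
Definition taff k m (M : 'M[R]_(k, m)) (p : 'rV[R]_m) (y : Rtuple R k) : Rtuple R m :=
  [tuple (p + row_of_tuple y *m M) 0 i | i < m].

Lemma row_taff k m (M : 'M[R]_(k, m)) p y :
  row_of_tuple (taff M p y) = p + row_of_tuple y *m M.
Proof. exact: row_of_tupleK. Qed.

Lemma row_of_tuple_inj k : injective (@row_of_tuple R k).
Proof.
move=> x y /rowP exy; apply: eq_from_tnth => i.
by have := exy i; rewrite !mxE.
Qed.

Lemma taff_comp k m n (M : 'M[R]_(k, m)) p (N : 'M[R]_(m, n)) q y :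
  taff N q (taff M p y) = taff (M *m N) (q + p *m N) y.
Proof.
by apply: row_of_tuple_inj; rewrite !row_taff mulmxDl addrA mulmxA.
Qed.

Lemma taff_id k y : taff (1%:M : 'M[R]_k) 0 y = y.
Proof. by apply: row_of_tuple_inj; rewrite row_taff mulmx1 add0r. Qed.

Lemma measurable_tuple_sum d (T : measurableType d) k (f : T -> Rtuple R k) (a : 'I_k -> R) :
  measurable_fun setT f -> measurable_fun setT (fun x => \sum_i tnth (f x) i * a i : measurableTypeR R).
Proof.
move=> mf; apply: (@measurable_sum _ _ R) => i.
apply: measurable_funM; last exact: measurable_cst.
by have /measurable_fun_tnthP := mf; exact.
Qed.

Lemma measurable_taff k m (M : 'M[R]_(k, m)) p : measurable_fun setT (taff M p).
Proof.
apply/measurable_fun_tnthP => i.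
rewrite (_ : _ \o _ = (fun y : Rtuple R k => p 0 i + \sum_j tnth y j * M j i)); last first.
  apply/funext => y; rewrite /= tnth_mktuple !mxE; congr (_ + _).
  by apply: eq_bigr => j _; rewrite !mxE.
apply: measurable_funD; first exact: measurable_cst.
by apply: measurable_tuple_sum; exact: measurable_id.
Qed.

HB.instance Definition _ k m (M : 'M[R]_(k, m)) p :=
  isMeasurableFun.Build _ _ _ _ (taff M p) (measurable_taff M p).

Lemma measurable_taff_preimage k m (M : 'M[R]_(k, m)) p A : measurable A ->
  measurable (taff M p @^-1` A).
Proof. by move=> mA; rewrite -[X in measurable X]setTI; exact: measurable_taff. Qed.

Lemma row_tcons k (x : R) (y : Rtuple R k) :
  row_of_tuple (tcons (x, y)) = row_mx x%:M (row_of_tuple y) :> 'rV[R]_(1 + k).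
Proof.
apply/rowP => i; rewrite !mxE /=; case: splitP => j ij.
  rewrite !mxE; have -> : i = ord0 by apply: val_inj; rewrite /= ij ord1.
  by rewrite tnth0 !ord1 eqxx mulr1n.
rewrite mxE; have -> : i = lift ord0 j by apply: val_inj; rewrite /= ij.
by rewrite tnthS.
Qed.

Lemma measurable_tcons_sectionr k (A : set (Rtuple R k.+1)) x : measurable A ->
  measurable [set y | A (tcons (x, y))].
Proof.
move=> mA; rewrite -[X in measurable X]setTI.
apply: (_ : measurable_fun setT (fun y : Rtuple R k => tcons (x, y))) => //.
by apply: measurable_cons; [exact: measurable_cst|exact: measurable_id].
Qed.

Lemma measurable_lebesgue_section k (A : set (Rtuple R k.+1)) : measurable A ->
  measurable_fun [set: measurableTypeR R] (fun x => lam k [set y | A (tcons (x, y))]).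
Proof.
move=> mA.
have mA' : measurable (@tcons R k @^-1` A).
  by rewrite -[X in measurable X]setTI; exact: measurable_tcons.
have := measurable_fun_xsection (lam k) mA'.
by congr (measurable_fun _); apply/funext => x /=; rewrite xsectionE.
Qed.

(** The recursion of [lebesgue_tuple] peels off the head coordinate, so a map can be integrated once
    its effects on head and tail are separated: [c] feeds the tail into the head, [b] the head into
    the tail. *)
Lemma taff_block k m (a : R) (b : 'rV[R]_m) (c : 'cV[R]_k) (M : 'M[R]_(k, m))
    (p : 'rV[R]_m.+1) x y :
  taff (block_mx a%:M b c M : 'M[R]_(1 + k, 1 + m)) p (tcons (x, y)) =
  tcons (a * x + (p 0 0 + (row_of_tuple y *m c) 0 0),
         taff M (rsubmx (p : 'rV[R]_(1 + m)) + x *: b) y).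
Proof.
apply: row_of_tuple_inj; rewrite row_taff !row_tcons row_taff.
rewrite (mul_row_block x%:M) !mul_scalar_mx scale_scalar_mx.
rewrite -[X in X + _](hsubmxK (p : 'rV[R]_(1 + m))) add_row_mx; congr row_mx.
  apply/matrixP => i j; rewrite !ord1 !mxE /= !mulr1n.
  by rewrite addrCA (mulrC x) (_ : lshift m 0 = ord0) //; exact: val_inj.
by rewrite addrA.
Qed.

(** Induction on the dimension: the head is shifted by the change of variables on the line, the tail
    by the induction hypothesis inside each slice. *)
Lemma lebesgue_tuple_translate k (p : 'rV[R]_k) (A : set (Rtuple R k)) : measurable A ->
  lam k (taff 1%:M p @^-1` A) = lam k A.
Proof.
elim: k p A => [|k IH] p A mA.
  congr (lam 0 _); apply/seteqP; split => y /=;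
    by rewrite (_ : taff _ _ y = y) //; apply: eq_from_tnth; case.
rewrite !lebesgue_tupleS.
pose phi x := lam k [set y | A (tcons (x, y))].
have mphi := measurable_lebesgue_section mA.
transitivity (\int[mu]_x phi (affine 1 (p 0 0)%R x))%E; last first.
  by rewrite [RHS](ge0_integral_affine (p 0 0) ltr01) ?mul1e.
apply: eq_integral => x _.
pose p' : 'rV[R]_k := rsubmx (p : 'rV[R]_(1 + k)).
rewrite /phi -[RHS](IH p'); last exact: measurable_tcons_sectionr.
congr (lam k _); apply/seteqP; split => y /=;
  rewrite (_ : taff _ _ _ = tcons (affine 1 (p 0 0) x, taff 1%:M p' y)) //;
  by rewrite [1%:M](@scalar_mx_block _ 1 k) taff_block /= mulmx0 mxE addr0 scaler0 addr0.
Qed.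

Section linear_push.
Variables (k : nat) (M : 'M[R]_k).
Hypothesis uM : M \in unitmx.

Definition lin_push : set (Rtuple R k) -> \bar R := pushforward (lam k) (taff M 0).

Let lin_push0 : lin_push set0 = 0%E.
Proof. exact: measure0. Qed.

Let lin_push_ge0 A : (0 <= lin_push A)%E.
Proof. exact: measure_ge0. Qed.

Let lin_push_sigma_additive : semi_sigma_additive lin_push.
Proof. exact: measure_semi_sigma_additive. Qed.

HB.instance Definition _ := isMeasure.Build _ _ _ lin_push
  lin_push0 lin_push_ge0 lin_push_sigma_additive.

Let lin_push_sigma_finite : sigma_finite setT lin_push.
Proof.
have /sigma_finiteP[F [FT ndF Foo]] := sigma_finiteT (lam k).
exists (fun i => taff (invmx M) 0 @^-1` F i).
  by rewrite -preimage_bigcup -FT preimage_setT.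
move=> i; have [mF Fi] := Foo i; split; first exact: measurable_taff_preimage.
rewrite /lin_push /pushforward (_ : _ @^-1` _ = F i) //.
by apply/seteqP; split => y /=; rewrite taff_comp mulmxV // mul0mx addr0 taff_id.
Qed.

HB.instance Definition _ := Measure_isSigmaFinite.Build _ _ _ lin_push
  lin_push_sigma_finite.

(** Translating the image by [p] amounts to translating the source by [p *m invmx M]. *)
Lemma lin_push_translate p (A : set (Rtuple R k)) : measurable A ->
  lin_push (taff 1%:M p @^-1` A) = lin_push A.
Proof.
move=> mA; rewrite /lin_push /pushforward -comp_preimage.
rewrite -[RHS](@lebesgue_tuple_translate k (p *m invmx M)); last exact: measurable_taff_preimage.
rewrite -[in RHS]comp_preimage.
suff -> : taff 1%:M p \o taff M 0 = taff M 0 \o taff 1%:M (p *m invmx M) by [].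
apply/funext => y /=.
by rewrite !taff_comp mul0mx mulmx1 mul1mx -mulmxA mulVmx // mulmx1 addr0 add0r.
Qed.

(** The classical proof that translation-invariant measures are proportional. The set of pairs with
    x in A and y - x in B is measured in both orders: slices at fixed x are translates of B, and
    slices at fixed y become, after shifting x by y, the conditions -x in B and x + y in A. Applied
    with the unit cube as [B], this makes [lin_push] a multiple of [lam k]. *)
Lemma lin_pushM (A B : set (Rtuple R k)) : measurable A -> measurable B ->
  (lin_push A * lam k B = lin_push (taff (- 1%:M) 0 @^-1` B) * lam k A)%E.
Proof.
move=> mA mB.
pose E := [set z : Rtuple R k * Rtuple R k | A z.1 /\ B (taff 1%:M (- row_of_tuple z.1) z.2)].
pose E' := [set z : Rtuple R k * Rtuple R k |
  B (taff (- 1%:M) 0 z.1) /\ A (taff 1%:M (row_of_tuple z.2) z.1)].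
have mT (a b : R) : measurable_fun setT (fun z : Rtuple R k * Rtuple R k =>
    [tuple a * tnth z.1 i + b * tnth z.2 i | i < k] : Rtuple R k).
  apply/measurable_fun_tnthP => i.
  rewrite (_ : _ \o _ = (fun z : Rtuple R k * Rtuple R k => a * tnth z.1 i + b * tnth z.2 i)); last first.
    by apply/funext => z /=; rewrite tnth_mktuple.
  apply: measurable_funD; (apply: measurable_funM; first exact: measurable_cst).
    by apply: (measurableT_comp (measurable_tnth i)); exact: measurable_fst.
  by apply: (measurableT_comp (measurable_tnth i)); exact: measurable_snd.
have mP (f : Rtuple R k * Rtuple R k -> Rtuple R k) (C : set (Rtuple R k)) :
    measurable_fun setT f -> measurable C -> measurable [set z | C (f z)].
  by move=> mf mC; rewrite -[X in measurable X]setTI; exact: mf.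
have mE : measurable E.
  apply: measurableI; first by apply: mP => //; exact: measurable_fst.
  apply: mP => //; rewrite (_ : (fun z => _) =
    (fun z => [tuple (-1) * tnth z.1 i + 1 * tnth z.2 i | i < k])); first exact: mT.
  apply/funext => z; apply: eq_from_tnth => i.
  by rewrite !tnth_mktuple mulmx1 !mxE mulN1r mul1r.
have mE' : measurable E'.
  apply: measurableI.
    apply: mP => //; apply: (measurableT_comp (measurable_taff (- 1%:M) 0)).
    exact: measurable_fst.
  apply: mP => //; rewrite (_ : (fun z => _) =
    (fun z => [tuple 1 * tnth z.1 i + 1 * tnth z.2 i | i < k])); first exact: mT.
  apply/funext => z; apply: eq_from_tnth => i.
  by rewrite !tnth_mktuple mulmx1 !mxE !mul1r addrC.
have C1 := @product_measureC _ _ _ _ lin_push (lam k) E mE.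
have C2 := @product_measureC _ _ _ _ lin_push (lam k) E' mE'.
have indI (C : set (Rtuple R k)) (c : \bar R) : measurable C -> (0 <= c)%E ->
    (\int[lin_push]_x (if x \in C then c else 0) = lin_push C * c)%E.
  move=> mC c0; rewrite muleC -integral_cst // [RHS]integral_mkcond.
  by apply: eq_integral => x _; rewrite patchE.
transitivity (\int[lin_push]_x lam k [set y | E (x, y)])%E.
  rewrite -indI //; apply: eq_integral => x _; rewrite /E /=.
  case: ifPn => [/set_mem|/negP] Ax.
    rewrite -(lebesgue_tuple_translate (- row_of_tuple x) mB); congr (lam k _).
    by apply/seteqP; split => y /= => [|[]].
  rewrite (_ : [set _ | _] = set0) ?measure0 //.
  by apply/seteqP; split => // y /= [/mem_set].
rewrite C1.
transitivity (\int[lin_push]_x lam k [set y | E' (x, y)])%E.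
  rewrite C2; apply: eq_integral => y _.
  (* The shift of x by y uses the invariance of [lin_push]; it turns y - x into -x. *)
  transitivity (lin_push (taff 1%:M (row_of_tuple y) @^-1` [set x | E (x, y)])).
    apply/esym/lin_push_translate.
    by have := measurable_ysection y mE; rewrite ysectionE.
  suff -> : taff 1%:M (row_of_tuple y) @^-1` [set x | E (x, y)] = [set x | E' (x, y)] by [].
  have S x : taff 1%:M (- (row_of_tuple y + row_of_tuple x)) y = taff (- 1%:M) 0 x.
    by apply: row_of_tuple_inj; rewrite !row_taff mulmx1 mulmxN mulmx1 opprD add0r addrAC addNr add0r.
  by apply/seteqP; split => x /=; rewrite /E /E' /= row_taff mulmx1 S => -[].
rewrite -indI //; last exact: measurable_taff_preimage.
apply: eq_integral => x _; rewrite /E' /=.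
case: ifPn => [/set_mem|/negP] Bx.
  rewrite -(lebesgue_tuple_translate (row_of_tuple x) mA); congr (lam k _).
  have S y : taff 1%:M (row_of_tuple y) x = taff 1%:M (row_of_tuple x) y.
    by apply: row_of_tuple_inj; rewrite !row_taff !mulmx1 addrC.
  by apply/seteqP; split => y /=; rewrite S => // -[].
rewrite (_ : [set _ | _] = set0) ?measure0 //.
by apply/seteqP; split => // y /= [/mem_set].
Qed.
End linear_push.
End tuple_measure.

(** * The volume ratio of a linear map and the projection of a hyperplane *)

Section ratio.
Context (R : realType).
Local Notation mu := (@lebesgue_measure R).
Local Notation lam := (lebesgue_tuple R).

Definition box k (a b : R) : set (Rtuple R k) := [set y | forall i, a <= tnth y i <= b].

Lemma measurable_box k a b : measurable (@box k a b).
Proof.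
rewrite (_ : box a b = \bigcap_(i in [set: 'I_k]) ((fun y : Rtuple R k => tnth y i) @^-1` `[a, b])).
  apply: fin_bigcap_measurable; first exact: finite_finset.
  move=> i _; rewrite -[X in measurable X]setTI; apply: measurable_tnth => //.
by apply/seteqP; split => y yab i; [move=> _; rewrite /= in_itv /=; exact: yab|
  have := yab i I; rewrite /= in_itv].
Qed.

Lemma box_tcons k a b x (y : Rtuple R k) :
  box a b (tcons (x, y)) <-> a <= x <= b /\ box a b y.
Proof.
split=> [h|[hx hy] i].
  by split=> [|i]; [have := h ord0; rewrite tnth0|have := h (lift ord0 i); rewrite tnthS].
by case: (unliftP ord0 i) => [j|] ->; rewrite ?tnth0 // tnthS.
Qed.

Lemma integral_itv_cst (a b : R) (c : \bar R) : (0 <= c)%E -> a <= b ->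
  (\int[mu]_x (if x \in `[a, b] then c else 0) = (b - a)%:E * c)%E.
Proof.
move=> c0 ab.
rewrite -[RHS]muleC (_ : (b - a)%:E = mu `[a, b]); last first.
  rewrite lebesgue_measure_itv /= lte_fin.
  by case: ltP => [_|ba]; [rewrite EFinB|rewrite (le_anti (introT andP (conj ab ba))) subrr].
rewrite -integral_cst // [RHS]integral_mkcond; apply: eq_integral => x _.
by rewrite patchE mem_setE.
Qed.

Lemma lebesgue_tuple_box k a b : a <= b -> (lam k (box a b) = ((b - a) ^+ k)%:E)%E.
Proof.
move=> ab; elim: k => [|k IH].
  rewrite /= diracE expr0 mem_set //; by case.
rewrite lebesgue_tupleS.
have -> : (\int[mu]_x lam k [set y | box a b (tcons (x, y))] =
    \int[mu]_x (if x \in `[a, b] then ((b - a) ^+ k)%:E else 0))%E.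
  apply: eq_integral => x _; rewrite in_itv /=; case: ifPn => [axb|nab].
    by rewrite -IH; congr (lam k _); apply/seteqP; split => y /=; rewrite box_tcons => // -[].
  rewrite (_ : [set _ | _] = set0) ?measure0 //.
  by apply/seteqP; split => y //=; rewrite box_tcons => -[axb]; rewrite axb in nab.
by rewrite integral_itv_cst ?lee_fin ?exprn_ge0 ?subr_ge0 // -EFinM exprS.
Qed.

Definition ucube k : set (Rtuple R k) := box 0 1.

Lemma ucube_tcons k x (y : Rtuple R k) :
  ucube (tcons (x, y)) <-> 0 <= x <= 1 /\ ucube y.
Proof. exact: box_tcons. Qed.

Lemma measurable_ucube k : measurable (@ucube k).
Proof. exact: measurable_box. Qed.

Lemma lebesgue_tuple_ucube k : lam k (@ucube k) = 1%E.
Proof. by rewrite lebesgue_tuple_box ?ler01 // subr0 expr1n. Qed.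

(** For invertible [M] this is 1 / |det M|. It is handled through its multiplicativity and its
    values on orthogonal and block triangular matrices. *)
Definition lin_ratio k (M : 'M[R]_k) : \bar R := lam k (taff M 0 @^-1` @ucube k).

(** [lin_pushM] against the unit cube gives a multiple of [lam k A]; its instance with the cube also
    in place of [A] identifies the factor. *)
Lemma lebesgue_tuple_lin k (M : 'M[R]_k) (A : set (Rtuple R k)) : M \in unitmx ->
  measurable A -> (lam k (taff M 0 @^-1` A) = lin_ratio M * lam k A)%E.
Proof.
move=> uM mA.
have h B mB := @lin_pushM R k M uM B (@ucube k) mB (@measurable_ucube k).
have := h A mA; rewrite /lin_push /pushforward lebesgue_tuple_ucube mule1 => ->.
have := h _ (@measurable_ucube k).
by rewrite /lin_push /pushforward lebesgue_tuple_ucube !mule1 => <-.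
Qed.

Lemma lin_ratioM k (M N : 'M[R]_k) : M \in unitmx -> N \in unitmx ->
  (lin_ratio (M *m N) = lin_ratio M * lin_ratio N)%E.
Proof.
move=> uM uN; rewrite -lebesgue_tuple_lin //; last first.
  by apply: measurable_taff_preimage; exact: measurable_ucube.
rewrite /lin_ratio -comp_preimage.
suff -> : taff N 0 \o taff M 0 = taff (M *m N) 0 by [].
by apply/funext => y /=; rewrite taff_comp mul0mx addr0.
Qed.

Lemma orthogonal_unitmx k (O : 'M[R]_k) : O *m O^T = 1%:M -> O \in unitmx.
Proof. by move=> /mulmx1_unit []. Qed.

Definition sqnorm k (y : Rtuple R k) : R := (row_of_tuple y *m (row_of_tuple y)^T) 0 0.

Lemma sqnormE k (y : Rtuple R k) : sqnorm y = \sum_i (tnth y i) ^+ 2.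
Proof. by rewrite /sqnorm mxE; apply: eq_bigr => i _; rewrite !mxE. Qed.

(** An orthogonal map preserves the ball |y|^2 <= k. This ball contains the unit cube and lies in
    [-k, k]^k, so its measure is positive and finite and can be cancelled. *)
Lemma lin_ratio_orthogonal k (O : 'M[R]_k) : O *m O^T = 1%:M -> lin_ratio O = 1%E.
Proof.
move=> oO; pose ball := [set y : Rtuple R k | sqnorm y <= k%:R].
have mb : measurable ball.
  rewrite (_ : ball = @sqnorm k @^-1` `]-oo, k%:R]); last first.
    by apply/seteqP; split => y; rewrite /ball /= in_itv.
  rewrite -[X in measurable X]setTI.
  suff : measurable_fun setT (@sqnorm k : _ -> measurableTypeR R) by apply => //; exact: measurable_itv.
  rewrite (_ : @sqnorm k = fun y => \sum_i tnth y i * tnth y i); last first.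
    by apply/funext => y; rewrite sqnormE; apply: eq_bigr => i _; rewrite expr2.
  apply: (@measurable_sum _ _ R) => i; apply: measurable_funM; exact: measurable_tnth.
have b1 : (1 <= lam k ball)%E.
  rewrite -(lebesgue_tuple_ucube k); apply: le_measure; rewrite ?inE //; first exact: measurable_ucube.
  move=> y yc; rewrite /ball /= sqnormE.
  rewrite (le_trans (y := \sum_(i < k) 1)) //; last by rewrite sumr_const card_ord.
  by apply: ler_sum => i _; have /andP[y0 y1] := yc i; rewrite expr_le1.
have boo : (lam k ball < +oo)%E.
  rewrite (@le_lt_trans _ _ (lam k (box (- k%:R) k%:R))) //; last first.
    by rewrite lebesgue_tuple_box ?ltry // (@le_trans _ _ 0) ?oppr_le0 ?ler0n.
  apply: le_measure; rewrite ?inE //; first exact: measurable_box.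
  move=> y; rewrite /ball /= sqnormE => yk i.
  rewrite -ler_norml -(@ler_pXn2r _ 2) ?nnegrE ?ler0n // -normrX ger0_norm ?sqr_ge0 //.
  apply: (@le_trans _ _ k%:R).
    by apply: le_trans yk; rewrite (bigD1 i) //= lerDl sumr_ge0 // => j _; rewrite sqr_ge0.
  rewrite -natrX ler_nat; case: (k) i => [[]//|n] _; by rewrite -{1}[n.+1]muln1 -mulnn leq_mul.
have E : (lin_ratio O * lam k ball = lam k ball)%E.
  rewrite -lebesgue_tuple_lin ?orthogonal_unitmx //; congr (lam k _).
  apply/seteqP; split => y; rewrite /ball /= /sqnorm row_taff add0r trmx_mul;
    by rewrite mulmxA -(mulmxA (row_of_tuple y)) oO mulmx1.
have bfin : lam k ball \is a fin_num by rewrite ge0_fin_numE.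
have r0 : (0 <= lin_ratio O)%E by exact: measure_ge0.
move: E b1; rewrite -(fineK bfin); case: (lin_ratio O) r0 => [r _||//].
  rewrite -EFinM lee_fin => -[rb] b1; congr EFin; apply/eqP.
  have b0 : fine (lam k ball) != 0 by rewrite gt_eqF // (lt_le_trans ltr01).
  by rewrite -(inj_eq (mulIf b0)) mul1r rb.
by move=> _ + b1; rewrite gt0_mulye // lte_fin (lt_le_trans ltr01).
Qed.

(** For a fixed tail the admissible heads form a translate of [0, 1], hence the slices are
    integrated tail first. *)
Lemma lin_ratio_lower k (c : 'cV[R]_k) (M : 'M[R]_k) :
  lin_ratio (block_mx 1%:M 0 c M : 'M[R]_(1 + k)) = lin_ratio M.
Proof.
rewrite {1}/lin_ratio lebesgue_tupleS'; last first.
  by apply: measurable_taff_preimage; exact: measurable_ucube.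
have mA : measurable (taff M 0 @^-1` @ucube k).
  by apply: measurable_taff_preimage; exact: measurable_ucube.
rewrite /lin_ratio -[RHS]mul1e -integral_cst // [RHS]integral_mkcond.
apply: eq_integral => y _; rewrite patchE.
pose q := (row_of_tuple y *m c) 0 0.
have T x : taff (block_mx 1%:M 0 c M : 'M[R]_(1 + k)) 0 (tcons (x, y)) =
    tcons (x + q, taff M 0 y).
  by rewrite taff_block mul1r mxE add0r scaler0 addr0 linear0.
case: ifPn => [/set_mem My|/negP Mny].
  rewrite (_ : [set x | _] = `[- q, 1 - q]%classic); last first.
    apply/seteqP; split => x /=; rewrite in_itv /= T ucube_tcons.
      by move=> [/andP[h1 h2] _]; apply/andP; split; lra.
    by move=> /andP[h1 h2]; split => //; apply/andP; split; lra.
  rewrite lebesgue_measure_itv /= lte_fin ltrBrDr addNr ltr01 -EFinD; congr EFin; ring.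
rewrite (_ : [set x | _] = set0) ?measure0 //.
by apply/seteqP; split => x //=; rewrite T ucube_tcons => -[_ /mem_set].
Qed.

(** For a fixed head the admissible tails form a translated unit cube, and the admissible heads form
    the interval between 0 and 1/a. *)
Lemma lin_ratio_upper k (a : R) (b : 'rV[R]_k) : a != 0 ->
  lin_ratio (block_mx a%:M b 0 1%:M : 'M[R]_(1 + k)) = (`|a|^-1)%:E.
Proof.
move=> a0; rewrite /lin_ratio lebesgue_tupleS.
have T x y : taff (block_mx a%:M b 0 1%:M : 'M[R]_(1 + k)) 0 (tcons (x, y)) =
    tcons (a * x, taff 1%:M (x *: b) y).
  by rewrite taff_block mulmx0 !mxE !addr0 linear0 add0r.
pose u := Num.min 0 a^-1; pose v := Num.max 0 a^-1.
have uv : u <= v by rewrite /u /v ge_min le_max lexx.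
have vu : v - u = `|a|^-1.
  rewrite -normfV /u /v; have [h|h] := leP 0 a^-1; first by rewrite subr0 ger0_norm.
  by rewrite ltr0_norm // sub0r.
have mem x : (0 <= a * x <= 1) = (x \in `[u, v]).
  rewrite in_itv /= /u /v ge_min le_max.
  have [a_gt0|a_lt0|/eqP] := ltgtP 0 a; last by rewrite eq_sym (negbTE a0).
    rewrite pmulr_rge0 // mulrC -ler_pdivlMr // div1r.
    have ai : 0 < a^-1 by rewrite invr_gt0.
    apply/andP/andP => [[-> ->]|[/orP h1 /orP h2]]; first by rewrite orbT.
    split; [case: h1 => //|case: h2 => //] => h; [exact: le_trans (ltW ai) h|].
    exact: le_trans h (ltW ai).
  rewrite nmulr_rge0 // mulrC -ler_ndivrMr // div1r.
  have ai : a^-1 < 0 by rewrite invr_lt0.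
  apply/andP/andP => [[-> ->]|[/orP h1 /orP h2]]; first by rewrite orbT.
  split; [case: h2 => //|case: h1 => //] => h; [exact: le_trans h (ltW ai)|].
  exact: le_trans (ltW ai) h.
rewrite -vu -[RHS]mule1 -integral_itv_cst ?lee_fin //.
apply: eq_integral => x _; rewrite -mem; case: ifPn => [ax|nax].
  rewrite -(@lebesgue_tuple_ucube k) -[RHS](@lebesgue_tuple_translate _ _ (x *: b)); last exact: measurable_ucube.
  congr (lam k _); apply/seteqP; split => y /=; rewrite T ucube_tcons; first by case.
  by split.
rewrite (_ : [set _ | _] = set0) ?measure0 //.
by apply/seteqP; split => y //=; rewrite T ucube_tcons => -[ax]; rewrite ax in nax.
Qed.

(** Dropping the first coordinate maps the hyperplane orthogonal to [n] onto R^k and multiplies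
    volumes by |n_0|, the cosine of the angle between the two hyperplanes. The factorization U O =
    L, with U and L block triangular and O orthogonal, gives the ratio of [rsubmx B]. *)
Lemma lebesgue_tuple_frame k (n : 'rV[R]_(1 + k)) (B : 'M[R]_(k, 1 + k))
    (p : 'rV[R]_k) (A : set (Rtuple R k)) :
  col_mx n B *m (col_mx n B)^T = 1%:M -> n 0 0 != 0 -> measurable A ->
  (lam k (taff (rsubmx B) p @^-1` A) = (`|n 0 0%R|^-1)%:E * lam k A)%E.
Proof.
move=> oO n0 mA; set O := col_mx n B in oO.
have uO := orthogonal_unitmx oO.
pose b := (lsubmx B)^T.
pose U : 'M[R]_(1 + k) := block_mx (n 0 0)%:M b 0 1%:M.
pose L : 'M[R]_(1 + k) := block_mx 1%:M 0 (lsubmx B) (rsubmx B).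
(* The first row reads n_0 n + b B = e_0, which is the first row of O^T O = 1. *)
have UO : U *m O = L.
  rewrite /U /O /L mul_block_col mul0mx mul1mx add0r block_mxEv hsubmxK; congr col_mx.
  have := mulmx1C oO; rewrite tr_col_mx mul_row_col => E.
  have := congr1 (@usubmx R 1 k (1 + k)) E.
  rewrite linearD /= -!mul_usub_mx -!trmx_lsub -/b (scalar_mx_block 1 k) block_mxEv col_mxKu => <-.
  rewrite (_ : lsubmx n = (n 0 0)%:M) ?tr_scalar_mx //.
  apply/matrixP => i j; rewrite !ord1 !mxE mulr1n; congr (n _ _); exact: val_inj.
have uU : U \in unitmx.
  by rewrite unitmxE det_ublock det_scalar1 det1 mulr1 unitfE.
have uB : rsubmx B \in unitmx.
  have : L \in unitmx by rewrite -UO unitmx_mul uU uO.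
  by rewrite !unitmxE det_lblock det1 mul1r.
have rB : lin_ratio (rsubmx B) = (`|n 0 0|^-1)%:E.
  rewrite -(lin_ratio_lower (lsubmx B)) -/L -UO lin_ratioM //.
  by rewrite (lin_ratio_orthogonal oO) mule1 lin_ratio_upper.
rewrite -rB -(lebesgue_tuple_translate p mA) -lebesgue_tuple_lin //; last first.
  exact: measurable_taff_preimage.
rewrite -comp_preimage.
suff -> : taff 1%:M p \o taff (rsubmx B) 0 = taff (rsubmx B) p by [].
by apply/funext => y /=; rewrite taff_comp mul0mx addr0 mulmx1.
Qed.
End ratio.

(** * Sections of the cube as volumes of slabs *)

Section section_volume.
Context (R : realType).
Local Notation lam := (lebesgue_tuple R).

Lemma lebesgue_tuple_isometry k (O : 'M[R]_k) p (A : set (Rtuple R k)) :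
  O *m O^T = 1%:M -> measurable A -> lam k (taff O p @^-1` A) = lam k A.
Proof.
move=> oO mA; rewrite -(lebesgue_tuple_translate p mA) -[RHS]mul1e.
rewrite -(lin_ratio_orthogonal oO) -lebesgue_tuple_lin ?orthogonal_unitmx //; last first.
  exact: measurable_taff_preimage.
rewrite -comp_preimage.
suff -> : taff 1%:M p \o taff O 0 = taff O p by [].
by apply/funext => y /=; rewrite taff_comp mul0mx addr0 mulmx1.
Qed.

Lemma dotmulE d (u v : 'rV[R]_d) : dotmul u v = (u *m v^T) 0 0.
Proof. by rewrite /dotmul mxE; apply: eq_bigr => i _; rewrite mxE. Qed.

Lemma dotmulDl d (u v w : 'rV[R]_d) : dotmul (u + v) w = dotmul u w + dotmul v w.
Proof. by rewrite !dotmulE mulmxDl mxE. Qed.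

Lemma dotmulZl d a (u v : 'rV[R]_d) : dotmul (a *: u) v = a * dotmul u v.
Proof. by rewrite !dotmulE -scalemxAl mxE. Qed.

Lemma dotmulC d (u v : 'rV[R]_d) : dotmul u v = dotmul v u.
Proof. by apply: eq_bigr => i _; rewrite mulrC. Qed.

Lemma dotmulBl d (u v w : 'rV[R]_d) : dotmul (u - v) w = dotmul u w - dotmul v w.
Proof. by rewrite dotmulDl -scaleN1r dotmulZl mulN1r. Qed.

Lemma dotmulZr d a (u v : 'rV[R]_d) : dotmul u (a *: v) = a * dotmul u v.
Proof. by rewrite dotmulC dotmulZl dotmulC. Qed.

Lemma dotmul_ge0 d (u : 'rV[R]_d) : 0 <= dotmul u u.
Proof. by apply: sumr_ge0 => i _; rewrite -expr2 sqr_ge0. Qed.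

(** The lower bound is the Cauchy-Schwarz inequality, read off from the positivity of the square of
    x - y - dl n; the orthogonal projection of x attains it. *)
Lemma set_edist_hyperplane d (x n : 'rV[R]_d) (b : R) : dotmul n n = 1 ->
  set_edist x (hyperplane n b) = `|dotmul x n - b|.
Proof.
move=> nn; set dl := dotmul x n - b.
have E y : hyperplane n b y -> `|dl| <= enorm (x - y).
  rewrite /hyperplane /= => yb.
  rewrite -sqrtr_sqr ler_wsqrtr //.
  move: (dotmul_ge0 (x - y - dl *: n)).
  have xyn : dotmul (x - y) n = dl by rewrite dotmulBl yb.
  move: xyn; move: (x - y) => a an.
  rewrite dotmulBl dotmulZl (dotmulC a) (dotmulC n) !dotmulBl !dotmulZl nn (dotmulC n) an.
  by rewrite mulr1 subrr mulr0 subr0 subr_ge0 expr2.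
have y0 : hyperplane n b (x - dl *: n).
  by rewrite /hyperplane /= dotmulBl dotmulZl nn mulr1 subKr.
have e0 : enorm (x - (x - dl *: n)) = `|dl|.
  by rewrite subKr /enorm dotmulZl dotmulC dotmulZl nn mulr1 -expr2 sqrtr_sqr.
apply/eqP; rewrite eq_le; apply/andP; split.
  rewrite -e0; apply: ge_inf; last by exists (x - dl *: n).
  by exists 0 => _ [y _ <-]; rewrite sqrtr_ge0.
apply: lb_le_inf; first by exists (enorm (x - (x - dl *: n))), (x - dl *: n).
by move=> _ [y yb <-]; exact: E.
Qed.

(** The Householder reflection exchanging e_0 and [n] is symmetric and orthogonal with first row
    [n]; its other rows are the frame. If [n] is e_0 already, the reflection degenerates and the
    identity serves. *)
Lemma orthonormal_completion k (n : 'rV[R]_(1 + k)) : dotmul n n = 1 ->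
  exists B : 'M[R]_(k, 1 + k), col_mx n B *m (col_mx n B)^T = 1%:M.
Proof.
move=> nn; pose e : 'rV[R]_(1 + k) := row_mx 1%:M 0.
have ee : dotmul e e = 1.
  by rewrite dotmulE /e tr_row_mx mul_row_col trmx0 mulmx0 addr0 tr_scalar_mx mulmx1 mxE.
suff [Q [QT QQ eQ]] : exists Q : 'M[R]_(1 + k), [/\ Q^T = Q, Q *m Q = 1%:M & e *m Q = n].
  exists (dsubmx Q); suff -> : col_mx n (dsubmx Q) = Q by rewrite QT QQ.
  by rewrite -eQ -{1}(vsubmxK Q) /e mul_row_col mul1mx mul0mx addr0 vsubmxK.
pose v := e - n; pose q := dotmul v v.
have [q0|q0] := eqVneq q 0.
  exists 1%:M; split; rewrite ?trmx1 ?mulmx1 //.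
  apply/eqP; rewrite -subr_eq0 -/v; apply/eqP/rowP => i.
  have /eqP := q0; rewrite psumr_eq0 => [/allP/(_ i)|j _]; last by rewrite -expr2 sqr_ge0.
  by rewrite mem_index_enum mulf_eq0 orbb !mxE => /(_ isT)/eqP.
exists (1%:M - (2 / q) *: (v^T *m v)).
have vv : v *m v^T = q%:M.
  by rewrite [LHS]mx11_scalar -dotmulE.
have vee : e *m v^T = (q / 2)%:M.
  rewrite [LHS]mx11_scalar -dotmulE; congr _%:M.
  have : q = 2 - 2 * dotmul e n.
    by rewrite /q /v dotmulBl !(dotmulC _ (e - n)) !dotmulBl ee nn (dotmulC n e); ring.
  by rewrite (dotmulC e v) [dotmul v e]dotmulBl ee (dotmulC n) => ->; field.
have q2 : 2 / q * q = 2 by rewrite divfK.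
pose P := v^T *m v.
have PP : P *m P = q *: P.
  by rewrite /P mulmxA -(mulmxA v^T v) vv mul_mx_scalar -scalemxAl.
rewrite -/P; split.
- by rewrite linearB /= trmx1 linearZ /= trmx_mul trmxK.
- set c := 2 / q in q2 *.
  rewrite mulmxBl mul1mx mulmxBr mulmx1 -scalemxAl -scalemxAr PP !scalerA.
  by rewrite -mulrA q2 mulr2n mulrDr mulr1 scalerDl opprB !addrA subrK addrK.
- rewrite mulmxBr mulmx1 -scalemxAr /P mulmxA vee mul_scalar_mx scalerA.
  by rewrite (_ : 2 / q * (q / 2) = 1) ?scale1r ?subKr //; field.
Qed.

(** The projection to R^k of the section of the (k+1)-cube by the hyperplane where the coordinates
    sum to s: the last condition bounds the coordinate that was dropped. *)
Definition slab k (s : R) : set (Rtuple R k) :=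
  [set z | ucube z /\ 0 <= s - \sum_i tnth z i <= 1].

Lemma measurable_affine_slab k (a b : R) (c : 'I_k -> R) :
  measurable [set z : Rtuple R k | ucube z /\ 0 <= a * (b - \sum_i tnth z i * c i) <= 1].
Proof.
apply: measurableI; first exact: measurable_ucube.
rewrite (_ : (fun z => _) = (fun z : Rtuple R k => a * (b - \sum_i tnth z i * c i)) @^-1` `[0, 1]); last first.
  by apply/seteqP; split => z /=; rewrite in_itv.
rewrite -[X in measurable X]setTI.
suff : measurable_fun setT (fun z : Rtuple R k => a * (b - \sum_i tnth z i * c i) : measurableTypeR R) by exact.
apply: measurable_funM; first exact: measurable_cst.
apply: measurable_funB; first exact: measurable_cst.
by apply: measurable_tuple_sum; exact: measurable_id.
Qed.

Lemma measurable_slab k s : measurable (@slab k s).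
Proof.
have := @measurable_affine_slab k 1 s (fun=> 1).
have E (z : Rtuple R k) : \sum_i tnth z i * 1 = \sum_i tnth z i.
  by apply: eq_bigr => i _; rewrite mulr1.
by congr measurable; apply/seteqP; split => z /=; rewrite mul1r /slab /= E.
Qed.

(** The entries 1 - 2 w_i are signs. Together with the translation by [w], this matrix is the
    symmetry of the cube replacing z_i by 1 - z_i where w_i = 1. *)
Lemma dotmul_diag k (w : 'rV[R]_k) : vertex w ->
  diag_mx (const_mx 1 - w *+ 2) *m (diag_mx (const_mx 1 - w *+ 2))^T = 1%:M.
Proof.
move=> vw; rewrite tr_diag_mx mulmx_diag -diag_const_mx; congr diag_mx.
by apply/rowP => i; rewrite !mxE; case: (vw i) => ->; ring.
Qed.

(** The central symmetry of the cube sends total coordinate sum s to k + 1 - s. *)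
Lemma slab_reflect k s : lam k (@slab k (k.+1%:R - s)) = lam k (@slab k s).
Proof.
have v1 : vertex (const_mx 1 : 'rV[R]_k) by move=> i; rewrite mxE; right.
rewrite -(@lebesgue_tuple_isometry _ _ (const_mx 1) (@slab k s) (dotmul_diag v1)); last exact: measurable_slab.
have T (y : Rtuple R k) i : tnth (taff (diag_mx (const_mx 1 - const_mx 1 *+ 2)) (const_mx 1) y) i = 1 - tnth y i.
  by rewrite tnth_mktuple mul_mx_diag !mxE; ring.
congr (lam k _); apply/seteqP; split => y; rewrite /slab /ucube /box /= => -[h1 h2]; split.
- by move=> i; rewrite T; have := h1 i; lra.
- rewrite (eq_bigr _ (fun i _ => T y i)) sumrB sumr_const card_ord; move: h2; rewrite -natr1; lra.
- by move=> i; have := h1 i; rewrite T; lra.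
- by move: h2; rewrite (eq_bigr _ (fun i _ => T y i)) sumrB sumr_const card_ord -natr1; lra.
Qed.

(** The normal has entries u_i = 1 or -1, so each coordinate of the unit normal is 1/sqrt d in
    absolute value, and projecting out the first coordinate costs the factor sqrt d whatever the
    frame. Symmetries of the cube then bring the diagonal to direction (1,...,1). *)
Lemma section_volume_slab k t v : is_section_volume k.+1 t v ->
  v = ((Num.sqrt k.+1%:R)%:E * lam k (@slab k (k.+1%:R / 2 + t * Num.sqrt k.+1%:R)))%E.
Proof.
move=> [H [[w [b [vw HE]]] dH [p [B [oB HB ->]]]]].
set d : R := k.+1%:R in dH *.
set u := opposite_vertex w - w in HE.
have ui i : u 0 i = 1 - 2 * w 0 i by rewrite !mxE; ring.
have uu1 i : u 0 i * u 0 i = 1 by rewrite ui; case: (vw i) => ->; ring.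
have uu : dotmul u u = d.
  by rewrite /dotmul (eq_bigr _ (fun i _ => uu1 i)) sumr_const card_ord.
have d0 : 0 < d by rewrite ltr0n.
set r := Num.sqrt d in dH *.
have r0 : 0 < r by rewrite sqrtr_gt0.
have rr : r * r = d by rewrite -expr2 sqr_sqrtr ?ltW.
pose n : 'rV[R]_(1 + k) := r^-1 *: u.
have nn : dotmul n n = 1.
  by rewrite /n dotmulZl dotmulC dotmulZl uu -rr; field; rewrite gt_eqF.
have Hn : H = hyperplane n (b / r).
  rewrite HE; apply/seteqP; split => x; rewrite /hyperplane /= dotmulZr mulrC.
    by move=> ->.
  by move=> /(congr1 ( *%R^~ r)); rewrite !divfK // gt_eqF.
have inH y : dotmul (p + y *m B) u = b.
  have : H (p + y *m B) by rewrite HB; exists y.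
  by rewrite HE.
(* Compare [inH] at a basis vector and at 0. *)
have Bu : B *m u^T = 0.
  apply/row_matrixP => i; rewrite row0 row_mul rowE.
  have := inH (delta_mx 0 i); rewrite dotmulDl => /eqP.
  have := inH 0; rewrite mul0mx addr0 => ->; rewrite eq_sym addrC -subr_eq subrr eq_sym dotmulE => /eqP h.
  by apply/matrixP => a c; rewrite !ord1 h mxE.
have oO : col_mx n B *m (col_mx n B)^T = 1%:M.
  rewrite tr_col_mx mul_col_row oB (scalar_mx_block 1 k); congr block_mx.
  - by rewrite [LHS]mx11_scalar -dotmulE nn.
  - by apply: trmx_inj; rewrite trmx_mul trmxK linearZ /= -scalemxAr Bu scaler0 trmx0.
  - by rewrite linearZ /= -scalemxAr Bu scaler0.
have n00 : `|n 0 0| = r^-1.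
  rewrite mxE normrM gtr0_norm ?invr_gt0 // -[RHS]mulr1; congr (_ * _).
  by apply/eqP; rewrite -sqrp_eq1 // -normrX expr2 uu1 normr1.
have n0 : n 0 0 != 0 by rewrite -normr_eq0 n00 invr_eq0 gt_eqF.
(* Since u_0^2 = 1, the equation of the hyperplane determines the first coordinate from the others;
   [A] requires that it lie in [0, 1]. *)
pose A := [set z : Rtuple R k | ucube z /\ 0 <= u 0 0 * (b - \sum_i tnth z i * u 0 (lift ord0 i)) <= 1].
have mA : measurable A by exact: measurable_affine_slab.
rewrite (_ : [set y | _] = taff (rsubmx (B : 'M[R]_(k, 1 + k))) (rsubmx (p : 'rV[R]_(1 + k))) @^-1` A); last first.
  have T y i : tnth (taff (rsubmx (B : 'M[R]_(k, 1 + k))) (rsubmx (p : 'rV[R]_(1 + k))) y) i =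
      (p + row_of_tuple y *m B) 0 (lift ord0 i).
    rewrite tnth_mktuple !mxE (_ : lift ord0 i = rshift 1 i); last exact: val_inj.
    by congr (_ + _); apply: eq_bigr => j _; rewrite !mxE.
  have T0 y : (p + row_of_tuple y *m B) 0 0 =
      u 0 0 * (b - \sum_i (p + row_of_tuple y *m B) 0 (lift ord0 i) * u 0 (lift ord0 i)).
    by rewrite -(inH (row_of_tuple y)) /dotmul big_ord_recl addrK mulrCA uu1 mulr1.
  apply/seteqP; split => y; rewrite /A /=.
    move=> [_ cy]; split; first by move=> i; rewrite T; exact: cy.
    by under eq_bigr do rewrite T; rewrite -T0; exact: cy.
  under eq_bigr do rewrite T; rewrite -T0 => -[cy cy0]; split; first by rewrite HB; exists (row_of_tuple y).
  by move=> i; case: (unliftP ord0 i) => [j|] -> //; rewrite -T; exact: cy.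
rewrite (@lebesgue_tuple_frame _ k n B) // n00 invrK; congr (_ * _)%E.
(* After the flips where w_i = 1, the equation x . u = b says that the coordinates sum to b + W. *)
pose W := \sum_i w 0 i.
pose w' : 'rV[R]_k := \row_i w 0 (lift ord0 i).
have vw' : vertex w' by move=> i; rewrite mxE.
have -> : lam k A = lam k (@slab k (b + W)).
  rewrite -(lebesgue_tuple_isometry w' (dotmul_diag vw') mA); congr (lam k _).
  have T (y : Rtuple R k) i : tnth (taff (diag_mx (const_mx 1 - w' *+ 2)) w' y) i =
      w 0 (lift ord0 i) + u 0 (lift ord0 i) * tnth y i.
    by rewrite tnth_mktuple mul_mx_diag ui !mxE; ring.
  have S (y : Rtuple R k) : 0 <= u 0 0 * (b - \sum_i
      tnth (taff (diag_mx (const_mx 1 - w' *+ 2)) w' y) i * u 0 (lift ord0 i)) <= 1 <->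
      0 <= b + W - \sum_i tnth y i <= 1.
    rewrite (eq_bigr (fun i => - w 0 (lift ord0 i) + tnth y i)); last first.
      by move=> i _; rewrite T ui; case: (vw (lift ord0 i)) => ->; ring.
    rewrite big_split /= sumrN /W big_ord_recl ui; case: (vw ord0) => ->.
      by rewrite (_ : (1 - 2 * 0) * _ = b + (0 + \sum_(i < k) w 0 (lift ord0 i)) - \sum_i tnth y i) //; ring.
    rewrite (_ : (1 - 2 * 1) * _ = 1 - (b + (1 + \sum_(i < k) w 0 (lift ord0 i)) - \sum_i tnth y i)); last by ring.
    by split => /andP[h1 h2]; apply/andP; split; lra.
  apply/seteqP; split => y; rewrite /A /slab /= S => -[h1 h2]; split => // i.
    by have := h1 i; rewrite T ui; case: (vw (lift ord0 i)) => ->; lra.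
  by have := h1 i; rewrite T ui; case: (vw (lift ord0 i)) => ->; lra.
have cu : dotmul (hypercube_center R k.+1) u = d / 2 - W.
  rewrite /dotmul (eq_bigr (fun i => 2^-1 - w 0 i)); last first.
    by move=> i _; rewrite mxE ui; field.
  by rewrite sumrB sumr_const card_ord -/W mulr_natl.
move: dH; rewrite Hn set_edist_hyperplane // dotmulZr cu (mulrC r^-1) -mulrBl normrM.
rewrite (gtr0_norm (_ : 0 < r^-1)) ?invr_gt0 // => /(congr1 ( *%R^~ r)); rewrite divfK ?gt_eqF // => dt.
(* The distance leaves two positions, on either side of the center; [slab_reflect] identifies their
   volumes. *)
have [h|h] := leP 0 (d / 2 - W - b).
  rewrite -slab_reflect -/d -dt ger0_norm //; congr (lam k (@slab k _)); by field.
by rewrite -dt ltr0_norm //; congr (lam k (@slab k _)); field.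
Qed.

(** Ensures that [xget] returns a genuine volume and not its default 0. The witness is the
    hyperplane orthogonal to (1,...,1) where the coordinates sum to d/2 + t sqrt d, based at the
    center moved by t along the unit normal. *)
Lemma is_section_volume_exists k t : 0 <= t -> exists v, @is_section_volume R k.+1 t v.
Proof.
move=> t0; set d : R := k.+1%:R.
have d0 : 0 < d by rewrite ltr0n.
set r := Num.sqrt d.
have r0 : 0 < r by rewrite sqrtr_gt0.
have rr : r * r = d by rewrite -expr2 sqr_sqrtr ?ltW.
pose n : 'rV[R]_(1 + k) := const_mx r^-1.
have nn : dotmul n n = 1.
  rewrite /dotmul (eq_bigr (fun=> r^-1 * r^-1)) => [|i _]; last by rewrite !mxE.
  by rewrite sumr_const card_ord -mulr_natl -/d -rr; field; rewrite gt_eqF.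
have [B oO] := orthonormal_completion nn.
have E : hyperplane (opposite_vertex 0 - 0) (d / 2 + t * r) = hyperplane n ((d / 2 + t * r) / r) :> set 'rV[R]_k.+1.
  have -> : n = r^-1 *: (opposite_vertex 0 - 0) by apply/rowP => i; rewrite !mxE !subr0 mulr1.
  apply/seteqP; split => x; rewrite /hyperplane /= dotmulZr (mulrC r^-1); first by move=> ->.
  by move=> /mulIf ->//; rewrite invr_eq0 gt_eqF.
pose c := hypercube_center R k.+1.
have cn : dotmul c n = d / 2 / r.
  rewrite /dotmul (eq_bigr (fun=> 2^-1 * r^-1)) => [|i _]; last by rewrite !mxE.
  by rewrite sumr_const card_ord -[LHS]mulr_natl -/d mulrA.
exists (lam k [set y | (hyperplane (opposite_vertex 0 - 0) (d / 2 + t * r) `&` hypercube R k.+1)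
   (c + t *: n + row_of_tuple y *m B)]).
exists (hyperplane (opposite_vertex 0 - 0) (d / 2 + t * r)); split.
- by exists 0, (d / 2 + t * r); split => // i; left; rewrite mxE.
- rewrite E set_edist_hyperplane // -/c cn mulrDl opprD addNKr normrN mulfK ?gt_eqF //.
  by rewrite ger0_norm.
- exists (c + t *: n), B; split => //.
    move: oO; rewrite tr_col_mx mul_col_row (scalar_mx_block 1 k) => /eq_block_mx [] //.
  have nB : n *m B^T = 0.
    by move: oO; rewrite tr_col_mx mul_col_row (scalar_mx_block 1 k) => /eq_block_mx [].
  have pn : dotmul (c + t *: n) n = (d / 2 + t * r) / r.
    by rewrite dotmulDl dotmulZl cn nn; field; rewrite gt_eqF.
  rewrite E; apply/seteqP; split => x.
    rewrite /hyperplane /= => xn; exists ((x - (c + t *: n)) *m B^T) => //.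
    have := mulmx1C oO; rewrite tr_col_mx mul_row_col => /(congr1 (mulmx (x - (c + t *: n)))).
    rewrite mulmxDr !mulmxA mulmx1 (mx11_scalar (_ *m n^T)) -dotmulE dotmulBl xn pn subrr.
    by rewrite mul_scalar_mx scale0r add0r => ->; rewrite addrC subrK.
  by move=> [y _ <-]; rewrite /hyperplane /= dotmulDl pn [X in _ + X]dotmulC dotmulE trmx_mul mulmxA nB mul0mx mxE addr0.
Qed.

Lemma section_volumeE k t : 0 <= t -> section_volume k.+1 t =
  ((Num.sqrt k.+1%:R)%:E * lam k (@slab k (k.+1%:R / 2 + t * Num.sqrt k.+1%:R)))%E.
Proof.
move=> /(is_section_volume_exists k)[v hv].
apply: section_volume_slab.
by apply: (@xgetPex _ 0%E [set v | is_section_volume k.+1 t v]); exists v.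
Qed.

End section_volume.

(** * Truncated powers and the Irwin-Hall density *)

Section real_derive.
Context (R : realType).
Implicit Types (f g : R -> R) (x a b : R).

Lemma is_derive_add f g x a b : is_derive x 1 f a -> is_derive x 1 g b ->
  is_derive x 1 (fun y => f y + g y) (a + b).
Proof. exact: is_deriveD. Qed.

Lemma is_derive_sub f g x a b : is_derive x 1 f a -> is_derive x 1 g b ->
  is_derive x 1 (fun y => f y - g y) (a - b).
Proof. exact: is_deriveB. Qed.

Lemma is_derive_opp f x a : is_derive x 1 f a -> is_derive x 1 (fun y => - f y) (- a).
Proof. exact: is_deriveN. Qed.

Lemma is_derive_mul f g x a b : is_derive x 1 f a -> is_derive x 1 g b ->
  is_derive x 1 (fun y => f y * g y) (a * g x + f x * b).
Proof.
move=> fa gb; have := is_deriveM fa gb.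
by rewrite addrC /GRing.scale /= (mulrC (g x)).
Qed.

Lemma is_derive_exprn f x a n : is_derive x 1 f a ->
  is_derive x 1 (fun y => f y ^+ n) (n%:R * f x ^+ n.-1 * a).
Proof. by move=> /(is_deriveX n); rewrite exprfctE. Qed.

Lemma is_derive_const (c : R) x : is_derive x 1 (fun=> c) (0 : R).
Proof. exact: is_derive_cst. Qed.

Lemma is_derive_var x : is_derive x 1 (fun y : R => y) (1 : R).
Proof. exact: is_derive_id. Qed.

Lemma is_derive_chain f g x a b : is_derive x 1 g b -> is_derive (g x) 1 f a ->
  is_derive x 1 (fun y => f (g y)) (a * b).
Proof. by move=> gb fa; exact: is_derive1_comp. Qed.

Lemma derivable_continuous f : (forall x, derivable f x 1) -> continuous f.
Proof. by move=> df x; apply: differentiable_continuous; apply/derivable1_diffP. Qed.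

Lemma continuous_comp_fun f g : continuous f -> continuous g -> continuous (fun x => f (g x)).
Proof. by move=> cf cg x; apply: continuous_comp; [exact: cg|exact: cf]. Qed.

Lemma continuous_add_fun f g : continuous f -> continuous g -> continuous (fun x => f x + g x).
Proof. by move=> cf cg x; apply: cvgD; [exact: cf|exact: cg]. Qed.

Lemma continuous_sub_fun f g : continuous f -> continuous g -> continuous (fun x => f x - g x).
Proof. by move=> cf cg x; apply: cvgB; [exact: cf|exact: cg]. Qed.

Lemma continuous_mul_fun f g : continuous f -> continuous g -> continuous (fun x => f x * g x).
Proof. by move=> cf cg x; apply: cvgM; [exact: cf|exact: cg]. Qed.

Lemma continuous_cst_fun (c : R) : continuous (fun _ : R => c).
Proof. by move=> x; exact: cvg_cst. Qed.

Lemma continuous_id_fun : continuous (fun x : R => x).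
Proof. by move=> x; exact: cvg_id. Qed.

Lemma FTC2_derive (f F : R -> R) a b : a <= b -> continuous f ->
  (forall x, is_derive x 1 F (f x)) ->
  (\int[lebesgue_measure]_(x in `[a, b]) (f x)%:E = (F b - F a)%:E)%E.
Proof.
move=> ab cf dF; have := ab; rewrite le_eqVlt => /orP[/eqP <-|{}ab].
  by rewrite set_itv1 integral_set1 subrr.
rewrite (@continuous_FTC2 _ f F) ?EFinB //.
- exact: continuous_subspaceT.
- have cF : continuous F by apply: derivable_continuous => x; have [] := dF x.
  split; first by move=> x _; have [] := dF x.
    by apply: cvg_at_right_filter; exact: cF.
  by apply: cvg_at_left_filter; exact: cF.
- by move=> x _; rewrite derive1E; have [_ ->] := dF x.
Qed.

Lemma cmax : continuous (fun x : R => Num.max 0 x).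
Proof. by move=> x; apply: continuous_max; [exact: cvg_cst|exact: cvg_id]. Qed.

Definition pospow n x : R := Num.max 0 x ^+ n.

(** At the corner 0 the difference quotient equals [Num.max 0 h], which tends to 0. The higher
    powers follow by the product rule. *)
Lemma is_derive_pospow2 x : is_derive x 1 (pospow 2) (2 * Num.max 0 x).
Proof.
have [x0|x0|->] := ltgtP x 0.
- rewrite mulr0; apply: near_eq_is_derive (is_derive_const 0 x).
  near=> z; rewrite /pospow max_l ?expr0n // ltW //; near: z; exact: lt_nbhsl.
- have h : is_derive x 1 (fun y : R => y ^+ 2) (2 * x).
    apply: (is_derive_eq (is_derive_exprn 2 (is_derive_var x))).
    by rewrite expr1 mulr1.
  apply: near_eq_is_derive h.
  near=> z; rewrite /pospow max_r // ltW //; near: z; exact: lt_nbhsr.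
- rewrite mulr0.
  suff h : h^-1 *: (pospow 2 (h *: 1 + 0) - pospow 2 0) @[h --> 0^'] --> (0 : R).
    by apply: DeriveDef; [apply/cvg_ex; exists 0; exact: h|exact/cvg_lim].
  have c : (fun h : R => Num.max 0 h) @ (0 : R)^' --> (0 : R).
    rewrite -[X in _ --> X](maxxx (0 : R)).
    by apply: cvg_within_filter; exact: cmax.
  apply: cvg_trans c; apply: near_eq_cvg; near=> h.
  have h0 : h != 0 by near: h; exact: nbhs_dnbhs_neq.
  rewrite /pospow addr0 maxxx expr0n subr0 /GRing.scale /= mulr1.
  have [|] := leP 0 h => hh; last by rewrite expr0n mulr0.
  by rewrite expr2 mulKf.
Unshelve. all: by end_near. Qed.

Lemma is_derive_pospow n x : is_derive x 1 (pospow n.+2) (n.+2%:R * pospow n.+1 x).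
Proof.
elim: n => [|n IH]; first exact: is_derive_pospow2.
have E m y : pospow m.+2 y = y * pospow m.+1 y.
  by rewrite /pospow; have [h|h] := leP 0 y; rewrite ?exprS // !mul0r mulr0.
rewrite (_ : pospow n.+3 = fun y => y * pospow n.+2 y); last by apply/funext => y; exact: E.
apply: (is_derive_eq (is_derive_mul (is_derive_var x) IH)).
by rewrite mul1r (E n x) -[n.+3%:R]natr1; ring.
Qed.

Lemma continuous_pospow n : continuous (pospow n.+1).
Proof.
case: n => [|n]; last by apply: derivable_continuous => x; have [] := is_derive_pospow n x.
exact: cmax.
Qed.

Definition tpow n x : R := pospow n x / n`!%:R.

Lemma is_derive_tpow n x : is_derive x 1 (tpow n.+2) (tpow n.+1 x).
Proof.
apply: (is_derive_eq (is_derive_mul (is_derive_pospow n x) (is_derive_const _ x))).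
rewrite mulr0 addr0 /tpow [n.+2`!]factS natrM invfM mulrA; congr (_ / _).
by rewrite mulrAC divff ?mul1r // pnatr_eq0.
Qed.

Lemma continuous_tpow n : continuous (tpow n.+1).
Proof. by move=> x; apply: cvgM; [exact: continuous_pospow|exact: cvg_cst]. Qed.

Definition nabla f x := f x - f (x - 1).

Lemma is_derive_shift f x b a : is_derive (x + b) 1 f a -> is_derive x 1 (fun y => f (y + b)) a.
Proof.
move=> h; rewrite -[a]mulr1; apply: (@is_derive_chain f (fun y => y + b)) => //.
apply: (is_derive_eq (is_derive_add (is_derive_var x) (is_derive_const b x))).
by rewrite addr0.
Qed.

Lemma is_derive_nabla f g : (forall x, is_derive x 1 f (g x)) ->
  forall x, is_derive x 1 (nabla f) (nabla g x).
Proof. by move=> fg x; apply: is_derive_sub => //; exact: is_derive_shift. Qed.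

Lemma is_derive_iter_nabla d f g : (forall x, is_derive x 1 f (g x)) ->
  forall x, is_derive x 1 (iter d nabla f) (iter d nabla g x).
Proof. by move=> fg; elim: d => //= d IH x; exact: is_derive_nabla. Qed.

Lemma continuous_iter_nabla d f : continuous f -> continuous (iter d nabla f).
Proof.
move=> cf; elim: d => //= d IH; apply: continuous_sub_fun => //.
apply: continuous_comp_fun => //.
by apply: continuous_sub_fun; [exact: continuous_id_fun|exact: continuous_cst_fun].
Qed.

(** The sum over j of (-1)^j C(d, j) (x - j)_+^(d-1) / (d-1)!, the density of a sum of d independent
    uniform variables on [0, 1], written as a d-fold backward difference. This holds for d >= 2:
    [tpow 0] is the constant 1, so [irwin_hall 1] vanishes. *)
Definition irwin_hall d : R -> R := iter d nabla (tpow d.-1).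

(** Convolution with the indicator of [0, 1] is the backward difference of an antiderivative, here
    [H]; one more difference of [H] is the next density. *)
Lemma integral_irwin_hall d s : (\int[lebesgue_measure]_(x in `[0%R, 1%R])
  (irwin_hall d.+2 (s - x))%:E = (irwin_hall d.+3 s)%:E)%E.
Proof.
pose H := iter d.+2 nabla (tpow d.+2).
have cf : continuous (fun x => irwin_hall d.+2 (s - x)).
  apply: continuous_comp_fun; first by apply: continuous_iter_nabla; exact: continuous_tpow.
  by apply: continuous_sub_fun; [exact: continuous_cst_fun|exact: continuous_id_fun].
have dF x : is_derive x 1 (fun x => - H (s - x)) (irwin_hall d.+2 (s - x)).
  have -> : irwin_hall d.+2 (s - x) = - (irwin_hall d.+2 (s - x) * (0 - 1)) by ring.
  have h1 : is_derive (s - x) 1 H (irwin_hall d.+2 (s - x)).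
    by apply: is_derive_iter_nabla => y; exact: is_derive_tpow.
  have h2 : is_derive x 1 (fun y => s - y) (0 - 1).
    exact: (is_derive_sub (is_derive_const s x) (is_derive_var x)).
  have h3 := is_derive_chain h2 h1.
  exact: (is_derive_opp h3).
by rewrite (FTC2_derive ler01 cf dF) subr0 opprK addrC.
Qed.

End real_derive.

(** * Slab volumes are Irwin-Hall densities *)

Section slab_volume.
Context (R : realType).
Local Notation mu := (@lebesgue_measure R).
Local Notation lam := (lebesgue_tuple R).

Lemma slab_tcons k s x (y : Rtuple R k) :
  slab s (tcons (x, y)) <-> 0 <= x <= 1 /\ slab (s - x) y.
Proof.
rewrite /slab /= ucube_tcons big_ord_recl tnth0.
rewrite (eq_bigr (tnth y)) => [|i _]; last by rewrite tnthS.
by rewrite opprD addrA; split => [[[? ?] ?]|[? [? ?]]].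
Qed.

Lemma slabS k s : (lam k.+1 (slab s) = \int[mu]_(x in `[0%R, 1%R]) lam k (slab (s - x)))%E.
Proof.
rewrite lebesgue_tupleS [RHS]integral_mkcond; apply: eq_integral => x _.
rewrite patchE mem_setE in_itv /=; case: ifPn => x01.
  congr (lam k _); apply/seteqP; split => y /=; rewrite slab_tcons => //; by case.
rewrite (_ : [set _ | _] = set0) ?measure0 //.
by apply/seteqP; split => y //=; rewrite slab_tcons => -[]; rewrite (negbTE x01).
Qed.

Lemma slab0 s : (lam 0 (slab s) = if (0 <= s <= 1)%R then 1 else 0)%E.
Proof.
rewrite /= diracE; case: ifPn => hs.
  by rewrite mem_set // /slab /=; split; [case|rewrite big_ord0 subr0].
by rewrite memNset // /slab /= big_ord0 subr0 => -[_]; rewrite (negbTE hs).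
Qed.

(** Slicing by the head coordinate gives the convolution recurrence of the densities. The base case
    is the tent function. *)
Lemma slab_irwin_hall k s : lam k.+1 (slab s) = (irwin_hall k.+2 s)%:E.
Proof.
elim: k s => [|k IH] s; rewrite slabS; last first.
  by under eq_integral do rewrite IH; exact: integral_irwin_hall.
(* In dimension 0 the slab is a point or empty, so the slices contribute the length of [0, 1]
   meeting [s - 1, s]. *)
transitivity (mu (`[0%R, 1%R] `&` `[s - 1, s])).
  rewrite -[RHS]mul1e -integral_cst //; last by apply: measurableI.
  rewrite [RHS]integral_mkcond [LHS]integral_mkcond; apply: eq_integral => x _.
  rewrite !patchE slab0 in_setI; case: ifPn => //= _.
  rewrite mem_setE in_itv /= (_ : (0 <= s - x <= 1) = (s - 1 <= x <= s)) //.
  by apply/andP/andP => -[h1 h2]; split; lra.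
rewrite (_ : _ `&` _ = `[Num.max 0 (s - 1), Num.min 1 s]%classic); last first.
  apply/seteqP; split => x /=; rewrite !in_itv /= ge_max le_min.
    by move=> [/andP[-> ->] /andP[-> ->]].
  by move=> /andP[/andP[-> ->] /andP[-> ->]].
rewrite lebesgue_measure_itv /= lte_fin /irwin_hall /= /nabla /tpow /pospow !expr1.
have -> : 1`!%:R = 1 :> R by [].
rewrite !divr1.
case: ifPn; rewrite -?leNgt => h; [rewrite -EFinD|]; congr EFin; move: h;
have [h1|h1] := leP 0 (s - 1); have [h2|h2] := leP 1 s; have [h3|h3] := leP 0 s;
have [h4|h4] := leP 0 (s - 1 - 1); lra.
Qed.
End slab_volume.

(** * Integrals over the half-line *)

Section halfline.
Context (R : realType).
Local Notation mu := (@lebesgue_measure R).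
Local Notation D := (`]0%R, +oo[%classic : set R).
Implicit Types (f g : R -> R) (a b : R).

Definition hintegrable f := mu.-integrable D (EFin \o f).

Lemma measurable_inv_itv a : 0 <= a -> measurable_fun (`]a, +oo[%classic : set R) (fun y : R => y^-1).
Proof.
move=> a0; apply: open_continuous_measurable_fun; first exact: interval_open.
move=> x; rewrite inE /= in_itv /= andbT => ax; apply: cvgV; last exact: cvg_id.
by rewrite gt_eqF // (le_lt_trans a0).
Qed.

Lemma measurable_invr : measurable_fun D (fun y : R => y^-1).
Proof. exact: measurable_inv_itv. Qed.

Lemma hintegrable_le f g : measurable_fun D f -> (forall x, 0 < x -> `|f x| <= g x) ->
  hintegrable g -> hintegrable f.
Proof.
move=> mf fg; apply: le_integrable => //; first exact/measurable_EFinP.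
move=> x /=; rewrite in_itv /= andbT lee_fin => x0.
by rewrite (le_trans (fg _ x0)) // ler_norm.
Qed.

Lemma hintegrableZ a f : hintegrable f -> hintegrable (fun x => a * f x).
Proof. by move=> fi; exact: (integrableZl _ a fi). Qed.

Lemma hintegrableD f g : hintegrable f -> hintegrable g -> hintegrable (fun x => f x + g x).
Proof. by move=> fi gi; exact: (integrableD _ fi gi). Qed.

Lemma hintegrableB f g : hintegrable f -> hintegrable g -> hintegrable (fun x => f x - g x).
Proof. by move=> fi gi; exact: (integrableB _ fi gi). Qed.

Lemma is_derive_continuous f (x a : R) : is_derive x 1 f a -> {for x, continuous f}.
Proof. by move=> [h _]; apply: differentiable_continuous; apply/derivable1_diffP. Qed.

Lemma is_derive_inv f (x a : R) : is_derive x 1 f a -> f x != 0 ->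
  is_derive x 1 (fun y => (f y)^-1) (- (f x) ^- 2 * a).
Proof. by move=> fa fx; exact: (is_deriveV fx fa). Qed.

Lemma is_derive_invX n (c x : R) : x + c != 0 ->
  is_derive x 1 (fun y => - (((y + c)^-1) ^+ n.+1 / n.+1%:R)) (((x + c)^-1) ^+ n.+2).
Proof.
move=> xc0.
have h1 : is_derive x 1 (fun y => y + c) (1 + 0).
  exact: is_derive_add (is_derive_var x) (is_derive_const c x).
have h2 := is_derive_inv h1 xc0.
have h3 := is_derive_mul (is_derive_exprn n.+1 h2) (is_derive_const (n.+1%:R^-1) x).
apply: (is_derive_eq (is_derive_opp h3)).
rewrite mulr0 !addr0 /GRing.scale /= mulr1 -exprVn mulrN mulNr opprK.
rewrite -(mulrA n.+1%:R) mulrAC divff ?mul1r ?pnatr_eq0 //.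
by rewrite -exprD addn2.
Qed.

Lemma cvg_invX n (c : R) : (- (((y + c)^-1) ^+ n.+1 / n.+1%:R)) @[y --> +oo] --> (0 : R).
Proof.
rewrite -[X in _ --> X]oppr0; apply: cvgN.
rewrite -[X in _ --> X](mul0r (n.+1%:R^-1)); apply: cvgM; last exact: cvg_cst.
rewrite -[X in _ --> X](expr0n _ n.+1).
apply: (@cvg_comp _ _ _ (fun y => (y + c)^-1) (fun y => y ^+ n.+1)); last exact: exprn_continuous.
apply/gtr0_cvgV0; last exact: cvg_addrr.
near=> y; rewrite -ltrBlDr sub0r; near: y.
by apply: nbhs_pinfty_gt; exact: num_real.
Unshelve. all: by end_near. Qed.

Lemma integral_invX n (c Y : R) : 0 < Y + c ->
  (\int[mu]_(y in `[Y, +oo[) (((y + c)^-1) ^+ n.+2)%:E = (((Y + c)^-1) ^+ n.+1 / n.+1%:R)%:E)%E.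
Proof.
move=> Yc.
have pos x : Y <= x -> 0 < x + c by move=> h; rewrite (lt_le_trans Yc) // lerD2r.
have dF x : Y <= x -> is_derive x 1 (fun y => - (((y + c)^-1) ^+ n.+1 / n.+1%:R)) (((x + c)^-1) ^+ n.+2).
  by move=> h; apply: is_derive_invX; rewrite gt_eqF // pos.
have cF x : Y <= x -> {for x, continuous (fun y : R => ((y + c)^-1) ^+ n.+2)}.
  move=> h; apply: (@continuous_comp _ _ _ (fun y => (y + c)^-1) (fun y => y ^+ n.+2)); last exact: exprn_continuous.
  apply: cvgV; first by rewrite gt_eqF // pos.
  by apply: cvgD; [exact: cvg_id|exact: cvg_cst].
rewrite (@ge0_continuous_FTC2y _ _ (fun y => - (((y + c)^-1) ^+ n.+1 / n.+1%:R)) _ 0).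
- by rewrite sub0e -EFinN opprK.
- by move=> x h; rewrite exprn_ge0 // invr_ge0 ltW // pos.
- by apply: continuous_in_subspaceT => x; rewrite inE /= in_itv /= andbT => h; exact: cF.
- exact: cvg_invX.
- by move=> x h; have [] := dF x (ltW h).
- apply: cvg_at_right_filter.
  exact: is_derive_continuous (dF Y (lexx Y)).
- by move=> x; rewrite in_itv /= andbT => h; rewrite derive1E; have [_ ->] := dF x (ltW h).
Qed.

Lemma measurable_invX n (c Y : R) : 0 < Y + c ->
  measurable_fun (`[Y, +oo[%classic : set R) (fun y : R => ((y + c)^-1) ^+ n).
Proof.
move=> Yc; apply: subspace_continuous_measurable_fun => //.
apply: continuous_in_subspaceT => x; rewrite inE /= in_itv /= andbT => Yx.
apply: (@continuous_comp _ _ _ (fun y => (y + c)^-1) (fun y => y ^+ n)); last exact: exprn_continuous.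
apply: cvgV; first by rewrite gt_eqF // (lt_le_trans Yc) // lerD2r.
by apply: cvgD; [exact: cvg_id|exact: cvg_cst].
Qed.

Lemma integrable_invX n (c Y : R) : 0 < Y + c ->
  mu.-integrable `[Y, +oo[ (EFin \o (fun y => ((y + c)^-1) ^+ n.+2)).
Proof.
move=> Yc; apply/integrableP; split.
  apply/measurable_EFinP.
  apply: (@measurable_invX n.+2 c Y Yc).
under eq_integral => y.
  rewrite inE /= in_itv /= andbT => h; rewrite ger0_norm; last first.
    by rewrite exprn_ge0 // invr_ge0 ltW // (lt_le_trans Yc) // lerD2r.
  over.
by rewrite integral_invX // ltry.
Qed.

Lemma hintegrable_inv1X : hintegrable (fun y => ((y + 1)^-1) ^+ 2).
Proof.
have h : 0 < 0 + 1 :> R by rewrite add0r.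
apply: integrableS (@integrable_invX 0 1 0 h) => //.
by apply: subset_itvr; rewrite bnd_simp.
Qed.

(** Distributivity also when both terms are infinite: the conventional value of their difference is
    stable under a positive finite factor. It recombines positive and negative parts in the signed
    change of variables. *)
Lemma muleBr_ge0 a (u v : \bar R) : 0 < a -> (0 <= u -> 0 <= v ->
  a%:E * (u - v) = a%:E * u - a%:E * v)%E.
Proof.
move=> a0; case: u v => [u||] [v||] // _ _.
- by rewrite -EFinB -!EFinM -EFinB mulrBr.
- by rewrite gt0_muley ?lte_fin //= gt0_muleNy ?lte_fin.
- by rewrite gt0_muley ?lte_fin //= gt0_muley ?lte_fin.
- by rewrite gt0_muley ?lte_fin //= gt0_muleNy ?lte_fin.
Qed.

Lemma integral_affine a b (f : measurableTypeR R -> \bar R) :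
  0 < a -> measurable_fun [set: measurableTypeR R] f ->
  (\int[mu]_x f x = a%:E * \int[mu]_x f (a * x + b)%R)%E.
Proof.
move=> a0 mf.
have Ep := ge0_integral_affine b a0 (measurable_funepos mf) (funepos_ge0 f).
have En := ge0_integral_affine b a0 (measurable_funeneg mf) (funeneg_ge0 f).
rewrite [in LHS]integralE [in RHS]integralE Ep En.
have -> : (\int[mu]_x f^\+ (a * x + b)%R = \int[mu]_x (fun x => f (a * x + b)%R)^\+ x)%E.
  by apply: eq_integral => x _; rewrite !funeposE.
have -> : (\int[mu]_x f^\- (a * x + b)%R = \int[mu]_x (fun x => f (a * x + b)%R)^\- x)%E.
  by apply: eq_integral => x _; rewrite !funenegE.
by apply/esym/muleBr_ge0 => //; apply: integral_ge0.
Qed.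

Lemma fine_mul_gt0 a (u : \bar R) : 0 < a -> fine (a%:E * u)%E = a * fine u.
Proof.
move=> a0; case: u => [u||] //=; first by rewrite gt0_muley ?lte_fin //= mulr0.
by rewrite gt0_muleNy ?lte_fin //= mulr0.
Qed.

Lemma hintegral_scale a f : 0 < a -> measurable_fun D f ->
  \int[mu]_(x in D) f x = a * \int[mu]_(x in D) f (a * x).
Proof.
move=> a0 mf; rewrite /Rintegral integral_mkcond [in RHS]integral_mkcond.
rewrite [in LHS](integral_affine 0 a0); last first.
  apply/(measurable_restrictT _ _).1 => //; exact/measurable_EFinP.
rewrite fine_mul_gt0 //; congr (a * fine _); apply: eq_integral => x _.
by rewrite !patchE !mem_setE !in_itv /= !andbT addr0 pmulr_rgt0.
Qed.

Lemma hintegrable_scale a f : 0 < a -> measurable_fun D f -> hintegrable f ->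
  hintegrable (fun x => f (a * x)).
Proof.
move=> a0 mf /integrableP[_ fi]; apply/integrableP; split.
  apply/measurable_EFinP; apply: (measurable_comp (F := D)) => //.
  by move=> _ [y /= + <-]; rewrite !in_itv /= !andbT => y0; rewrite mulr_gt0.
have a1 : (0 <= (a^-1)%:E)%E by rewrite lee_fin invr_ge0 ltW.
rewrite (_ : integral _ _ _ = (a^-1)%:E * \int[mu]_(x in D) `|(EFin \o f) x|)%E.
  by rewrite lte_mul_pinfty.
rewrite integral_mkcond [in RHS]integral_mkcond [in RHS](integral_affine 0 a0); last first.
  apply/(measurable_restrictT _ _).1 => //; apply: measurableT_comp => //; exact/measurable_EFinP.
rewrite muleA -EFinM mulVf ?gt_eqF // mul1e; apply: eq_integral => x _.
by rewrite !patchE !mem_setE !in_itv /= !andbT addr0 pmulr_rgt0.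
Qed.

End halfline.

(** * Powers of sinc and their cosine transforms *)

Section sinc.
Context (R : realType).
Local Notation mu := (@lebesgue_measure R).
Local Notation D := (`]0%R, +oo[%classic : set R).
Implicit Types (f g : R -> R) (a b x y z : R).

Lemma derive_ge0_le f (df : R -> R) a b : a <= b ->
  (forall x, a <= x <= b -> is_derive x 1 f (df x)) ->
  (forall x, a < x < b -> 0 <= df x) -> f a <= f b.
Proof.
rewrite le_eqVlt => /orP[/eqP-> //|ab] dF df0.
have := @MVT R f df a b ab.
case.
- by move=> x; rewrite in_itv /= => /andP[ax xb]; apply: dF; rewrite !ltW.
- apply: continuous_in_subspaceT => x; rewrite inE /= in_itv /= => xab.
  exact: is_derive_continuous (dF _ xab).
- move=> c; rewrite in_itv /= => cab E.
  by rewrite -subr_ge0 E mulr_ge0 ?df0 // subr_ge0 ltW.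
Qed.

Fixpoint cos_taylor n (y : R) : R :=
  if n is m.+1 then cos_taylor m y + (-1) ^+ n * y ^+ (2 * n) / (2 * n)`!%:R else 1.

Fixpoint sin_taylor n (y : R) : R :=
  if n is m.+1 then sin_taylor m y + (-1) ^+ n * y ^+ (2 * n).+1 / (2 * n).+1`!%:R else y.

Lemma is_derive_monomial (c x : R) n : is_derive x 1 (fun y => c * y ^+ n.+1 / n.+1`!%:R) (c * x ^+ n / n`!%:R).
Proof.
have h1 := is_derive_exprn n.+1 (is_derive_var x).
have h2 := is_derive_mul (is_derive_const c x) h1.
have h3 := is_derive_mul h2 (is_derive_const (n.+1`!%:R^-1) x).
apply: (is_derive_eq h3).
rewrite mulr0 addr0 mul0r add0r mulr1 factS natrM invfM /= -!mulrA; congr (_ * _).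
by rewrite mulrCA [X in _ * X]mulrCA mulKf ?pnatr_eq0 // mulrC.
Qed.

Lemma is_derive_sin_taylor n (x : R) : is_derive x 1 (sin_taylor n) (cos_taylor n x).
Proof.
elim: n => [|n IH] /=; first exact: is_derive_var.
exact: is_derive_add IH (is_derive_monomial _ _ _).
Qed.

Lemma is_derive_cos_taylor n (x : R) : is_derive x 1 (cos_taylor n.+1) (- sin_taylor n x).
Proof.
have M m : is_derive x 1 (fun y => (-1) ^+ m.+1 * y ^+ (2 * m.+1) / (2 * m.+1)`!%:R)
    (- ((-1) ^+ m * x ^+ (2 * m).+1 / (2 * m).+1`!%:R)).
  have -> : (2 * m.+1 = (2 * m).+2)%N by rewrite mulnS.
  by apply: (is_derive_eq (is_derive_monomial _ _ _)); rewrite exprS !mulN1r !mulNr.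
elim: n => [|n IH].
  apply: (is_derive_eq (is_derive_add (is_derive_const 1 x) (M 0%N))).
  by rewrite add0r /= expr0 mul1r expr1 divr1.
have := is_derive_add IH (M n.+1); rewrite -opprD; exact.
Qed.

(** Repeated integration from 0, starting with cos <= 1: each bound for cos gives one for sin, which
    gives the next one for cos with the opposite sign. Even [n] bounds from above, odd [n] from
    below. *)
Lemma trig_taylor_bounds n y : 0 <= y ->
  0 <= (-1) ^+ n * (cos_taylor n y - cos y) /\ 0 <= (-1) ^+ n * (sin_taylor n y - sin y).
Proof.
have S m : (forall z, 0 <= z -> 0 <= (-1) ^+ m * (cos_taylor m z - cos z)) ->
    forall z, 0 <= z -> 0 <= (-1) ^+ m * (sin_taylor m z - sin z).
  move=> H z z0.
  have s0 : sin_taylor m 0 = 0 by elim: (m) => //= k ->; rewrite expr0n /= mulr0 mul0r addr0.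
  have := @derive_ge0_le (fun z => (-1) ^+ m * (sin_taylor m z - sin z))
    (fun z => 0 * (sin_taylor m z - sin z) + (-1) ^+ m * (cos_taylor m z - cos z)) 0 z z0.
  rewrite s0 sin0 subr0 mulr0; apply.
    move=> w _; apply: is_derive_mul (is_derive_const _ _) _.
    apply: is_derive_sub; exact: is_derive_sin_taylor.
  by move=> w /andP[w0 _]; rewrite mul0r add0r H // ltW.
have C m : (forall z, 0 <= z -> 0 <= (-1) ^+ m * (sin_taylor m z - sin z)) ->
    forall z, 0 <= z -> 0 <= (-1) ^+ m.+1 * (cos_taylor m.+1 z - cos z).
  move=> H z z0.
  have s0 : cos_taylor m.+1 0 = 1.
    by elim: (m.+1) => // k /= ->; rewrite mulnS expr0n /= mulr0 mul0r addr0.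
  have := @derive_ge0_le (fun z => (-1) ^+ m.+1 * (cos_taylor m.+1 z - cos z))
    (fun z => 0 * (cos_taylor m.+1 z - cos z) + (-1) ^+ m.+1 * (- sin_taylor m z - - sin z)) 0 z z0.
  rewrite s0 cos0 subrr mulr0; apply.
    move=> w _; apply: is_derive_mul (is_derive_const _ _) _.
    apply: is_derive_sub; exact: is_derive_cos_taylor.
  by move=> w /andP[w0 _]; rewrite mul0r add0r exprS mulN1r -opprD mulrNN H // ltW.
have Cn : forall z, 0 <= z -> 0 <= (-1) ^+ n * (cos_taylor n z - cos z).
  elim: n {y} => [|n IH]; last exact/C/S.
  by move=> z _; rewrite expr0 mul1r subr_ge0 cos_le1.
by move=> y0; split; [exact: Cn|exact: S].
Qed.

Lemma sin_le_id y : 0 <= y -> sin y <= y.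
Proof. by move=> /(trig_taylor_bounds 0)[_]; rewrite expr0 mul1r subr_ge0. Qed.

Definition sinc (y : R) := sin y / y.

Lemma normr_sinc_le1 y : 0 < y -> `|sinc y| <= 1.
Proof.
move=> y0; rewrite normrM normfV (gtr0_norm y0) ler_pdivrMr // mul1r.
rewrite ler_norml sin_le_id ?(ltW y0) // andbT.
suff : 0 <= y + sin y by lra.
have := @derive_ge0_le (fun z => z + sin z) (fun z => 1 + cos z) 0 y (ltW y0).
rewrite sin0 addr0; apply.
by move=> w _; have := cos_geN1 w; lra.
Qed.

Lemma normr_sinc_leV y : 0 < y -> `|sinc y| <= y^-1.
Proof.
move=> y0; rewrite normrM normfV (gtr0_norm y0) ler_piMl ?invr_ge0 ?(ltW y0) //.
by rewrite ler_norml sin_le1 sin_geN1.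
Qed.

Lemma measurable_sinc : measurable_fun D sinc.
Proof.
apply: measurable_funM; last exact: measurable_invr.
by apply: measurable_funTS; apply: continuous_measurable_fun; exact: continuous_sin.
Qed.

(** From |sinc y| <= min(1, 1/y) follows |sinc y| <= 2/(1 + y); exponents from 2 on are thus
    dominated by one integrable function. *)
Lemma normr_sincX_le d y : 0 < y -> `|sinc y ^+ d.+2| <= 4 * ((y + 1)^-1) ^+ 2.
Proof.
move=> y0; rewrite normrX.
have h : `|sinc y| <= 2 * (y + 1)^-1.
  rewrite ler_pdivlMr ?addr_gt0 // mulrDr mulr1.
  have : `|sinc y| * y <= 1 by rewrite -ler_pdivlMr // div1r normr_sinc_leV.
  by have := normr_sinc_le1 y0; lra.
apply: (@le_trans _ _ (`|sinc y| ^+ 2)).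
  by rewrite -addn2 exprD ler_piMl ?exprn_ge0 // exprn_ile1 // normr_sinc_le1.
rewrite (_ : 4 * _ = (2 * (y + 1)^-1) ^+ 2); last by rewrite exprMn; congr (_ * _); ring.
by rewrite lerXn2r // nnegrE // mulr_ge0 // invr_ge0 ltW // addr_gt0.
Qed.

Lemma hintegrable_mulX d f : measurable_fun D f -> (forall y, 0 < y -> `|f y| <= 1) ->
  hintegrable (fun y => f y * sinc y ^+ d.+2).
Proof.
move=> mf f1; apply: (@hintegrable_le _ _ (fun y => 4 * ((y + 1)^-1) ^+ 2)).
- by apply: measurable_funM => //; apply: measurable_funX; exact: measurable_sinc.
- move=> y y0; rewrite normrM (le_trans _ (normr_sincX_le d y0)) //.
  by rewrite ler_piMl // f1.
- by apply: hintegrableZ; exact: hintegrable_inv1X.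
Qed.

Lemma measurable_cosM (a : R) : measurable_fun D (fun y => cos (a * y)).
Proof.
apply: measurable_funTS; apply: continuous_measurable_fun.
apply: continuous_comp_fun; first exact: continuous_cos.
by apply: continuous_mul_fun; [exact: continuous_cst_fun|exact: continuous_id_fun].
Qed.

(** The frequency is doubled because sinc y is the characteristic function, at 2y, of a uniform
    variable on [-1/2, 1/2]. *)
Definition fourier d x := \int[mu]_(y in D) (cos (2 * x * y) * sinc y ^+ d).

Lemma hintegrable_fourier d x : hintegrable (fun y => cos (2 * x * y) * sinc y ^+ d.+2).
Proof.
apply: hintegrable_mulX; first exact: measurable_cosM.
by move=> y _; rewrite ler_norml cos_le1 cos_geN1.
Qed.

Lemma hintegrable_sinc2 : hintegrable (fun y => sinc y ^+ 2).
Proof.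
apply: eq_integrable (hintegrable_fourier 0 0) => // y _ /=.
by rewrite mulr0 mul0r cos0 mul1r.
Qed.

Definition sinc2_int := \int[mu]_(y in D) (sinc y ^+ 2).

Lemma hintegrable_sinM a : hintegrable (fun y => (sin (a * y) / y) ^+ 2).
Proof.
wlog a0 : a / 0 < a.
  move=> H; have [a0|a0|->] := ltgtP a 0; last 2 first.
  - exact: H.
  - apply: eq_integrable (integrable0 _ _) => // y _ /=.
    by rewrite mul0r sin0 mul0r expr0n.
  - have := H (- a); rewrite oppr_gt0 => /(_ a0); apply: eq_integrable => // y _ /=.
    by rewrite mulNr sinN mulNr sqrrN.
have mS : measurable_fun D (fun y => sinc y ^+ 2).
  by apply: measurable_funX; exact: measurable_sinc.
apply: eq_integrable (hintegrableZ (a ^+ 2) (hintegrable_scale a0 mS hintegrable_sinc2)) => //.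
move=> y; rewrite inE /= in_itv /= andbT => y0; congr EFin.
by rewrite -exprMn /sinc invfM; congr (_ ^+ 2); field; rewrite !gt_eqF.
Qed.

Lemma integral_sinM a : \int[mu]_(y in D) ((sin (a * y) / y) ^+ 2) = `|a| * sinc2_int.
Proof.
wlog a0 : a / 0 < a.
  move=> H; have [a0|a0|->] := ltgtP a 0; last 2 first.
  - exact: H.
  - rewrite normr0 mul0r; under eq_Rintegral do rewrite mul0r sin0 mul0r expr0n.
    by rewrite Rintegral_cst // mul0r.
  - rewrite -normrN -H ?oppr_gt0 //; apply: eq_Rintegral => y _.
    by rewrite mulNr sinN mulNr sqrrN.
have mS : measurable_fun D (fun y => sinc y ^+ 2).
  by apply: measurable_funX; exact: measurable_sinc.
rewrite gtr0_norm // /sinc2_int (hintegral_scale a0 mS) mulrA.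
rewrite -RintegralZl //; last exact: hintegrable_scale hintegrable_sinc2.
apply: eq_Rintegral => y; rewrite inE /= in_itv /= andbT => y0.
by rewrite -expr2 -exprMn /sinc invfM; congr (_ ^+ 2); field; rewrite !gt_eqF.
Qed.

(** The product cos(2xy) sin^2 y is a second difference of squared sines, and sin^2(ay)/y^2
    integrates to |a| times [sinc2_int]. The second difference of |x| is twice the tent function. *)
Lemma fourier2 x : fourier 2 x = sinc2_int * irwin_hall 2 (x + 1).
Proof.
have iS a := hintegrable_sinM a.
have -> : fourier 2 x = \int[mu]_(y in D) (2^-1 * ((sin ((x + 1) * y) / y) ^+ 2 +
    (sin ((x - 1) * y) / y) ^+ 2 - 2 * (sin (x * y) / y) ^+ 2)).
  apply: eq_Rintegral => y; rewrite inE /= in_itv /= andbT => y0.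
  have e1 : cos (x * y) ^+ 2 = 1 - sin (x * y) ^+ 2 by rewrite -(cos2Dsin2 (x * y)) addrK.
  have e2 : cos y ^+ 2 = 1 - sin y ^+ 2 by rewrite -(cos2Dsin2 y) addrK.
  have -> : 2 * x * y = (x * y) *+ 2 by ring.
  rewrite cos_mulr2n e1 /sinc (mulrDl x 1 y) (mulrBl y x 1) mul1r sinD sinB.
  transitivity ((sin (x * y) ^+ 2 * cos y ^+ 2 + cos (x * y) ^+ 2 * sin y ^+ 2
    - sin (x * y) ^+ 2) * (y^-1) ^+ 2); last by rewrite !exprMn; field; rewrite gt_eqF.
  by rewrite e1 e2 exprMn; ring.
have iS2 := hintegrableD (iS (x + 1)) (iS (x - 1)).
rewrite RintegralZl //; last exact: hintegrableB iS2 (hintegrableZ 2 (iS x)).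
rewrite RintegralB //; last exact: hintegrableZ.
rewrite RintegralD ?RintegralZl //; try exact: iS.
rewrite !integral_sinM /irwin_hall /= /nabla /tpow /pospow !expr1.
have -> : 1`!%:R = 1 :> R by [].
rewrite !divr1 addrK.
have [h1|h1] := leP 0 (x + 1); have [h2|h2] := leP 0 (x - 1); have [h3|h3] := leP 0 x;
  rewrite ?(ger0_norm h1) ?(ltr0_norm h1) ?(ger0_norm h2) ?(ltr0_norm h2) ?(ger0_norm h3) ?(ltr0_norm h3);
  try ring; lra.
Qed.

Lemma sinc_ge_half y : 0 < y -> y <= 1 -> 2^-1 <= sinc y.
Proof.
move=> y0 y1; rewrite ler_pdivlMr //.
have [_] := trig_taylor_bounds 1 (ltW y0).
rewrite /= expr1 mulN1r oppr_ge0 subr_le0.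
have -> : (2 * 1).+1`!%:R = 6 :> R by [].
have : y ^+ 3 <= y by rewrite exprS ler_piMr ?(ltW y0) // exprn_ile1 // ltW.
lra.
Qed.

(** Comparison with [c] times the indicator of ]0, 1]; a crude bound for constants whose exact
    values never enter. *)
Lemma hintegral_ge_unit (f : R -> R) c : 0 <= c -> hintegrable f -> (forall x, 0 < x -> 0 <= f x) ->
  (forall x, 0 < x -> x <= 1 -> c <= f x) -> c <= \int[mu]_(x in D) f x.
Proof.
move=> c0 fi f0 fc.
pose h := fun x : R => c * \1_(`]0%R, 1%R]%classic : set R) x : R.
have hi : hintegrable h.
  apply: hintegrableZ; apply: (@integrableS _ _ _ _ setT) => //.
  exact: integrable_indic_itv.
have <- : \int[mu]_(x in D) h x = c.
  rewrite RintegralZl //; last first.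
    by apply: (@integrableS _ _ _ _ setT) => //; exact: integrable_indic_itv.
  rewrite /Rintegral integral_indic // (_ : _ `&` _ = `]0%R, 1%R]%classic).
    have E : mu `]0%R, 1%R] = 1%E by rewrite lebesgue_measure_itv /= lte_fin ltr01 -EFinB subr0.
    by rewrite [X in fine X]E mulr1.
  by apply/seteqP; split => x /=; [case|rewrite !in_itv /= => /andP[-> ->]].
apply: le_Rintegral hi fi _ => //.
move=> x; rewrite /= in_itv /= andbT /h indicE => x0.
have [|] := boolP (x \in _); last by rewrite mulr0 f0.
by rewrite mem_setE in_itv /= x0 /= mulr1 => x1; exact: fc.
Qed.

Lemma sinc2_int_gt0 : 0 < sinc2_int.
Proof.
apply: (@lt_le_trans _ _ 4^-1); first by rewrite invr_gt0.
apply: (hintegral_ge_unit _ hintegrable_sinc2); first by rewrite invr_ge0.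
  by move=> x _; exact: sqr_ge0.
by move=> x x0 x1; have := sinc_ge_half x0 x1; nra.
Qed.

(** Averaging a cosine over a unit interval multiplies it by sinc and recenters it at the
    midpoint. *)
Lemma integral_cos_affine u y : 0 < y ->
  (\int[mu]_(x in `[0%R, 1%R]) (cos (2 * (u - x) * y))%:E = (cos (2 * (u - 2^-1) * y) * sinc y)%:E)%E.
Proof.
move=> y0.
have dF x : is_derive x 1 (fun x => - (sin (2 * (u - x) * y) / (2 * y))) (cos (2 * (u - x) * y)).
  have h1 : is_derive x 1 (fun z : R => 2 * (u - z) * y) (- 2 * y).
    have h := is_derive_mul (is_derive_mul (is_derive_const 2 x) (is_derive_sub (is_derive_const u x) (is_derive_var x))) (is_derive_const y x).
    by apply: (is_derive_eq h); ring.
  have h2 := is_derive_mul (is_derive_chain h1 (is_derive_sin _)) (is_derive_const ((2 * y)^-1) x).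
  by apply: (is_derive_eq (is_derive_opp h2)); field; rewrite gt_eqF.
have cf : continuous (fun x => cos (2 * (u - x) * y)).
  apply: continuous_comp_fun; first exact: continuous_cos.
  apply: continuous_mul_fun; last exact: continuous_cst_fun.
  apply: continuous_mul_fun; first exact: continuous_cst_fun.
  by apply: continuous_sub_fun; [exact: continuous_cst_fun|exact: continuous_id_fun].
rewrite (FTC2_derive ler01 cf dF) subr0; congr EFin.
rewrite (_ : 2 * (u - 1) * y = 2 * (u - 2^-1) * y - y); last by field.
rewrite (_ : 2 * u * y = 2 * (u - 2^-1) * y + y); last by field.
by rewrite sinB sinD /sinc; field; rewrite gt_eqF.
Qed.

(** By Fubini, averaging the transform over a unit interval supplies one more factor sinc: this is
    the recurrence of [integral_irwin_hall], centered. *)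
Lemma fourierS d u :
  (\int[mu]_(z in `[0%R, 1%R]) (fourier d.+2 (u - z))%:E = (fourier d.+3 (u - 2^-1))%:E)%E.
Proof.
pose h := (fun y => sinc y ^+ d.+2) \_ D.
pose I := (`[0%R, 1%R]%classic : set R).
have mh : measurable_fun setT h.
  apply/(measurable_restrictT _ _).1 => //.
  by apply: measurable_funX; exact: measurable_sinc.
pose F := fun p : measurableTypeR R * measurableTypeR R =>
  (\1_I p.1 * cos (2 * (u - p.1) * p.2) * h p.2)%:E.
have mI : measurable_fun setT (\1_I : measurableTypeR R -> R).
  by apply: measurable_indic; exact: measurable_itv.
have mcos : measurable_fun setT (@cos R).
  by apply: continuous_measurable_fun; exact: continuous_cos.
have mF : measurable_fun setT F.
  apply/measurable_EFinP; apply: measurable_funM; last exact: (measurableT_comp mh measurable_snd).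
  apply: measurable_funM; first exact: (measurableT_comp mI measurable_fst).
  apply: (measurableT_comp mcos).
  apply: measurable_funM; last exact: measurable_snd.
  apply: measurable_funM; first exact: measurable_cst.
  by apply: measurable_funB; [exact: measurable_cst|exact: measurable_fst].
have hS : hintegrable (fun y => sinc y ^+ d.+2).
  apply: eq_integrable (hintegrable_fourier d 0) => // y _ /=.
  by rewrite mulr0 mul0r cos0 mul1r.
have hi : mu.-integrable setT (EFin \o h).
  by rewrite /h -restrict_EFin; exact: (integrable_mkcond _ _).1.
have cos1 x : `|cos x| <= 1 :> R by rewrite ler_norml cos_le1 cos_geN1.
(* The inner integral of |F| is at most that of |sinc|^(d+2) for z in [0, 1] and is 0 for other
   z. *)
have iF : (mu \x mu)%E.-integrable setT F.
  apply/integrable12ltyP => //.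
  pose M := (\int[mu]_y `|(EFin \o h) y|)%E.
  have Moo : (M < +oo)%E by case/integrableP : hi.
  have M0 : (0 <= M)%E by exact: integral_ge0.
  have MK : M = (fine M)%:E by rewrite fineK // ge0_fin_numE.
  have mF' : measurable_fun setT (abse \o F) by exact: measurableT_comp.
  have mFF : measurable_fun setT (fubini_F mu (abse \o F)).
    have H := measurable_fun_fubini_tonelli_F.
    by apply: H => // z; exact: abse_ge0.
  have ifE z : (fine M * \1_I z)%:E = (if z \in I then M else 0)%E.
    by rewrite indicE; case: ifPn => _; rewrite ?mulr0 // mulr1.
  apply: (@le_lt_trans _ _ (\int[mu]_z (fine M * \1_I z)%:E)%E).
    apply: ge0_le_integral => //.
    - by move=> z _; exact: integral_ge0.
    - by apply/measurable_EFinP; apply: measurable_funM => //; exact: measurable_cst.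
    - move=> z _; rewrite ifE; case: ifPn => zI.
        apply: ge0_le_integral => //.
        + by apply: (measurableT_comp mF'); exact: measurable_pair1.
        + by apply: measurableT_comp => //; exact/measurable_EFinP.
        + move=> y _; rewrite lee_fin /= indicE zI mul1r normrM.
          by rewrite ler_piMl.
      rewrite (eq_integral (cst 0%E)) ?integral0 // => y _.
      by rewrite /F /= indicE (negbTE zI) !mul0r normr0.
  have <- : (\int[mu]_z (if z \in `[0%R, 1%R] then M else 0) = \int[mu]_z (fine M * \1_I z)%:E)%E.
    by apply: eq_integral => z _; rewrite ifE mem_setE.
  by rewrite (integral_itv_cst _ ler01) // subr0 mul1e.
rewrite integral_mkcond.
transitivity (\int[mu]_z \int[mu]_y F (z, y))%E.
  apply: eq_integral => z _; rewrite patchE; case: ifPn => zI; last first.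
    rewrite (eq_integral (cst 0%E)) ?integral0 // => y _.
    by rewrite /F /= indicE (negbTE zI) !mul0r.
  rewrite /fourier fineK; last by apply: integrable_fin_num => //; exact: hintegrable_fourier.
  rewrite integral_mkcond; apply: eq_integral => y _.
  rewrite /F /= indicE zI mul1r /h !patchE; case: ifPn => // _; by rewrite mulr0.
rewrite Fubini //.
rewrite /fourier fineK; last by apply: integrable_fin_num => //; exact: hintegrable_fourier.
rewrite [RHS]integral_mkcond; apply: eq_integral => y _; rewrite patchE.
case: ifPn => yD; last first.
  rewrite (eq_integral (cst 0%E)) ?integral0 // => z _.
  by rewrite /F /= /h patchE (negbTE yD) mulr0.
have y0 : 0 < y by move: yD; rewrite mem_setE in_itv /= andbT.
transitivity (\int[mu]_(z in I) ((sinc y ^+ d.+2)%:E * (cos (2 * (u - z) * y))%:E))%E.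
  rewrite [RHS]integral_mkcond; apply: eq_integral => z _.
  rewrite /F /= /h !patchE yD indicE; case: ifPn => zI; last by rewrite !mul0r.
  by rewrite mul1r -EFinM mulrC.
rewrite integralZl //; [|exact: measurable_itv|]; last first.
  apply: continuous_compact_integrable; first exact: segment_compact.
  apply: continuous_subspaceT; apply: continuous_comp_fun; first exact: continuous_cos.
  apply: continuous_mul_fun; last exact: continuous_cst_fun.
  apply: continuous_mul_fun; first exact: continuous_cst_fun.
  by apply: continuous_sub_fun; [exact: continuous_cst_fun|exact: continuous_id_fun].
by rewrite (integral_cos_affine u y0) -EFinM mulrCA -exprSr.
Qed.

(** Both sides obey the same averaging recurrence and agree for d = 2, which replaces Fourier
    inversion. *)
Theorem irwin_hall_fourier d x :
  fourier d.+2 x = sinc2_int * irwin_hall d.+2 (x + d.+2%:R / 2).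
Proof.
elim: d x => [|d IH] x; first by rewrite fourier2 divff.
have := fourierS d (x + 2^-1); rewrite addrK => H.
have := integral_irwin_hall d (x + d.+3%:R / 2) => H2.
apply: EFin_inj; rewrite -H EFinM -H2 -integralZl //; last first.
  apply: continuous_compact_integrable; first exact: segment_compact.
  apply: continuous_subspaceT; apply: continuous_comp_fun.
    by apply: continuous_iter_nabla; exact: continuous_tpow.
  by apply: continuous_sub_fun; [exact: continuous_cst_fun|exact: continuous_id_fun].
apply: eq_integral => z _; rewrite IH -EFinM; congr (_ * irwin_hall _ _)%:E.
by rewrite -[d.+3%:R]natr1; field.
Qed.
End sinc.

(** * Certified polynomial arithmetic with rational coefficients *)

Local Notation Z := BinNums.Z.
Local Notation Zpos := BinNums.Zpos.
Local Notation Q := QArith_base.Q.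
Local Notation Qmake := QArith_base.Qmake.
Local Notation Qnum := QArith_base.Qnum.
Local Notation Qden := QArith_base.Qden.
Local Notation Qred := Qreduction.Qred.
Local Notation Qle_bool := QArith_base.Qle_bool.
Local Notation Qadd := QArith_base.Qplus.
Local Notation Qmul := QArith_base.Qmult.
Local Notation Qopp := QArith_base.Qopp.
Local Notation q0 := (Qmake BinNums.Z0 BinNums.xH).
Local Notation q1 := (Qmake (Zpos BinNums.xH) BinNums.xH).

Section qpoly.
Context (R : realType).
Implicit Types (p q : seq Q) (x y z : R) (a b c h : Q).

(** Binary integers and fractions serve as coefficients because they evaluate under [vm_compute];
    [Z2R] and [Q2R] interpret the results in R. *)
Definition Z2R (z : Z) : R := (int_of_Z z)%:~R.

Lemma Z2RD u v : Z2R (BinInt.Z.add u v) = Z2R u + Z2R v.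
Proof. by rewrite /Z2R (raddfD int_of_Z) rmorphD. Qed.
Lemma Z2RM u v : Z2R (BinInt.Z.mul u v) = Z2R u * Z2R v.
Proof. by rewrite /Z2R (rmorphM int_of_Z) rmorphM. Qed.
Lemma Z2RN u : Z2R (BinInt.Z.opp u) = - Z2R u.
Proof. by rewrite /Z2R (raddfN int_of_Z) rmorphN. Qed.

Lemma Z2R_pos u : 0 < Z2R (Zpos u).
Proof. by rewrite /Z2R ltr0z /=; lia. Qed.

Lemma Z2R_le u v : BinInt.Z.leb u v -> Z2R u <= Z2R v.
Proof. by move=> /BinInt.Z.leb_spec0 uv; rewrite /Z2R ler_int; lia. Qed.

Lemma Z2R_lt u v : BinInt.Z.ltb u v -> Z2R u < Z2R v.
Proof. by move=> /BinInt.Z.ltb_spec0 uv; rewrite /Z2R ltr_int; lia. Qed.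

Definition Q2R a : R := Z2R (Qnum a) / Z2R (Zpos (Qden a)).

Let den0 a : Z2R (Zpos (Qden a)) != 0.
Proof. by rewrite gt_eqF // Z2R_pos. Qed.

Lemma Q2RD a b : Q2R (Qadd a b) = Q2R a + Q2R b.
Proof.
rewrite /Q2R /= Z2RD !Z2RM BinInt.Pos2Z.inj_mul Z2RM.
by field; rewrite !den0.
Qed.

Lemma Q2RM a b : Q2R (Qmul a b) = Q2R a * Q2R b.
Proof. by rewrite /Q2R /= BinInt.Pos2Z.inj_mul !Z2RM; field; rewrite !den0. Qed.

Lemma Q2RN a : Q2R (Qopp a) = - Q2R a.
Proof. by rewrite /Q2R /= Z2RN mulNr. Qed.

Lemma Q2R_eq a b : QArith_base.Qeq a b -> Q2R a = Q2R b.
Proof.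
rewrite /QArith_base.Qeq /Q2R => E; apply/eqP; rewrite eqr_div ?den0 //.
by rewrite -!Z2RM E.
Qed.

Lemma Q2R_red a : Q2R (Qred a) = Q2R a.
Proof. exact/Q2R_eq/Qreduction.Qred_correct. Qed.

Lemma Q2R_le a b : Qle_bool a b -> Q2R a <= Q2R b.
Proof.
move=> H; rewrite /Q2R ler_pdivrMr ?Z2R_pos // mulrAC ler_pdivlMr ?Z2R_pos //.
by rewrite -!Z2RM; apply: Z2R_le.
Qed.

Definition Qltb a b := ~~ Qle_bool b a.

Lemma Q2R_lt a b : Qltb a b -> Q2R a < Q2R b.
Proof.
move=> H; rewrite /Q2R ltr_pdivrMr ?Z2R_pos // mulrAC ltr_pdivlMr ?Z2R_pos //.
rewrite -!Z2RM; apply: Z2R_lt.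
by move: H; rewrite /Qltb /QArith_base.Qle_bool -BinInt.Z.ltb_antisym.
Qed.

Lemma Q2R0 : Q2R q0 = 0. Proof. by rewrite /Q2R /Z2R /= mul0r. Qed.
Lemma Q2R1 : Q2R q1 = 1. Proof. by rewrite /Q2R /Z2R /= divr1. Qed.

Arguments Qreduction.Qred : simpl never.
Arguments QArith_base.Qplus : simpl never.
Arguments QArith_base.Qmult : simpl never.
Arguments QArith_base.Qopp : simpl never.

Definition Qnat (n : nat) : Q := QArith_base.inject_Z (BinInt.Z.of_nat n).

Lemma Q2R_nat n : Q2R (Qnat n) = n%:R.
Proof. by rewrite /Q2R /Z2R /= divr1; have -> : int_of_Z (BinInt.Z.of_nat n) = n by lia. Qed.

Lemma Q2RV n : Q2R (Qmake (Zpos BinNums.xH) (BinPos.Pos.of_succ_nat n)) = n.+1%:R^-1.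
Proof.
rewrite /Q2R /Z2R mul1r; congr (_^-1).
by have -> : int_of_Z (Zpos (BinPos.Pos.of_succ_nat n)) = n.+1 by lia.
Qed.

(* Polynomials are coefficient lists, constant term first. *)

Fixpoint ev p x : R := if p is c :: p' then Q2R c + x * ev p' x else 0.

Fixpoint padd p q : seq Q :=
  match p, q with
  | [::], _ => q
  | _, [::] => p
  | a :: p', b :: q' => Qred (Qadd a b) :: padd p' q'
  end.

Lemma ev_add p q x : ev (padd p q) x = ev p x + ev q x.
Proof.
elim: p q => [|a p IH] [|b q] /=; rewrite ?add0r ?addr0 //.
by rewrite IH Q2R_red Q2RD; ring.
Qed.

Definition pscale a p := [seq Qred (Qmul a c) | c <- p].

Lemma ev_scale a p x : ev (pscale a p) x = Q2R a * ev p x.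
Proof. by elim: p => [|c p IH] /=; rewrite ?mulr0 // IH Q2R_red Q2RM; ring. Qed.

Definition psub p q := padd p (pscale (Qopp q1) q).

Lemma ev_sub p q x : ev (psub p q) x = ev p x - ev q x.
Proof. by rewrite ev_add ev_scale Q2RN Q2R1 mulN1r. Qed.

Fixpoint pmul p q : seq Q :=
  if p is a :: p' then padd (pscale a q) (q0 :: pmul p' q) else [::].

Lemma ev_mul p q x : ev (pmul p q) x = ev p x * ev q x.
Proof.
elim: p => [|a p IH] /=; first by rewrite mul0r.
by rewrite ev_add ev_scale /= IH Q2R0 add0r; ring.
Qed.

Fixpoint pexp p n := if n is m.+1 then pmul p (pexp p m) else [:: q1].

Lemma ev_exp p n x : ev (pexp p n) x = ev p x ^+ n.
Proof.
elim: n => [|n IH] /=; first by rewrite Q2R1 mulr0 addr0.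
by rewrite ev_mul IH exprS.
Qed.

Fixpoint pshift a p : seq Q :=
  if p is c :: p' then let q := pshift a p' in padd (c :: q) (pscale a q) else [::].

Lemma ev_shift a p x : ev (pshift a p) x = ev p (x + Q2R a).
Proof.
elim: p => // c p IH; rewrite /pshift -/(pshift a p) ev_add ev_scale /= IH; ring.
Qed.

Lemma ev_rcons p c x : ev (rcons p c) x = ev p x + Q2R c * x ^+ size p.
Proof.
elim: p => [|a p IH] /=; first by rewrite mulr0 addr0 add0r mulr1.
by rewrite IH exprS; ring.
Qed.

Definition Qneg a : Q := if Qle_bool a q0 then a else q0.

(* A lower bound for p on [0, h], by Horner's scheme. *)
Fixpoint plb h p : Q := if p is c :: p' then Qred (Qadd c (Qneg (Qmul h (plb h p')))) else q0.

(** If l bounds the inner polynomial from below and x lies in [0, h], then x times it is at least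
    min(0, h l), whence [Qneg]. *)
Lemma plb_le h p x : 0 <= x <= Q2R h -> Q2R (plb h p) <= ev p x.
Proof.
move=> /andP[x0 xh]; elim: p => [|c p IH] /=; first by rewrite Q2R0.
rewrite Q2R_red Q2RD lerD2l.
have h0 : 0 <= Q2R h := le_trans x0 xh.
rewrite /Qneg; case: ifPn => H.
  move: (Q2R_le H); rewrite Q2RM Q2R0 => H0.
  have [e0|e0] := leP 0 (ev p x); first by rewrite (le_trans H0) // mulr_ge0.
  apply: (@le_trans _ _ (Q2R h * ev p x)); first by rewrite ler_wpM2l.
  by rewrite ler_nM2r.
have H' : Qle_bool q0 (Qmul h (plb h p)).
  by move: H; rewrite /QArith_base.Qle_bool -BinInt.Z.ltb_antisym => /BinInt.Z.ltb_lt ?; apply/BinInt.Z.leb_spec0; lia.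
move: (Q2R_le H'); rewrite Q2RM Q2R0 => H0.
have [e0|e0] := leP 0 (ev p x); first by rewrite mulr_ge0.
have [->|xn0] := eqVneq x 0; first by rewrite mul0r.
have hp : 0 < Q2R h by rewrite (lt_le_trans _ xh) // lt_def xn0.
have H1 : Q2R h * Q2R (plb h p) <= Q2R h * ev p x by rewrite ler_wpM2l.
have : Q2R h * ev p x < 0 by rewrite pmulr_rlt0.
by move/(le_lt_trans H1)/(le_lt_trans H0); rewrite ltxx.
Qed.

(** Positivity on n consecutive cells of width h: each cell is moved to the origin by a Taylor shift
    and bounded there, so short cells compensate for the crude bound. *)
Fixpoint ppos h p n : bool :=
  if n is m.+1 then Qltb q0 (plb h p) && ppos h (pshift h p) m else true.

Lemma ppos_gt0 h p n x : ppos h p n.+1 -> 0 <= x <= n.+1%:R * Q2R h -> 0 < ev p x.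
Proof.
elim: n p x => [|n IH] p x.
  by rewrite /= andbT mul1r => /Q2R_lt; rewrite Q2R0 => H xh; apply/(lt_le_trans H)/plb_le.
rewrite -[ppos _ _ _]/(_ && ppos h (pshift h p) n.+1) => /andP[H1 H2] /andP[x0 xh].
have [xh'|xh'] := leP x (Q2R h).
  by move: (Q2R_lt H1); rewrite Q2R0 => H; apply/(lt_le_trans H)/plb_le; rewrite x0.
have := IH _ (x - Q2R h) H2; rewrite ev_shift subrK; apply.
by move: xh; rewrite -(natr1 n.+1) mulrDl mul1r; move: xh'; lra.
Qed.

Lemma ppos_on a h p n x : ppos h (pshift a p) n.+1 ->
  Q2R a <= x <= Q2R a + n.+1%:R * Q2R h -> 0 < ev p x.
Proof.
move=> H /andP[H1 H2]; have := @ppos_gt0 _ _ _ (x - Q2R a) H.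
by rewrite ev_shift subrK; apply; rewrite subr_ge0 H1 lerBlDl.
Qed.

Definition Qinvn n : Q := Qmake (Zpos BinNums.xH) (BinPos.Pos.of_succ_nat (n.+2 * n.+1).-1).

Lemma Q2R_invn n : Q2R (Qinvn n) = (n.+2%:R * n.+1%:R)^-1.
Proof. by rewrite Q2RV -natrM prednK. Qed.
Arguments Qinvn : simpl never.

(* [o] is 0 for cos and 1 for sin; the pair is the coefficient list in y^2 and
   its last entry. *)
Fixpoint tayl (o n : nat) : seq Q * Q :=
  if n is m.+1 then
    let: (p, c) := tayl o m in
    let c' := Qred (Qmul (Qopp c) (Qinvn (2 * m + o))) in
    (rcons p c', c')
  else ([:: q1], q1).

Lemma taylE o n : size (tayl o n).1 = n.+1 /\ ((o <= 1)%N -> Q2R (tayl o n).2 = (-1) ^+ n / (2 * n + o)`!%:R).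
Proof.
elim: n => [|n [IH1 IH2]].
  split => // o1; rewrite -[(tayl o 0).2]/q1 Q2R1 expr0 mul1r muln0 add0n (_ : o`! = 1%N) ?invr1 //.
  by case: o o1 => [|[|]].
rewrite /=; case: (tayl o n) IH1 IH2 => p c /= IH1 IH2; split; first by rewrite size_rcons IH1.
move=> o1; rewrite Q2R_red Q2RM Q2R_invn Q2RN IH2 //.
have -> : (2 * n.+1 + o = (2 * n + o).+2)%N by lia.
by rewrite !factS !natrM exprS !invfM; ring.
Qed.

Definition cosl n := (tayl 0 n).1.
Definition sinl n := (tayl 1 n).1.

Lemma ev_cosl n y : ev (cosl n) (y ^+ 2) = cos_taylor n y.
Proof.
rewrite /cosl; elim: n => [|n IH]; first by rewrite /= Q2R1 mulr0 addr0.
have [sz H2] := taylE 0 n; have [_ H3] := taylE 0 n.+1.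
move: H3 H2 sz IH; rewrite /= addn0; case: (tayl 0 n) => p c /= H3 H2 sz IH.
by rewrite ev_rcons IH H3 // sz -exprM addn0 mulrAC.
Qed.

Lemma ev_sinl n y : y * ev (sinl n) (y ^+ 2) = sin_taylor n y.
Proof.
rewrite /sinl; elim: n => [|n IH]; first by rewrite /= Q2R1 mulr0 addr0 mulr1.
have [sz H2] := taylE 1 n; have [_ H3] := taylE 1 n.+1.
move: H3 H2 sz IH; rewrite /= addn1; case: (tayl 1 n) => p c /= H3 H2 sz IH.
rewrite ev_rcons mulrDr IH H3 // sz -exprM addn1 [y ^+ _.+1]exprS; congr (_ + _).
by rewrite mulrA [y * _]mulrCA -!mulrA; congr (_ * _); rewrite mulrCA mulrC -mulrA.
Qed.

End qpoly.

Arguments Qreduction.Qred : simpl never.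
Arguments QArith_base.Qplus : simpl never.
Arguments QArith_base.Qmult : simpl never.
Arguments QArith_base.Qopp : simpl never.

(** * The logarithm of sinc on 0 < y <= 5/2 *)

Section sinc_log.
Context (R : realType).
Implicit Types (x y z : R).

(* The denominator 0 is read as 1. *)
Definition Qfrac (m n : nat) : Q := Qmake (BinInt.Z.of_nat m) (BinPos.Pos.of_nat n).

Lemma Q2R_frac m n : (0 < n)%N -> Q2R R (Qfrac m n) = m%:R / n%:R.
Proof.
move=> n0; rewrite /Q2R /Z2R -[m%:R]/((Posz m)%:~R) -[n%:R in RHS]/((Posz n)%:~R).
have -> : int_of_Z (Qnum (Qfrac m n)) = m by rewrite /=; lia.
by have -> : int_of_Z (Zpos (Qden (Qfrac m n))) = n by rewrite /=; lia.
Qed.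

Lemma ev_ncons0 n p x : ev (ncons n q0 p) x = x ^+ n * ev p x.
Proof.
elim: n => [|n IH]; first by rewrite mul1r.
by rewrite /= -/(ncons n q0 p) IH Q2R0 exprS; ring.
Qed.

Lemma sin_cos_bounds y : 0 <= y ->
  [/\ y * ev (sinl 5) (y ^+ 2) <= sin y, sin y <= y * ev (sinl 4) (y ^+ 2),
      ev (cosl 5) (y ^+ 2) <= cos y & cos y <= ev (cosl 4) (y ^+ 2)].
Proof.
move=> y0; rewrite !ev_sinl !ev_cosl.
have [c4 s4] := trig_taylor_bounds 4 y0.
have [c5 s5] := trig_taylor_bounds 5 y0.
have e4 : (-1) ^+ 4 = 1 :> R by ring.
have e5 : (-1) ^+ 5 = -1 :> R by ring.
move: c4 s4 c5 s5; rewrite e4 e5 !mul1r !mulN1r !oppr_ge0 !subr_ge0 !subr_le0 => h1 h2 h3 h4.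
exact: And4 h4 h2 h3 h1.
Qed.

(** The Taylor polynomial of y cot y in the variable y^2. The next coefficient is -1/4725; the
    larger 6/10^4 subtracted in [cotB] makes it a lower bound up to y = 5/2, while [cotA] is an
    upper bound. *)
Definition cotA : seq Q := [:: q1; Qopp (Qfrac 1 3); Qopp (Qfrac 1 45); Qopp (Qfrac 2 945)].
Definition cotB : seq Q := psub cotA (ncons 4 q0 [:: Qfrac 6 10000]).

(** The polynomials compared agree with the same Taylor series up to y^6, so their difference
    vanishes to order 8 at 0. Strict positivity becomes checkable once y^8 is divided out. *)
Lemma dvd4_gt0 p q h n y : p = ncons 4 q0 q -> ppos h q n.+1 -> 0 < y -> y ^+ 2 <= n.+1%:R * Q2R R h ->
  0 < ev p (y ^+ 2).
Proof.
move=> -> H y0 yh; rewrite ev_ncons0 mulr_gt0 ?exprn_gt0 //.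
by apply: ppos_gt0 H _; rewrite sqr_ge0.
Qed.

(** The sign of [A] is open (y cot y changes sign before 5/2), so the product is checked at both
    ends of the enclosure of s. *)
Lemma mul_between_ge (s l u y A c : R) : y * l <= s -> s <= y * u -> 0 <= y ->
  c <= u * A -> c <= l * A -> y * c <= s * A.
Proof.
move=> ls su y0 cu cl; have [A0|A0] := leP 0 A.
  by rewrite (le_trans (ler_wpM2l y0 cl)) // mulrA ler_wpM2r.
by rewrite (le_trans (ler_wpM2l y0 cu)) // mulrA ler_nM2r.
Qed.

Lemma cotA_ge y : 0 < y -> y ^+ 2 <= 25 / 4 -> 0 <= sin y * ev cotA (y ^+ 2) - y * cos y.
Proof.
move=> y0 yh.
have [s5 s4 c5 c4] := sin_cos_bounds (ltW y0).
have E : 25 / 4 = 10%:R * Q2R R (Qfrac 25 40) by rewrite Q2R_frac //; field.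
rewrite E in yh.
have H5 : 0 < ev (psub (pmul (sinl 5) cotA) (cosl 4)) (y ^+ 2).
  apply: (@dvd4_gt0 _ (drop 4 (psub (pmul (sinl 5) cotA) (cosl 4))) (Qfrac 25 40) 9 y _ _ y0 yh).
    by vm_compute.
  by vm_compute.
have H4 : 0 < ev (psub (pmul (sinl 4) cotA) (cosl 4)) (y ^+ 2).
  apply: (@dvd4_gt0 _ (drop 4 (psub (pmul (sinl 4) cotA) (cosl 4))) (Qfrac 25 40) 9 y _ _ y0 yh).
    by vm_compute.
  by vm_compute.
rewrite !ev_sub !ev_mul !subr_gt0 in H4 H5.
rewrite subr_ge0 (le_trans (ler_wpM2l (ltW y0) c4)) //.
exact: (mul_between_ge s5 s4 (ltW y0) (ltW H4) (ltW H5)).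
Qed.

Lemma cotB_le y : 0 < y -> y ^+ 2 <= 25 / 4 -> sin y * ev cotB (y ^+ 2) - y * cos y <= 0.
Proof.
move=> y0 yh.
have [s5 s4 c5 c4] := sin_cos_bounds (ltW y0).
have E : 25 / 4 = 40%:R * Q2R R (Qfrac 25 160) by rewrite Q2R_frac //; field.
rewrite E in yh.
have H5 : 0 < ev (psub (cosl 5) (pmul (sinl 5) cotB)) (y ^+ 2).
  apply: (@dvd4_gt0 _ (drop 4 (psub (cosl 5) (pmul (sinl 5) cotB))) (Qfrac 25 160) 39 y _ _ y0 yh).
    by vm_compute.
  by vm_compute.
have H4 : 0 < ev (psub (cosl 5) (pmul (sinl 4) cotB)) (y ^+ 2).
  apply: (@dvd4_gt0 _ (drop 4 (psub (cosl 5) (pmul (sinl 4) cotB))) (Qfrac 25 160) 39 y _ _ y0 yh).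
    by vm_compute.
  by vm_compute.
rewrite !ev_sub !ev_mul !subr_gt0 in H4 H5.
rewrite subr_le0; apply: le_trans (ler_wpM2l (ltW y0) c5).
rewrite -lerN2 -!mulrN; apply: (mul_between_ge s5 s4 (ltW y0)); by rewrite mulrN lerN2 ltW.
Qed.

Lemma sin_gt0_25 y : 0 < y -> y ^+ 2 <= 25 / 4 -> 0 < sin y.
Proof.
move=> y0 yh; have [s5 _ _ _] := sin_cos_bounds (ltW y0).
apply: lt_le_trans s5; rewrite mulr_gt0 //.
have E : 25 / 4 = 10%:R * Q2R R (Qfrac 25 40) by rewrite Q2R_frac //; field.
apply: (@ppos_gt0 _ (Qfrac 25 40) _ 9); first by vm_compute.
by rewrite -E yh sqr_ge0.
Qed.

(* The remainder of -ln (sinc y) after three Taylor terms, used for 0 < y <= 5/2. *)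
Definition sinc_rem y := ln y - ln (sin y) - y ^+ 2 / 6 - y ^+ 4 / 180 - y ^+ 6 / 2835%:R.

Lemma is_derive_sinc_rem y : 0 < y -> y ^+ 2 <= 25 / 4 ->
  is_derive y 1 sinc_rem ((sin y * ev cotA (y ^+ 2) - y * cos y) / (y * sin y)).
Proof.
move=> y0 yh; have s0 := sin_gt0_25 y0 yh.
have h1 := is_derive_chain (is_derive_sin y) (is_derive1_ln s0).
have h2 n (k : R) := is_derive_mul (is_derive_exprn n (is_derive_var y)) (is_derive_const k^-1 y).
have h := is_derive_sub (is_derive_sub (is_derive_sub (is_derive_sub (is_derive1_ln y0) h1) (h2 2%N 6)) (h2 4%N 180)) (h2 6%N 2835%:R).
apply: (is_derive_eq h).
rewrite /cotA /= !Q2RN !Q2R_frac // Q2R1 /=.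
by field; rewrite !gt_eqF.
Qed.

(** The slack in the bound (3/4) 10^-4 y^8 for [sinc_rem]. Its monotonicity bounds the difference of
    two remainders by the difference of the two terms in y^8. *)
Definition sinc_rem' y := 3 / 10 ^+ 4 / 4 * y ^+ 8 - sinc_rem y.

Lemma is_derive_sinc_rem' y : 0 < y -> y ^+ 2 <= 25 / 4 ->
  is_derive y 1 sinc_rem' (- ((sin y * ev cotB (y ^+ 2) - y * cos y) / (y * sin y))).
Proof.
move=> y0 yh; have s0 := sin_gt0_25 y0 yh.
have h2 := is_derive_mul (is_derive_const (3 / 10 ^+ 4 / 4) y) (is_derive_exprn 8 (is_derive_var y)).
apply: (is_derive_eq (is_derive_sub h2 (is_derive_sinc_rem y0 yh))).
rewrite /cotB ev_sub ev_ncons0 /ev Q2R_frac //.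
have -> : 10000%:R = 10 ^+ 4 :> R by ring.
by field; rewrite !gt_eqF.
Qed.

Let sqr_le x y : 0 < x -> x <= y -> y ^+ 2 <= 25 / 4 -> x ^+ 2 <= 25 / 4.
Proof. by move=> x0 xy; apply: le_trans; rewrite lerXn2r // nnegrE ltW // (lt_le_trans x0). Qed.

Lemma sinc_rem_mono x y : 0 < x -> x <= y -> y ^+ 2 <= 25 / 4 -> sinc_rem x <= sinc_rem y.
Proof.
move=> x0 xy yh.
apply: (@derive_ge0_le _ sinc_rem
  (fun z => (sin z * ev cotA (z ^+ 2) - z * cos z) / (z * sin z)) x y xy).
  move=> z /andP[xz zy]; apply: is_derive_sinc_rem; first exact: lt_le_trans xz.
  exact: (sqr_le (lt_le_trans x0 xz) zy yh).
move=> z /andP[/ltW xz /ltW zy]; have z0 : 0 < z by exact: lt_le_trans xz.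
have zh := sqr_le z0 zy yh.
by rewrite divr_ge0 ?cotA_ge // mulr_ge0 // ltW // sin_gt0_25.
Qed.

Lemma sinc_rem'_mono x y : 0 < x -> x <= y -> y ^+ 2 <= 25 / 4 -> sinc_rem' x <= sinc_rem' y.
Proof.
move=> x0 xy yh.
apply: (@derive_ge0_le _ sinc_rem'
  (fun z => - ((sin z * ev cotB (z ^+ 2) - z * cos z) / (z * sin z))) x y xy).
  move=> z /andP[xz zy]; apply: is_derive_sinc_rem'; first exact: lt_le_trans xz.
  exact: (sqr_le (lt_le_trans x0 xz) zy yh).
move=> z /andP[/ltW xz /ltW zy]; have z0 : 0 < z by exact: lt_le_trans xz.
have zh := sqr_le z0 zy yh.
by rewrite -mulNr divr_ge0 ?oppr_ge0 ?cotB_le // mulr_ge0 // ltW // sin_gt0_25.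
Qed.

(** Replaces the limit at 0, where the logarithms are undefined, by a lower bound -e at small e. *)
Lemma ge0_from_0 (f : R -> R) y : 0 < y ->
  (forall e, 0 < e -> e <= y -> f e <= f y) -> (forall e, 0 < e -> e <= 1 -> - e <= f e) -> 0 <= f y.
Proof.
move=> y0 fy f0; rewrite leNgt; apply/negP => fn.
pose e := Num.min (Num.min y 1) (- f y / 2).
have e0 : 0 < e by rewrite !lt_min y0 ltr01 divr_gt0 // oppr_gt0.
have ey : e <= y by rewrite !ge_min lexx.
have e1 : e <= 1 by rewrite !ge_min lexx orbT.
have ef : e <= - f y / 2 by rewrite ge_min lexx orbT.
have := fy e e0 ey; have := f0 e e0 e1; lra.
Qed.

Lemma sinc_rem_ge0 y : 0 < y -> y ^+ 2 <= 25 / 4 -> 0 <= sinc_rem y.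
Proof.
move=> y0 yh; apply: (ge0_from_0 y0) => e e0 e1; first exact: sinc_rem_mono.
have eh : e ^+ 2 <= 25 / 4 by rewrite (@le_trans _ _ 1) ?exprn_ile1 ?(ltW e0) //; lra.
have s0 := sin_gt0_25 e0 eh.
have H : ln (sin e) <= ln e by rewrite ler_ln ?posrE // sin_le_id // ltW.
have X n : e ^+ n.+1 <= e by rewrite exprS ler_piMr ?(ltW e0) // exprn_ile1 // ltW.
move: (X 1%N) (X 3%N) (X 5%N); rewrite /sinc_rem.
have : e ^+ 6 / 2835%:R <= e ^+ 6 / 180.
  rewrite ler_wpM2l ?exprn_ge0 ?(ltW e0) // lef_pV2 ?posrE ?ltr0n // ler_nat //.
move: (e ^+ 6 / _) => a; lra.
Qed.

Lemma sinc_rem'_ge0 y : 0 < y -> y ^+ 2 <= 25 / 4 -> 0 <= sinc_rem' y.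
Proof.
move=> y0 yh; apply: (ge0_from_0 y0) => e e0 e1; first exact: sinc_rem'_mono.
have eh : e ^+ 2 <= 25 / 4 by rewrite (@le_trans _ _ 1) ?exprn_ile1 ?(ltW e0) //; lra.
have s0 := sin_gt0_25 e0 eh.
have [_] := trig_taylor_bounds 1 (ltW e0).
rewrite /= expr1 mulN1r oppr_ge0 subr_le0.
have -> : (2 * 1).+1`!%:R = 6 :> R by [].
move=> S.
have H : ln e - ln (sin e) <= e.
  rewrite -ln_div ?posrE //.
  (* From ln z <= z - 1 at z = e / sin e, which sin e >= e - e^3/6 then bounds by e. *)
  have L : ln (e / sin e) <= e / sin e - 1.
    have := @le_ln1Dx R (e / sin e - 1); rewrite [1 + _]addrC subrK; apply.
    by rewrite ltrBrDr addNr divr_gt0.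
  apply: (le_trans L); rewrite lerBlDr ler_pdivrMr //.
  have e2 : e ^+ 2 * e <= e ^+ 2 by rewrite ler_piMr // sqr_ge0.
  have e3 : e ^+ 3 * e <= e ^+ 3 by rewrite ler_piMr // exprn_ge0 // ltW.
  have : (e + 1) * (e - e ^+ 3 / 6) <= (e + 1) * sin e.
    rewrite ler_wpM2l ?addr_ge0 ?(ltW e0) //.
    by move: S; rewrite mulN1r mulNr.
  have := sqr_ge0 e; have : e ^+ 3 = e ^+ 2 * e by rewrite exprSr.
  move: e2 e3; lra.
have X n : 0 <= e ^+ n by rewrite exprn_ge0 // ltW.
have Y : 0 <= e ^+ 6 / 2835%:R by apply: mulr_ge0 (X 6%N) _; rewrite invr_ge0 ler0n.
have W : 0 <= 3 / 10 ^+ 4 / 4 * e ^+ 8.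
  by apply: mulr_ge0 _ (X 8%N); rewrite !mulr_ge0 ?invr_ge0 ?exprn_ge0 ?ler0n.
move: (X 2%N) (X 4%N) Y W; rewrite /sinc_rem' /sinc_rem.
move: (e ^+ 6 / _) (_ * e ^+ 8) => a b; lra.
Qed.

Lemma sinc_expR y : 0 < y -> y ^+ 2 <= 25 / 4 ->
  sinc y = expR (- (y ^+ 2 / 6 + y ^+ 4 / 180 + y ^+ 6 / 2835%:R + sinc_rem y)).
Proof.
move=> y0 yh; have s0 := sin_gt0_25 y0 yh.
rewrite /sinc_rem (_ : - _ = ln (sin y) + - ln y); last by field.
by rewrite expRD expRN !lnK ?posrE.
Qed.

End sinc_log.

(** * Comparing consecutive exponents *)

Section gauss_compare.
Context (R : realType).
Implicit Types (u x y z a b : R).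

(** With u = x^2, [errU] is the relative excess of the exponent difference over its leading term and
    [errL] bounds the larger exponent itself. The constants are the values at a = 1/12, b = 1/13:
    25/819 = (20/105)(1/12 + 1/13). *)
Definition errU u := 25 / 819 * u + u ^+ 2 / 288.
Definition errL u := u ^+ 2 / 240 + u ^+ 3 / (105 * 144) + u ^+ 4 / (160 * 1728%:R).
(* Bounds max(errU, errL) by |z| <= 1/16 + 4 z^2 for z = errU - errL. *)
Definition errM u := (errU u + errL u) / 2 + (8^-1 + 8 * (errU u - errL u) ^+ 2) / 4.

(** From 8 (z - 1/8)^2 >= 0 and 8 (z + 1/8)^2 >= 0. A polynomial is wanted in place of the maximum
    so that Gaussian moments integrate it exactly. *)
Lemma errM_ge u : errU u <= errM u /\ errL u <= errM u.
Proof.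
rewrite /errM; move: (errU u) (errL u) => U L.
have H : 8 * (U - L - 8^-1) ^+ 2 >= 0 by rewrite mulr_ge0 ?sqr_ge0.
have H' : 8 * (U - L + 8^-1) ^+ 2 >= 0 by rewrite mulr_ge0 ?sqr_ge0.
have E : 8 * (U - L - 8^-1) ^+ 2 = 8 * (U - L) ^+ 2 + 8^-1 - 2 * (U - L) by field.
have E' : 8 * (U - L + 8^-1) ^+ 2 = 8 * (U - L) ^+ 2 + 8^-1 + 2 * (U - L) by field.
by split; lra.
Qed.

(* a = 1/n, b = 1/(n+1); r and r' are the remainders at n and n+1. *)
Lemma exponent_bounds u a b n r r' th : 0 <= u -> 0 < b -> b <= 13%:R^-1 -> a <= 12^-1 -> b < a ->
  a - b = a * b -> n * a = 1 -> (n + 1) * b = 1 -> u * a <= 25 / 12 -> 0 <= th -> th <= 160^-1 ->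
  0 <= r' -> r' <= r -> r' <= th * u ^+ 4 * b ^+ 4 ->
  r <= th * u ^+ 4 * a ^+ 4 -> r - r' <= th * u ^+ 4 * (a ^+ 4 - b ^+ 4) ->
  let B := u ^+ 2 * a / 20 + u ^+ 3 * a ^+ 2 / 105 + n * r in
  let B' := u ^+ 2 * b / 20 + u ^+ 3 * b ^+ 2 / 105 + (n + 1) * r' in
  [/\ 0 <= B', B <= errL u, a * b / 20 * u ^+ 2 <= B - B' &
     B - B' <= a * b / 20 * u ^+ 2 * (1 + errU u)].
Proof.
move=> u0 b0 b13 a12 ba ab na nb ua th0 th160 r'0 r'r r'b ra rr'.
have a0 : 0 < a by lra.
have n0 : 0 <= n by rewrite leNgt; apply/negP => n0; have := nmulr_rlt0 a n0; rewrite a0 na ltr10.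
have uX k : 0 <= u ^+ k by rewrite exprn_ge0.
have aX k : 0 <= a ^+ k by rewrite exprn_ge0 // ltW.
have bX k : 0 <= b ^+ k by rewrite exprn_ge0 // ltW.
have ab0 : 0 <= a * b by rewrite mulr_ge0 // ltW.
have nab : n * (a - b) = b by rewrite ab mulrA na mul1r.
have a4b4 : a ^+ 4 - b ^+ 4 = (a - b) * ((a + b) * (a ^+ 2 + b ^+ 2)) by ring.
have a2b2 : a ^+ 2 - b ^+ 2 = a * b * (a + b) by rewrite -ab; ring.
have b2a2 : b ^+ 2 <= a ^+ 2 by rewrite lerXn2r ?nnegrE ?(ltW b0) ?(ltW a0) // ltW.
have a2 : a ^+ 2 <= 144^-1.
  have -> : 144^-1 = 12^-1 ^+ 2 :> R by field.
  by rewrite lerXn2r ?nnegrE ?(ltW a0) ?invr_ge0 ?ler0n.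
have a3 : a ^+ 3 <= 1728%:R^-1.
  have -> : 1728%:R^-1 = 12^-1 ^+ 3 :> R by field.
  by rewrite lerXn2r ?nnegrE ?(ltW a0) ?invr_ge0 ?ler0n.
have pab : (a + b) * (a ^+ 2 + b ^+ 2) <= 4 * a ^+ 3.
  have -> : 4 * a ^+ 3 = (2 * a) * (2 * a ^+ 2) by ring.
  by rewrite ler_pM ?addr_ge0 ?(ltW a0) ?(ltW b0) //; lra.
have thu : 0 <= th * u ^+ 4 by rewrite mulr_ge0.
(* Dropping -r' leaves n (r - r'), and n (a - b) = b absorbs the large factor n. *)
have diffu : n * r - (n + 1) * r' <= th * u ^+ 4 * b * (4 * a ^+ 3).
  apply: (@le_trans _ _ (n * (r - r'))).
    by rewrite mulrDl mul1r mulrBr opprD addrA lerBlDr lerDl.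
  apply: (le_trans (ler_wpM2l n0 rr')).
  have -> : n * (th * u ^+ 4 * (a ^+ 4 - b ^+ 4)) =
      th * u ^+ 4 * (n * (a - b)) * ((a + b) * (a ^+ 2 + b ^+ 2)) by ring.
  by rewrite nab ler_wpM2l // mulr_ge0 // ltW.
have diffl : - r' <= n * r - (n + 1) * r'.
  have : n * r' <= n * r by rewrite ler_wpM2l.
  by rewrite mulrDl mul1r; lra.
split.
- rewrite addr_ge0 // ?mulr_ge0 ?addr_ge0 ?mulr_ge0 ?invr_ge0 ?ler0n ?(ltW b0) //.
- rewrite /errL; have : n * r <= th * u ^+ 4 * a ^+ 3.
    apply: (le_trans (ler_wpM2l n0 ra)).
    have -> : n * (th * u ^+ 4 * a ^+ 4) = (n * a) * (th * u ^+ 4 * a ^+ 3) by ring.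
    by rewrite na mul1r.
  have : th * u ^+ 4 * a ^+ 3 <= 160^-1 * u ^+ 4 * 1728%:R^-1.
    by apply: ler_pM => //; exact: ler_wpM2r.
  have : u ^+ 2 * a <= u ^+ 2 * 12^-1 by rewrite ler_wpM2l.
  have : u ^+ 3 * a ^+ 2 <= u ^+ 3 * 144^-1 by rewrite ler_wpM2l.
  have -> : 160^-1 * u ^+ 4 * 1728%:R^-1 = u ^+ 4 / (160 * 1728%:R) by field.
  have -> : u ^+ 3 / (105 * 144) = u ^+ 3 * 144^-1 / 105 by field.
  move: (_ / (160 * _)) (u ^+ 3 * _) (u ^+ 3 * _) (th * _ * _) => *; lra.
(* The only negative contribution, -r', is absorbed by the cubic terms: u b <= 25/12 turns its u^4
   into u^3. *)
- have : 105^-1 * u ^+ 3 * (a * b * (a + b)) >= r'.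
    apply: (le_trans r'b).
    have -> : th * u ^+ 4 * b ^+ 4 = th * u ^+ 3 * b ^+ 3 * (u * b) by ring.
    have ub : u * b <= 25 / 12 by rewrite (le_trans _ ua) // ler_wpM2l // ltW.
    apply: (@le_trans _ _ (160^-1 * u ^+ 3 * b ^+ 3 * (25 / 12))).
      apply: ler_pM => //; rewrite ?mulr_ge0 ?(ltW b0) //.
      by apply: ler_wpM2r => //; exact: ler_wpM2r.
    have b3 : b ^+ 3 * 2 <= a * b * (a + b).
      have : b * b <= a * b by rewrite ler_wpM2r // ltW.
      have -> : b ^+ 3 * 2 = (b * b) * (b + b) by ring.
      by move=> bb; rewrite ler_pM ?mulr_ge0 ?addr_ge0 ?(ltW b0) //; lra.
    have : 105^-1 * u ^+ 3 * (b ^+ 3 * 2) <= 105^-1 * u ^+ 3 * (a * b * (a + b)).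
      by rewrite ler_wpM2l // mulr_ge0.
    apply: le_trans.
    have -> : 160^-1 * u ^+ 3 * b ^+ 3 * (25 / 12) = (160^-1 * (25 / 12)) * (u ^+ 3 * b ^+ 3) by ring.
    have -> : 105^-1 * u ^+ 3 * (b ^+ 3 * 2) = (105^-1 * 2) * (u ^+ 3 * b ^+ 3) by ring.
    by rewrite ler_wpM2r ?mulr_ge0 //; lra.
  have -> : a * b / 20 * u ^+ 2 = u ^+ 2 * a / 20 - u ^+ 2 * b / 20.
    by rewrite -ab; field.
  rewrite -a2b2.
  have -> : 105^-1 * u ^+ 3 * (a ^+ 2 - b ^+ 2) = u ^+ 3 * a ^+ 2 / 105 - u ^+ 3 * b ^+ 2 / 105 by field.
  by move: diffl; lra.
- have -> : u ^+ 2 * a / 20 + u ^+ 3 * a ^+ 2 / 105 + n * r - (u ^+ 2 * b / 20 + u ^+ 3 * b ^+ 2 / 105 + (n + 1) * r') =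
    (a - b) / 20 * u ^+ 2 + u ^+ 3 * (a ^+ 2 - b ^+ 2) / 105 + (n * r - (n + 1) * r') by field.
  rewrite ab a2b2.
  have : a * b / 20 * u ^+ 2 * (1 + errU u) = a * b / 20 * u ^+ 2 + a * b * u ^+ 3 * (5 / 20 * (5 / 819)) + a * b * u ^+ 4 / (20 * 288).
    by rewrite /errU; field.
  move=> ->.
  have : u ^+ 3 * (a * b * (a + b)) / 105 <= a * b * u ^+ 3 * (5 / 20 * (5 / 819)).
    have -> : u ^+ 3 * (a * b * (a + b)) / 105 = (a * b * u ^+ 3) * ((a + b) / 105) by field.
    by rewrite ler_wpM2l ?mulr_ge0 ?(ltW a0) ?(ltW b0) //; lra.
  have : th * u ^+ 4 * b * (4 * a ^+ 3) <= a * b * u ^+ 4 / (20 * 288).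
    have -> : th * u ^+ 4 * b * (4 * a ^+ 3) = (a * b * u ^+ 4) * (4 * th * a ^+ 2) by ring.
    rewrite ler_wpM2l ?mulr_ge0 ?(ltW a0) ?(ltW b0) //.
    have : th * a ^+ 2 <= 160^-1 * 144^-1 by rewrite ler_pM.
    by move=> h; rewrite -mulrA (le_trans (ler_wpM2l _ h)) //; lra.
  by move: diffu; lra.
Qed.

(** Three uses of 1 + x <= exp x, with exp(-a) <= 1 above and exp(-b) >= 1 - b below. *)
Lemma expR_diff_bounds a b : 0 <= a -> a <= b ->
  expR (- a) - expR (- b) <= b - a /\ (b - a) * (1 - b) <= expR (- a) - expR (- b).
Proof.
move=> a0 ab.
have ea : 0 < expR (- a) by exact: expR_gt0.
have eb : 0 < expR (- b) by exact: expR_gt0.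
have ea1 : expR (- a) <= 1 by rewrite -expR0 ler_expR; lra.
have h1 : 1 + (a - b) <= expR (a - b) := expR_ge1Dx _.
have h2 : 1 + (b - a) <= expR (b - a) := expR_ge1Dx _.
have h3 : 1 - b <= expR (- b) := expR_ge1Dx _.
have E1 : expR (- b) = expR (- a) * expR (a - b) by rewrite -expRD; congr expR; ring.
have E2 : expR (- a) = expR (- b) * expR (b - a) by rewrite -expRD; congr expR; ring.
split.
  have : expR (- a) * (1 + (a - b)) <= expR (- b) by rewrite E1 ler_wpM2l // ltW.
  have : expR (- a) * (b - a) <= 1 * (b - a) by rewrite ler_wpM2r // subr_ge0.
  lra.
have : expR (- b) * (1 + (b - a)) <= expR (- a) by rewrite E2 ler_wpM2l // ltW.
have : (1 - b) * (b - a) <= expR (- b) * (b - a) by rewrite ler_wpM2r // subr_ge0.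
lra.
Qed.

Definition phi n x : R := sinc (Num.sqrt (3 / n%:R) * x) ^+ n.

Lemma phi_expR n x : (0 < n)%N -> 0 < x -> x ^+ 2 <= 25 / 12 * n%:R ->
  phi n x = expR (- (x ^+ 2 / 2)) * expR (- ((x ^+ 2) ^+ 2 / n%:R / 20 + (x ^+ 2) ^+ 3 / n%:R ^+ 2 / 105 +
     n%:R * sinc_rem (Num.sqrt (3 / n%:R) * x))).
Proof.
move=> n0 x0 xn.
have n0' : 0 < n%:R :> R by rewrite ltr0n.
have s0 : 0 < Num.sqrt (3 / n%:R) :> R by rewrite sqrtr_gt0 divr_gt0.
have s2 : Num.sqrt (3 / n%:R) ^+ 2 = 3 / n%:R :> R by rewrite sqr_sqrtr // ltW // divr_gt0.
set y := _ * x; have y0 : 0 < y by rewrite mulr_gt0.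
have y2 : y ^+ 2 = 3 * x ^+ 2 / n%:R by rewrite exprMn s2 mulrAC.
have yh : y ^+ 2 <= 25 / 4 by rewrite y2 ler_pdivrMr //; lra.
have y4 : y ^+ 4 = (3 * x ^+ 2 / n%:R) ^+ 2 by rewrite -y2 -exprM.
have y6 : y ^+ 6 = (3 * x ^+ 2 / n%:R) ^+ 3 by rewrite -y2 -exprM.
rewrite /phi -/y (sinc_expR y0 yh) -expRM_natl -expRD; congr expR.
rewrite y2 y4 y6.
have -> : 2835%:R = 27 * 105 :> R by ring.
by field; rewrite gt_eqF.
Qed.
End gauss_compare.

(** * Gaussian moments *)

Section gauss_moments.
Context (R : realType).
Local Notation mu := (@lebesgue_measure R).
Local Notation D := (`]0%R, +oo[%classic : set R).
Implicit Types (x y z X : R) (s : seq Q).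

Definition gauss x : R := expR (- (x ^+ 2 / 2)).

Lemma continuous_gauss : continuous gauss.
Proof.
apply: continuous_comp_fun; first exact: continuous_expR.
move=> x; apply: cvgN; apply: cvgM; last exact: cvg_cst.
exact: exprn_continuous.
Qed.

(** One term of the exponential series: z^k / k! <= exp z at z = x^2/2. *)
Lemma exprn_gauss_le k x : x ^+ (2 * k) * gauss x <= 2 ^+ k * k`!%:R.
Proof.
rewrite /gauss expRN ler_pdivrMr ?expR_gt0 // mulrC.
have h : 0 <= x ^+ 2 / 2 by rewrite divr_ge0 ?sqr_ge0.
have H : (x ^+ 2 / 2) ^+ k / k`!%:R <= expR (x ^+ 2 / 2).
  case: k => [|k]; first by rewrite expr0 fact0 divr1 (le_trans _ (expR_ge1Dx _)) // lerDl.
  by rewrite (le_trans _ (expR_ge1Dxn k h)) // lerDr.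
move: H; rewrite ler_pdivrMr ?ltr0n ?fact_gt0 // => H.
have -> : x ^+ (2 * k) = 2 ^+ k * (x ^+ 2 / 2) ^+ k.
  by rewrite -exprMn exprM; congr (_ ^+ k); field.
by rewrite mulrCA ler_wpM2l ?exprn_ge0.
Qed.

Definition gauss_cst k : R := 2 * (2 ^+ k * k`!%:R + 2 ^+ k.+1 * k.+1`!%:R).

Lemma exprn_gauss_le_inv k x : 0 < x -> x ^+ (2 * k) * gauss x <= gauss_cst k * ((x + 1)^-1) ^+ 2.
Proof.
move=> x0; rewrite exprVn ler_pdivlMr ?exprn_gt0 ?addr_gt0 //.
have g0 : 0 <= x ^+ (2 * k) * gauss x by rewrite mulr_ge0 ?expR_ge0 // exprM exprn_ge0 ?sqr_ge0.
apply: (@le_trans _ _ (x ^+ (2 * k) * gauss x * (2 * (1 + x ^+ 2)))).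
  by rewrite ler_wpM2l //; have := sqr_ge0 (x - 1); rewrite !expr2; lra.
have -> : x ^+ (2 * k) * gauss x * (2 * (1 + x ^+ 2)) = 2 * (x ^+ (2 * k) * gauss x + x ^+ (2 * k.+1) * gauss x).
  by rewrite mulnS exprD; ring.
by rewrite ler_wpM2l // lerD // exprn_gauss_le.
Qed.

Lemma measurable_exprn_gauss k : measurable_fun D (fun x => x ^+ k * gauss x).
Proof.
apply: measurable_funTS; apply: continuous_measurable_fun.
by apply: continuous_mul_fun; [exact: exprn_continuous|exact: continuous_gauss].
Qed.

Lemma hintegrable_exprn_gauss k : hintegrable (fun x => x ^+ (2 * k) * gauss x).
Proof.
apply: (@hintegrable_le _ _ (fun x => gauss_cst k * ((x + 1)^-1) ^+ 2)).
- exact: measurable_exprn_gauss.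
- move=> x x0; rewrite ger0_norm; first exact: exprn_gauss_le_inv.
  by rewrite mulr_ge0 ?expR_ge0 // exprn_ge0 // ltW.
- by apply: hintegrableZ; exact: hintegrable_inv1X.
Qed.

Definition gmoment k := \int[mu]_(x in D) (x ^+ (2 * k) * gauss x).

Lemma is_derive_gauss x : is_derive x 1 gauss (- x * gauss x).
Proof.
have h1 := is_derive_opp (is_derive_mul (is_derive_exprn 2 (is_derive_var x)) (is_derive_const 2^-1 x)).
apply: (is_derive_eq (is_derive_chain h1 (is_derive_expR _))).
by rewrite /gauss; field.
Qed.

Let F k x : R := x ^+ (2 * k).+1 * gauss x.
Let f k x : R := (2 * k).+1%:R * (x ^+ (2 * k) * gauss x) - x ^+ (2 * k.+1) * gauss x.

Let is_derive_F k x : is_derive x 1 (F k) (f k x).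
Proof.
have h := is_derive_mul (is_derive_exprn (2 * k).+1 (is_derive_var x)) (is_derive_gauss x).
apply: (is_derive_eq h); rewrite /f /= mulnS exprD exprS; ring.
Qed.

Let continuous_f k : continuous (f k).
Proof.
apply: continuous_sub_fun.
  apply: continuous_mul_fun; first exact: continuous_cst_fun.
  by apply: continuous_mul_fun; [exact: exprn_continuous|exact: continuous_gauss].
by apply: continuous_mul_fun; [exact: exprn_continuous|exact: continuous_gauss].
Qed.

Let cvg_F k : F k x @[x --> +oo] --> (0 : R).
Proof.
have H : (gauss_cst k.+1 * ((x + 0)^-1) ^+ 1) @[x --> +oo] --> (0 : R).
  rewrite -[X in _ --> X](mulr0 (gauss_cst k.+1)); apply: cvgM; first exact: cvg_cst.
  have H0 := cvgN (@cvg_invX R 0 0); rewrite oppr0 in H0.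
  have -> : (fun x : R => (x + 0)^-1 ^+ 1) = (fun x => - - ((x + 0)^-1 ^+ 1 / 1%:R)).
    by apply/funext => x; rewrite opprK divr1.
  exact: H0.
apply: (@squeeze_cvgr _ _ _ _ (fun=> 0) (fun x => gauss_cst k.+1 * ((x + 0)^-1) ^+ 1)) => //; last exact: cvg_cst.
near=> x.
have x1 : 1 <= x by near: x; apply: nbhs_pinfty_ge; exact: num_real.
have x0 : 0 < x by lra.
have G0 := expR_ge0 (- (x ^+ 2 / 2)).
apply/andP; split; first by rewrite mulr_ge0 // exprn_ge0 // ltW.
rewrite addr0 expr1 ler_pdivlMr //.
have -> : F k x * x = x ^+ (2 * k.+1) * gauss x by rewrite /F mulnS exprD exprS; ring.
apply: (le_trans (exprn_gauss_le _ _)).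
rewrite /gauss_cst; have : 0 <= 2 ^+ k.+1 * k.+1`!%:R :> R by rewrite mulr_ge0 ?exprn_ge0 ?ler0n.
have : 0 <= 2 ^+ k.+2 * k.+2`!%:R :> R by rewrite mulr_ge0 ?exprn_ge0 ?ler0n.
move: (2 ^+ k.+1 * _) (2 ^+ k.+2 * _) => a b; lra.
Unshelve. all: by end_near. Qed.

(** Integration by parts: the difference of the two sides is the integral of the derivative of
    x^(2k+1) exp(-x^2/2), which vanishes at 0 and at infinity. *)
Lemma gmomentS k : gmoment k.+1 = (2 * k).+1%:R * gmoment k.
Proof.
have i1 := hintegrable_exprn_gauss k; have i2 := hintegrable_exprn_gauss k.+1.
have iF : hintegrable (f k) by apply: hintegrableB => //; exact: hintegrableZ.
apply/eqP; rewrite eq_sym -subr_eq0; apply/eqP.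
rewrite /gmoment -RintegralZl // -RintegralB //; last exact: hintegrableZ.
rewrite -[LHS]/(\int[mu]_(x in D) f k x).
(* The derivative changes sign at sqrt(2k + 1). Splitting there leaves an integrand of constant sign
   on the unbounded part, as the fundamental theorem up to infinity requires. *)
pose a : R := Num.sqrt (2 * k).+1%:R.
have a0 : 0 < a by rewrite sqrtr_gt0 ltr0n.
have := @Rintegral_itvB R (f k) (BRight 0) (BInfty R false) a iF.
rewrite !bnd_simp => /(_ (ltW a0) isT).
move=> /eqP; rewrite subr_eq => /eqP ->.
have ia : mu.-integrable `]a, +oo[ (EFin \o f k).
  by apply: integrableS iF => //; apply: subset_itvr; rewrite bnd_simp ltW.
have ib : mu.-integrable `]0%R, a] (EFin \o f k).
  by apply: integrableS iF => //; apply: subset_itvl; rewrite bnd_simp.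
rewrite Rintegral_itv_obnd_cbnd // Rintegral_itv_obnd_cbnd //.
rewrite /Rintegral (FTC2_derive (ltW a0) (@continuous_f k) (is_derive_F k)).
rewrite (@le0_continuous_FTC2y _ (f k) (F k) a 0).
- by rewrite -EFinB /= /F expr0n mul0r; ring.
- move=> x ax; have -> : f k x = x ^+ (2 * k) * gauss x * ((2 * k).+1%:R - x ^+ 2).
    by rewrite /f [(2 * k.+1)%N]mulnS exprD; ring.
  have x0 : 0 <= x by rewrite (le_trans (ltW a0)).
  rewrite mulr_ge0_le0 ?mulr_ge0 ?expR_ge0 ?exprn_ge0 // subr_le0.
  have <- : a ^+ 2 = (2 * k).+1%:R by rewrite sqr_sqrtr ?ler0n.
  by rewrite lerXn2r // nnegrE ltW.
- by apply: continuous_subspaceT; exact: continuous_f.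
- exact: cvg_F.
- by apply: cvg_at_right_filter; exact: is_derive_continuous (is_derive_F k a).
- by move=> x _; have [] := is_derive_F k x.
- by move=> x _; rewrite derive1E; have [_ ->] := is_derive_F k x.
Qed.

(* The weight of the coefficient of index j is the double factorial (2j-1)!!
   (from index k on, given m = (2k-1)!!). *)
Fixpoint mweight (m : Q) (k : nat) s : seq Q :=
  if s is c :: s' then Qred (Qmul c m) :: mweight (Qred (Qmul m (Qnat (2 * k).+1))) k.+1 s' else [::].

(** Integrates a polynomial termwise in units of [gmoment 0]. The scale [X] will be a squared
    frequency, and the outcome is again a polynomial in it, accessible to the certified checks. *)
Lemma gauss_ev_integral s k m X : gmoment k = Q2R R m * gmoment 0 ->
  hintegrable (fun x => x ^+ (2 * k) * ev s (X * x ^+ 2) * gauss x) /\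
  \int[mu]_(x in D) (x ^+ (2 * k) * ev s (X * x ^+ 2) * gauss x) = gmoment 0 * ev (mweight m k s) X.
Proof.
elim: s k m => [|c s IH] k m gm /=.
  have E : (fun x : R => x ^+ (2 * k) * 0 * gauss x) = fun=> 0.
    by apply/funext => x; rewrite mulr0 mul0r.
  rewrite E mulr0 Rintegral_cst // mul0r; split=> //.
  exact: integrable0.
have gm' : gmoment k.+1 = Q2R R (Qred (Qmul m (Qnat (2 * k).+1))) * gmoment 0.
  by rewrite gmomentS gm Q2R_red Q2RM Q2R_nat; ring.
have [I1 I2] := IH _ _ gm'.
have ik := hintegrable_exprn_gauss k.
have E : (fun x : R => x ^+ (2 * k) * (Q2R R c + X * x ^+ 2 * ev s (X * x ^+ 2)) * gauss x) =
    (fun x => Q2R R c * (x ^+ (2 * k) * gauss x) + X * (x ^+ (2 * k.+1) * ev s (X * x ^+ 2) * gauss x)).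
  by apply/funext => x; rewrite mulnS exprD; ring.
rewrite E; split; first by apply: hintegrableD; exact: hintegrableZ.
rewrite RintegralD //; try exact: hintegrableZ.
by rewrite RintegralZl // RintegralZl // I2 -/(gmoment k) gm Q2R_red Q2RM; ring.
Qed.

(** Converts the tail error, which is absolute, into a multiple of [gmoment 0], whose value is
    sqrt(pi/2). *)
Lemma gmoment0_ge : 2^-1 <= gmoment 0.
Proof.
apply: hintegral_ge_unit; rewrite ?invr_ge0 //.
- exact: hintegrable_exprn_gauss.
- by move=> x x0; rewrite mulr_ge0 ?expR_ge0.
- move=> x x0 x1; rewrite muln0 expr0 mul1r.
  apply: (le_trans _ (expR_ge1Dx _)).
  have : x ^+ 2 <= 1 by rewrite exprn_ile1 // ltW.
  lra.
Qed.
End gauss_moments.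

(** * Central estimate and tails for d >= 12 *)

Section large_dim.
Context (R : realType).
Local Notation mu := (@lebesgue_measure R).
Local Notation D := (`]0%R, +oo[%classic : set R).
Implicit Types (x y z t u : R) (n m : nat).

Definition gap_cst n : R := n%:R^-1 * n.+1%:R^-1 / 20.

Lemma gap_cst_gt0 n : (0 < n)%N -> 0 < gap_cst n.
Proof. by move=> n0; rewrite !mulr_gt0 ?invr_gt0 ?ltr0n. Qed.

(** The Gaussian factors out of both functions, and the difference of the remaining exponentials
    lies between c u^2 (1 - errL) and c u^2 (1 + errU), where u = x^2 and c is [gap_cst n]. *)
Lemma phi_diff n x : (12 <= n)%N -> 0 < x -> x ^+ 2 <= 25 / 12 * n%:R ->
  `|phi n.+1 x - phi n x - gap_cst n * (x ^+ 4 * gauss x)| <=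
    gap_cst n * (x ^+ 4 * gauss x) * errM (x ^+ 2).
Proof.
move=> n12 x0 xn.
have n0 : (0 < n)%N by exact: leq_trans n12.
have n0' : 0 < n%:R :> R by rewrite ltr0n.
have nS0' : 0 < n.+1%:R :> R by rewrite ltr0n.
have xnS : x ^+ 2 <= 25 / 12 * n.+1%:R.
  by rewrite (le_trans xn) // ler_wpM2l ?ler_nat // divr_ge0.
rewrite (phi_expR n0 x0 xn) (phi_expR (ltn0Sn n) x0 xnS) -/(gauss x).
set u := x ^+ 2; set y := Num.sqrt (3 / n%:R) * x; set y' := Num.sqrt (3 / n.+1%:R) * x.
have -> : x ^+ 4 = u ^+ 2 by rewrite -exprM.
have u0 : 0 <= u by exact: sqr_ge0.
pose a : R := n%:R^-1; pose b : R := n.+1%:R^-1.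
have a0 : 0 < a by rewrite invr_gt0.
have b0 : 0 < b by rewrite invr_gt0.
have na : n%:R * a = 1 by rewrite divff // gt_eqF.
have nb : (n%:R + 1) * b = 1 by rewrite natr1 divff // gt_eqF.
have a12 : a <= 12^-1 by rewrite lef_pV2 ?posrE ?ltr0n // ler_nat.
have b13 : b <= 13%:R^-1 by rewrite lef_pV2 ?posrE ?ltr0n // ler_nat.
have ab : a - b = a * b by rewrite /a /b -natr1; field; rewrite natr1 !gt_eqF.
have ba : b < a by rewrite -subr_gt0 ab mulr_gt0.
have ua : u * a <= 25 / 12 by rewrite ler_pdivrMr.
have sa : Num.sqrt (3 / n%:R) ^+ 2 = 3 * a by rewrite sqr_sqrtr // mulr_ge0 // ltW.
have sb : Num.sqrt (3 / n.+1%:R) ^+ 2 = 3 * b by rewrite sqr_sqrtr // mulr_ge0 // ltW.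
have y0 : 0 < y by rewrite mulr_gt0 // sqrtr_gt0 mulr_gt0.
have y'0 : 0 < y' by rewrite mulr_gt0 // sqrtr_gt0 mulr_gt0.
have y2 : y ^+ 2 = 3 * a * u by rewrite exprMn sa.
have y'2 : y' ^+ 2 = 3 * b * u by rewrite exprMn sb.
have yh : y ^+ 2 <= 25 / 4 by rewrite y2; move: ua; lra.
have y'y : y' <= y.
  by rewrite ler_wpM2r ?(ltW x0) // ler_wsqrtr // ler_wpM2l // ltW.
have y'h : y' ^+ 2 <= 25 / 4.
  by apply: le_trans yh; rewrite lerXn2r // nnegrE ltW.
(* The bound (3/4) 10^-4 y^8 at y^2 = 3 a u; the factor 81 is 3^4. *)
pose th : R := 3 / 10 ^+ 4 / 4 * 81.
have y8 : 3 / 10 ^+ 4 / 4 * y ^+ 8 = th * u ^+ 4 * a ^+ 4.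
  have -> : y ^+ 8 = (y ^+ 2) ^+ 4 by rewrite -exprM.
  by rewrite y2 /th; ring.
have y'8 : 3 / 10 ^+ 4 / 4 * y' ^+ 8 = th * u ^+ 4 * b ^+ 4.
  have -> : y' ^+ 8 = (y' ^+ 2) ^+ 4 by rewrite -exprM.
  by rewrite y'2 /th; ring.
have th0 : 0 <= th by rewrite /th !mulr_ge0 ?invr_ge0 ?exprn_ge0 ?ler0n.
have th160 : th <= 160^-1.
  rewrite /th; have -> : 10 ^+ 4 = 100 * 100 :> R by ring.
  lra.
have r'0 := sinc_rem_ge0 y'0 y'h.
have r'r := sinc_rem_mono y'0 y'y yh.
have := sinc_rem'_ge0 y'0 y'h; have := sinc_rem'_ge0 y0 yh; have := sinc_rem'_mono y'0 y'y yh.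
rewrite /sinc_rem' y8 y'8.
move: (sinc_rem y) (sinc_rem y') r'0 r'r => r r' r'0 r'r h1 h2 h3.
have ra : r <= th * u ^+ 4 * a ^+ 4 by rewrite -subr_ge0.
have r'b : r' <= th * u ^+ 4 * b ^+ 4 by rewrite -subr_ge0.
have rr' : r - r' <= th * u ^+ 4 * (a ^+ 4 - b ^+ 4) by rewrite mulrBr; move: h1; lra.
have := exponent_bounds u0 b0 b13 a12 ba ab na nb ua th0 th160 r'0 r'r r'b ra rr'.
have nr : n.+1%:R * r' = (n%:R + 1) * r' by rewrite natr1.
rewrite -!exprVn -/a -/b nr.
set B := u ^+ 2 * a / 20 + _ + _; set B' := u ^+ 2 * b / 20 + _ + _.
move=> [B'0 BL lo hi].
have c0 : 0 < a * b / 20 by rewrite divr_gt0 ?mulr_gt0.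
have cu0 : 0 <= a * b / 20 * u ^+ 2 by rewrite mulr_ge0 ?sqr_ge0 // ltW.
have BB' : B' <= B by rewrite -subr_ge0 (le_trans cu0).
have [e1 e2] := expR_diff_bounds B'0 BB'.
have [MU ML] := errM_ge u.
have G0 : 0 <= gauss x by exact: expR_ge0.
have -> : gap_cst n = a * b / 20 by [].
set E := expR (- B') - expR (- B) in e1 e2.
have -> : gauss x * expR (- B') - gauss x * expR (- B) - a * b / 20 * (u ^+ 2 * gauss x) =
  gauss x * (E - a * b / 20 * u ^+ 2) by rewrite /E; ring.
have -> : a * b / 20 * (u ^+ 2 * gauss x) * errM u = gauss x * (a * b / 20 * u ^+ 2 * errM u) by ring.
rewrite normrM (ger0_norm G0) ler_wpM2l //.
have H1 : a * b / 20 * u ^+ 2 * errU u <= a * b / 20 * u ^+ 2 * errM u by rewrite ler_wpM2l.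
have H2 : a * b / 20 * u ^+ 2 * errL u <= a * b / 20 * u ^+ 2 * errM u by rewrite ler_wpM2l.
have H3 : a * b / 20 * u ^+ 2 * (1 - errL u) <= E.
  (* If B > 1, then errL > 1 as well and the claimed lower bound is negative. *)
  have [h|h] := leP 0 (1 - B).
    apply: le_trans e2; apply: (@le_trans _ _ (a * b / 20 * u ^+ 2 * (1 - B))).
      by rewrite ler_wpM2l // lerD2l lerN2.
    by rewrite ler_wpM2r.
  apply: (@le_trans _ _ 0).
    by rewrite mulr_ge0_le0 // subr_le0 (le_trans _ BL) // ltW // -subr_lt0.
  by rewrite subr_ge0 ler_expR lerN2.
move: hi H1 H2 H3 e1; rewrite ler_norml mulrDr mulrBr mulr1; set K := a * b / 20 * u ^+ 2.
move=> *; apply/andP; split; lra.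
Qed.

Lemma phi_tail m x : (0 < m)%N -> 0 < x -> `|phi m x| <= Num.sqrt (m%:R / 3) ^+ m * (x^-1) ^+ m.
Proof.
move=> m0 x0; have m0' : 0 < m%:R :> R by rewrite ltr0n.
have s0 : 0 < Num.sqrt (3 / m%:R) :> R by rewrite sqrtr_gt0 divr_gt0.
rewrite /phi normrX -exprMn lerXn2r ?nnegrE ?mulr_ge0 ?sqrtr_ge0 ?invr_ge0 ?(ltW x0) //.
apply: (le_trans (normr_sinc_leV _)); first by rewrite mulr_gt0.
rewrite invfM; apply: ler_wpM2r; first by rewrite invr_ge0 ltW.
by rewrite -sqrtrV ?divr_ge0 ?(ltW m0') // invf_div.
Qed.

(** The cut corresponds to y >= 12/5, that is x^2 >= (48/25) m. It starts before the end x^2 =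
    (25/12) n of the central range so that it also serves m = n + 1: (48/25)(n + 1) <= (25/12) n
    holds from n = 12 on. The summand 0 matches the form of [integral_invX]. *)
Definition tail m : R -> R :=
  (fun x => Num.sqrt (m%:R / 3) ^+ m * ((x + 0)^-1) ^+ m) \_ `[12 / 5 * Num.sqrt (m%:R / 3), +oo[.

Let tail_start_gt0 m : 0 < 12 / 5 * Num.sqrt (m.+2%:R / 3) + 0 :> R.
Proof. by rewrite addr0 mulr_gt0 ?divr_gt0 // sqrtr_gt0 divr_gt0 // ltr0n. Qed.

Let tail_sub m : `[12 / 5 * Num.sqrt (m.+2%:R / 3), +oo[%classic `<=` D.
Proof. by apply: subset_itvr; rewrite bnd_simp -[ltRHS]addr0. Qed.

Lemma hintegrable_tail m : hintegrable (tail m.+2).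
Proof.
rewrite /hintegrable /tail -restrict_EFin.
apply: (@integrableS _ _ _ _ setT) => //.
apply: (integrable_mkcond _ _).1 => //.
exact: (integrableZl _ _ (integrable_invX m (tail_start_gt0 m))).
Qed.

Lemma integral_tail m : \int[mu]_(x in D) tail m.+2 x =
  Num.sqrt (m.+2%:R / 3) / m.+1%:R * (5 / 12) ^+ m.+1.
Proof.
rewrite /tail -Rintegral_mkcondr setIidr; last exact: tail_sub.
rewrite RintegralZl //; last exact: integrable_invX (tail_start_gt0 m).
rewrite /Rintegral integral_invX //= addr0.
have s0 : 0 < Num.sqrt (m.+2%:R / 3) :> R by rewrite sqrtr_gt0 divr_gt0 // ltr0n.
move: (Num.sqrt (m.+2%:R / 3)) s0 => s s0.
rewrite exprS invfM invf_div exprMn mulrA.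
have -> : s * s ^+ m.+1 * ((5 / 12) ^+ m.+1 * s^-1 ^+ m.+1) = s * (5 / 12) ^+ m.+1 * (s / s) ^+ m.+1.
  by rewrite [(s / s) ^+ _]exprMn -!mulrA; congr (_ * _); rewrite mulrCA.
by rewrite divff ?gt_eqF // expr1n mulr1 mulrAC.
Qed.

Lemma tail_le m : (10 <= m)%N -> \int[mu]_(x in D) tail m.+2 x <= 2 / 11 * (5 / 12) ^+ m.+1.
Proof.
move=> m10; rewrite integral_tail ler_wpM2r ?exprn_ge0 ?divr_ge0 //.
rewrite ler_pdivrMr ?ltr0n //.
have m10' : 10 <= m%:R :> R by rewrite ler_nat.
have s0 : 0 <= Num.sqrt (m.+2%:R / 3) :> R by exact: sqrtr_ge0.
have s2 : Num.sqrt (m.+2%:R / 3) ^+ 2 = m.+2%:R / 3 :> R by rewrite sqr_sqrtr // divr_ge0.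
(* The tangent to the square root at 4, its argument for m = 10, where the inequality is an
   equality. *)
have := sqr_ge0 (Num.sqrt (m.+2%:R / 3) - 2 : R).
rewrite sqrrB s2 -(natr1 m) -(natr1 m.+1) -(natr1 m); move: m10' s0; lra.
Qed.

(** In units of [gap_cst n] the bound is a constant times n (n + 1) (5/12)^n, which decreases from n
    = 12 on; its value there is just below 55/1000. *)
Lemma tails_le n : (12 <= n)%N ->
  \int[mu]_(x in D) tail n x + \int[mu]_(x in D) tail n.+1 x <= gap_cst n * (55 / 1000%:R).
Proof.
move=> n12; case: n n12 => [|[|m]] // m10.
apply: (le_trans (lerD (@tail_le m m10) (@tail_le m.+1 (leqW m10)))).
have {m10} [k ->] : exists k, m = (k + 10)%N by exists (m - 10)%N; rewrite subnK.
have e1 : (k + 10).+2%:R = k%:R + 12 :> R by rewrite -addn2 -addnA natrD.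
have e2 : (k + 10).+3%:R = k%:R + 13 :> R by rewrite -addn3 -addnA natrD.
have k0 : 0 <= k%:R :> R by [].
have H : (k%:R + 12) * (k%:R + 13) * (5 / 12) ^+ k <= 156 :> R.
  elim: (k) => [|j IH]; first by rewrite mulr1 !add0r; lra.
  apply: le_trans IH; rewrite exprS mulrA; apply: ler_wpM2r; first by rewrite exprn_ge0 // divr_ge0.
  have : 0 <= j%:R :> R by [].
  rewrite -natr1; move: (j%:R) => c c0.
  by have := mulr_ge0 c0 c0; lra.
have q4 : (5 / 12) ^+ 4 <= 1 / 33 :> R by lra.
have q3 : (5 / 12) ^+ 3 <= 73 / 1000%:R :> R by lra.
have q11 : (5 / 12) ^+ 11 <= 1 / 33 * (1 / 33) * (73 / 1000%:R) :> R.
  have -> : (5 / 12) ^+ 11 = (5 / 12) ^+ 4 * (5 / 12) ^+ 4 * (5 / 12) ^+ 3 :> R by rewrite -!exprD.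
  have q0 j : 0 <= (5 / 12 : R) ^+ j by rewrite exprn_ge0 // divr_ge0.
  by apply: ler_pM; rewrite ?mulr_ge0 //; apply: ler_pM.
rewrite /gap_cst e1 e2 [(5 / 12) ^+ (k + 10).+2]exprS -addnS exprD.
have A0 : 0 < k%:R + 12 :> R by lra.
have B0 : 0 < k%:R + 13 :> R by lra.
have -> : (k%:R + 12)^-1 / (k%:R + 13) / 20 * (55 / 1000%:R) = (55 / 1000%:R / 20) / ((k%:R + 12) * (k%:R + 13)) :> R.
  by field; rewrite !gt_eqF.
rewrite ler_pdivlMr ?mulr_gt0 //.
have -> : (2 / 11 * ((5 / 12) ^+ k * (5 / 12) ^+ 11) + 2 / 11 * (5 / 12 * ((5 / 12) ^+ k * (5 / 12) ^+ 11))) * ((k%:R + 12) * (k%:R + 13)) =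
  (17 / 66) * (((k%:R + 12) * (k%:R + 13) * (5 / 12) ^+ k) * (5 / 12) ^+ 11) :> R by field.
have : ((k%:R + 12) * (k%:R + 13) * (5 / 12) ^+ k) * (5 / 12) ^+ 11 <= 156 * (1 / 33 * (1 / 33) * (73 / 1000%:R)) :> R.
  by apply: ler_pM; rewrite ?mulr_ge0 ?exprn_ge0 ?divr_ge0 ?(ltW A0) ?(ltW B0).
by move: (_ * _ ^+ 11) => z; lra.
Qed.

End large_dim.

(** * The sign of I_{d+1} - I_d for d >= 12 *)

Section large_dim_compare.
Context (R : realType).
Local Notation mu := (@lebesgue_measure R).
Local Notation D := (`]0%R, +oo[%classic : set R).
Implicit Types (x y z t u : R) (n m : nat).

Definition polyU : seq Q := [:: q0; Qfrac 25 819; Qfrac 1 288].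
Definition polyL : seq Q := [:: q0; q0; Qfrac 1 240; Qmul (Qfrac 1 105) (Qfrac 1 144);
  Qmul (Qfrac 1 160) (Qfrac 1 1728)].
(** Outside the central range the main term itself counts as an error. There u > 25 n / 12 >= 25, so
    (u/25)^10 >= 1 covers it by a polynomial term with a small Gaussian moment. *)
Definition polyE : seq Q :=
  padd (padd (pscale (Qfrac 1 2) (padd polyU polyL))
    (pscale (Qfrac 1 4) (padd [:: Qfrac 1 8] (pscale (Qfrac 8 1) (pexp (psub polyU polyL) 2)))))
    (pexp [:: q0; Qfrac 1 25] 10).

Lemma ev_polyE u : ev polyE u = errM u + (u / 25) ^+ 10.
Proof.
have hU : ev polyU u = errU u.
  by rewrite /polyU /errU /= !Q2R_frac // Q2R0; field.
have hL : ev polyL u = errL u.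
  by rewrite /polyL /errL /= !Q2RM !Q2R_frac // Q2R0; field.
rewrite /polyE !(ev_add, ev_scale, ev_exp) hU hL /errM Q2RN Q2R1.
have e8 : ev [:: Qfrac 1 8] u = 8^-1 by rewrite /= Q2R_frac //; field.
have e25 : ev [:: q0; Qfrac 1 25] u = u / 25 by rewrite /= Q2R_frac // Q2R0; field.
rewrite e8 e25 !Q2R_frac //.
by move: (_ ^+ 10) (errU u) (errL u) => w U L; field.
Qed.

(** The redundant factor 1 is the scale [X] of [gauss_ev_integral]. *)
Definition dominator n x : R := gap_cst R n * (x ^+ 4 * ev polyE (1 * x ^+ 2) * gauss x) + (tail n x + tail n.+1 x).

Lemma tail_ge0 n x : 0 < x -> 0 <= tail n x.
Proof.
move=> x0; rewrite /tail patchE; case: ifP => // _.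
by rewrite mulr_ge0 // exprn_ge0 // ?sqrtr_ge0 // invr_ge0 addr0 ltW.
Qed.

Lemma phi_diff_dominated n x : (12 <= n)%N -> 0 < x ->
  `|phi n.+1 x - phi n x - gap_cst R n * (x ^+ 4 * gauss x)| <= dominator n x.
Proof.
move=> n12 x0; have n0 : (0 < n)%N by exact: leq_trans n12.
have w0 : 0 <= x ^+ 4 * gauss x by rewrite mulr_ge0 ?expR_ge0 ?exprn_ge0 // ltW.
have c0 := ltW (gap_cst_gt0 R n0).
have cw0 : 0 <= gap_cst R n * (x ^+ 4 * gauss x) by rewrite mulr_ge0.
rewrite /dominator mul1r ev_polyE.
have -> : gap_cst R n * (x ^+ 4 * (errM (x ^+ 2) + (x ^+ 2 / 25) ^+ 10) * gauss x) =
  gap_cst R n * (x ^+ 4 * gauss x) * errM (x ^+ 2) + gap_cst R n * (x ^+ 4 * gauss x) * (x ^+ 2 / 25) ^+ 10.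
  by move: (_ ^+ 10) => w; ring.
have p0 : 0 <= (x ^+ 2 / 25) ^+ 10 by rewrite exprn_ge0 // divr_ge0 ?sqr_ge0.
have t1 := tail_ge0 n x0; have t2 := tail_ge0 n.+1 x0.
have M0 : 0 <= errM (x ^+ 2).
  apply: le_trans (errM_ge _).1; rewrite /errU; apply: addr_ge0; apply: mulr_ge0.
  - by apply: mulr_ge0; rewrite ?invr_ge0 ler0n.
  - exact: sqr_ge0.
  - exact: sqr_ge0.
  - by rewrite invr_ge0 ler0n.
have [h|h] := leP (x ^+ 2) (25 / 12 * n%:R).
  apply: (le_trans (phi_diff n12 x0 h)).
  rewrite -addrA lerDl addr_ge0 ?addr_ge0 //.
  exact: mulr_ge0.
have n12' : 12 <= n%:R :> R by rewrite ler_nat.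
have tE m : (0 < m)%N -> m%:R * (48 / 25) <= x ^+ 2 -> `|phi m x| <= tail m x.
  move=> m0 mx; apply: (le_trans (phi_tail m0 x0)).
  rewrite /tail patchE addr0 ifT // inE /= in_itv /= andbT.
  rewrite -[leRHS]ger0_norm ?(ltW x0) // -sqrtr_sqr -(@ger0_norm _ (12 / 5 * _)); last first.
    by rewrite mulr_ge0 ?sqrtr_ge0 // divr_ge0.
  rewrite -sqrtr_sqr ler_wsqrtr // exprMn sqr_sqrtr ?divr_ge0 //.
  by move: mx; lra.
have P1 : `|phi n x| <= tail n x by apply: tE => //; lra.
have P2 : `|phi n.+1 x| <= tail n.+1 x by apply: tE => //; rewrite -natr1; lra.
have cw : gap_cst R n * (x ^+ 4 * gauss x) <= gap_cst R n * (x ^+ 4 * gauss x) * (x ^+ 2 / 25) ^+ 10.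
  rewrite ler_peMr // exprn_ege1 // ler_pdivlMr //; lra.
have M0' : 0 <= gap_cst R n * (x ^+ 4 * gauss x) * errM (x ^+ 2) by exact: mulr_ge0.
apply: (le_trans (ler_normB _ _)); rewrite (ger0_norm cw0).
apply: (le_trans (lerD (ler_normB _ _) (lexx _))).
move: cw M0' P1 P2; move: (_ * _ ^+ 10) (_ * errM _) => p q; lra.
Qed.

(** The error budget in units of [gap_cst n * gmoment 0]: less than 0.88 from [polyE], and at most
    0.11 from the tails as [gmoment 0] is at least 1/2. In these units the main term at frequency z
    is exp(-z^2/2) (z^4 - 6 z^2 + 3). *)
Definition total_err : Q := Qfrac 1085 1000.

Lemma gmoment2 : gmoment R 2 = Q2R R (Qnat 3) * gmoment R 0.
Proof. by rewrite !gmomentS Q2R_nat /= muln0 muln1; ring. Qed.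

Lemma integral_dominator n : (12 <= n)%N -> hintegrable (dominator n) /\
  \int[mu]_(x in D) dominator n x < gap_cst R n * (gmoment R 0 * Q2R R total_err).
Proof.
move=> n12; have n0 : (0 < n)%N by exact: leq_trans n12.
have c0 := gap_cst_gt0 R n0.
have [I1 I2] := gauss_ev_integral polyE 1 gmoment2.
have hT m : (2 <= m)%N -> hintegrable (tail m : R -> R).
  by case: m => [|[|k]] // _; exact: (@hintegrable_tail R k).
have T1 := hT n (leq_trans (isT : (2 <= 12)%N) n12).
have T2 := hT n.+1 (leq_trans (isT : (2 <= 12)%N) (leqW n12)).
have T := hintegrableD T1 T2.
split; first by apply: hintegrableD T; exact: hintegrableZ I1.
rewrite /dominator RintegralD //; last exact: hintegrableZ I1.
rewrite RintegralZl // RintegralD // I2.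
have H : ev (mweight (Qnat 3) 2 polyE) 1 < Q2R R (Qfrac 880 1000).
  rewrite -subr_gt0.
  have -> : Q2R R (Qfrac 880 1000) - ev (mweight (Qnat 3) 2 polyE) 1 =
    ev (psub [:: Qfrac 880 1000] (mweight (Qnat 3) 2 polyE)) 1 :> R.
    by rewrite ev_sub [ev [:: _] _]/= mulr0 addr0.
  (* A single cell of width 0 at 1: an evaluation at one point. *)
  apply: (@ppos_on _ q1 q0 _ 0); first by vm_compute.
  by rewrite Q2R1 Q2R0 mulr0 addr0 lexx.
have g0 := gmoment0_ge R.
have tl := tails_le R n12.
apply: (@le_lt_trans _ _ (gap_cst R n * (gmoment R 0 * ev (mweight (Qnat 3) 2 polyE) 1) + gap_cst R n * (55 / 1000%:R))).
  by rewrite lerD2l.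
rewrite -mulrDr ltr_pM2l //.
apply: (@lt_le_trans _ _ (gmoment R 0 * Q2R R (Qfrac 880 1000) + 55 / 1000%:R)).
  by rewrite ltrD2r ltr_pM2l //; lra.
rewrite !Q2R_frac //; move: g0; lra.
Qed.

Lemma hintegrable_cos_phi n z : (2 <= n)%N -> hintegrable (fun x => cos (z * x) * phi n x).
Proof.
case: n => [|[|n]] // _.
have a0 : 0 < Num.sqrt (3 / n.+2%:R) :> R by rewrite sqrtr_gt0 divr_gt0 // ltr0n.
pose f (x : R) := cos (z / Num.sqrt (3 / n.+2%:R) * x) * sinc x ^+ n.+2.
have mf : measurable_fun D f.
  apply: measurable_funM; first exact: measurable_cosM.
  by apply: measurable_funX; exact: measurable_sinc.
have := hintegrable_scale a0 mf; rewrite /f => H.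
apply: eq_integrable (H _) => //.
  move=> x _ /=; rewrite /phi; congr (cos _ * _)%:E.
  by rewrite mulrA divfK // gt_eqF.
apply: hintegrable_mulX; first exact: measurable_cosM.
by move=> y _; rewrite ler_norml cos_le1 cos_geN1.
Qed.

Definition cos_phi_int n z := \int[mu]_(x in D) (cos (z * x) * phi n x).

Lemma cos_phi_int_diff n z : (12 <= n)%N ->
  cos_phi_int n.+1 z - cos_phi_int n z =
    \int[mu]_(x in D) (cos (z * x) * (phi n.+1 x - phi n x)) /\
  hintegrable (fun x => cos (z * x) * (phi n.+1 x - phi n x)).
Proof.
move=> n12; have n2 : (2 <= n)%N by exact: leq_trans n12.
have i1 := hintegrable_cos_phi z n2; have i2 := hintegrable_cos_phi z (leqW n2).
have E : (fun x => cos (z * x) * (phi n.+1 x - phi n x)) = (fun x => cos (z * x) * phi n.+1 x - cos (z * x) * phi n x).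
  by apply/funext => x; rewrite mulrBr.
rewrite E; split; last exact: hintegrableB.
by rewrite RintegralB.
Qed.

(** The cosine is replaced by a Taylor lower bound (odd [k]) in the main term and by 1 in the error.
    Gaussian moments reduce the claim to a polynomial inequality in z^2. *)
Lemma cos_phi_diff_ge n z k : (12 <= n)%N -> odd k ->
  Q2R R total_err < ev (mweight (Qnat 3) 2 (cosl k)) (z ^+ 2) ->
  cos_phi_int n z < cos_phi_int n.+1 z.
Proof.
move=> n12 ok H; have n0 : (0 < n)%N by exact: leq_trans n12.
have c0 := gap_cst_gt0 R n0; have g0 := gmoment0_ge R.
rewrite -subr_gt0; have [-> iD] := cos_phi_int_diff z n12.
have [Ei Eu] := integral_dominator n12.
have [I1 I2] := gauss_ev_integral (cosl k) (z ^+ 2) gmoment2.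
have J := hintegrableZ (gap_cst R n) I1.
apply: (@lt_le_trans _ _ (\int[mu]_(x in D) (gap_cst R n * (x ^+ (2 * 2) * ev (cosl k) (z ^+ 2 * x ^+ 2) * gauss x) - dominator n x))).
  rewrite RintegralB // RintegralZl // I2 subr_gt0 (lt_trans Eu) // ltr_pM2l // ltr_pM2l //; lra.
apply: le_Rintegral => //; first exact: hintegrableB.
move=> x; rewrite /= in_itv /= andbT => x0.
have := phi_diff_dominated n12 x0.
have w0 : 0 <= gap_cst R n * (x ^+ 4 * gauss x) by rewrite mulr_ge0 ?(ltW c0) // mulr_ge0 ?expR_ge0 ?exprn_ge0 // ltW.
have C : ev (cosl k) (z ^+ 2 * x ^+ 2) <= cos (z * x).
  rewrite -exprMn ev_cosl.
  have [c _] := trig_taylor_bounds k (normr_ge0 (z * x)).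
  move: c; rewrite -signr_odd ok expr1 mulN1r oppr_ge0 subr_le0 -ev_cosl real_normK ?num_real // ev_cosl.
  by have [zx|zx] := ger0P (z * x); rewrite ?cosN.
have -> : (2 * 2 = 4)%N by [].
have -> : gap_cst R n * (x ^+ 4 * ev (cosl k) (z ^+ 2 * x ^+ 2) * gauss x) = gap_cst R n * (x ^+ 4 * gauss x) * ev (cosl k) (z ^+ 2 * x ^+ 2) by ring.
have C' := ler_wpM2l w0 C.
set K := gap_cst R n * (x ^+ 4 * gauss x) in C' *.
set E := phi n.+1 x - phi n x.
have Hc : `|cos (z * x) * (E - K)| <= `|E - K|.
  by rewrite normrM ler_piMl // ler_norml cos_le1 cos_geN1.
rewrite mulrBr ler_norml in Hc => h.
move/andP : Hc => [h1 _]; move: h1 h C'.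
move: `|_| (ev _ _) (cos _) => N e cz; lra.
Qed.

(** Even [k] makes the Taylor polynomial an upper bound for the cosine; the error is treated as in
    [cos_phi_diff_ge]. *)
Lemma cos_phi_diff_le n z k : (12 <= n)%N -> ~~ odd k ->
  ev (mweight (Qnat 3) 2 (cosl k)) (z ^+ 2) < - Q2R R total_err ->
  cos_phi_int n.+1 z < cos_phi_int n z.
Proof.
move=> n12 ok H; have n0 : (0 < n)%N by exact: leq_trans n12.
have c0 := gap_cst_gt0 R n0; have g0 := gmoment0_ge R.
rewrite -subr_lt0; have [-> iD] := cos_phi_int_diff z n12.
have [Ei Eu] := integral_dominator n12.
have [I1 I2] := gauss_ev_integral (cosl k) (z ^+ 2) gmoment2.
have J := hintegrableZ (gap_cst R n) I1.
apply: (@le_lt_trans _ _ (\int[mu]_(x in D) (gap_cst R n * (x ^+ (2 * 2) * ev (cosl k) (z ^+ 2 * x ^+ 2) * gauss x) + dominator n x))); last first.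
  rewrite RintegralD // RintegralZl // I2.
  have g1 : 0 < gmoment R 0 by lra.
  have : gap_cst R n * (gmoment R 0 * ev (mweight (Qnat 3) 2 (cosl k)) (z ^+ 2)) < gap_cst R n * (gmoment R 0 * - Q2R R total_err).
    by rewrite ltr_pM2l // ltr_pM2l.
  by rewrite !mulrN; move: Eu; lra.
apply: le_Rintegral => //; first exact: hintegrableD.
move=> x; rewrite /= in_itv /= andbT => x0.
have := phi_diff_dominated n12 x0.
have w0 : 0 <= gap_cst R n * (x ^+ 4 * gauss x) by rewrite mulr_ge0 ?(ltW c0) // mulr_ge0 ?expR_ge0 ?exprn_ge0 // ltW.
have C : cos (z * x) <= ev (cosl k) (z ^+ 2 * x ^+ 2).
  rewrite -exprMn ev_cosl.
  have [c _] := trig_taylor_bounds k (normr_ge0 (z * x)).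
  move: c; rewrite -signr_odd (negbTE ok) expr0 mul1r subr_ge0 -ev_cosl real_normK ?num_real // ev_cosl.
  by have [zx|zx] := ger0P (z * x); rewrite ?cosN.
have -> : (2 * 2 = 4)%N by [].
have -> : gap_cst R n * (x ^+ 4 * ev (cosl k) (z ^+ 2 * x ^+ 2) * gauss x) = gap_cst R n * (x ^+ 4 * gauss x) * ev (cosl k) (z ^+ 2 * x ^+ 2) by ring.
have C' := ler_wpM2l w0 C.
set K := gap_cst R n * (x ^+ 4 * gauss x) in C' *.
set E := phi n.+1 x - phi n x.
have Hc : `|cos (z * x) * (E - K)| <= `|E - K|.
  by rewrite normrM ler_piMl // ler_norml cos_le1 cos_geN1.
rewrite mulrBr ler_norml in Hc => h.
move/andP : Hc => [_ h1]; move: h1 h C'.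
move: `|_| (ev _ _) (cos _) => N e cz; lra.
Qed.

(* This is I_d(t) for d >= 2. *)
Definition section_density d t : R := Num.sqrt d%:R * irwin_hall d (d%:R / 2 + t * Num.sqrt d%:R).

(** Since sqrt d * sqrt(3/d) = sqrt 3, the substitution makes both the prefactor and the frequency
    independent of d. *)
Lemma section_density_fourier d t : (2 <= d)%N ->
  sinc2_int R * section_density d t = Num.sqrt 3 * cos_phi_int d (2 * Num.sqrt 3 * t).
Proof.
case: d => [|[|d]] // _.
rewrite /section_density mulrCA [d.+2%:R / 2 + _]addrC -irwin_hall_fourier.
have d0 : 0 < d.+2%:R :> R by rewrite ltr0n.
have a0 : 0 < Num.sqrt (3 / d.+2%:R) :> R by rewrite sqrtr_gt0 divr_gt0.
rewrite /fourier (hintegral_scale a0); last first.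
  apply: measurable_funM; first exact: measurable_cosM.
  by apply: measurable_funX; exact: measurable_sinc.
have E : Num.sqrt d.+2%:R * Num.sqrt (3 / d.+2%:R) = Num.sqrt 3 :> R.
  by rewrite -sqrtrM ?ler0n // mulrCA divff ?mulr1 // gt_eqF.
rewrite [LHS]mulrA E; congr (_ * _); apply: eq_Rintegral => x _.
rewrite /phi; congr (cos _ * _).
by rewrite -E; ring.
Qed.

Let freq_sqr t : (2 * Num.sqrt 3 * t) ^+ 2 = 12 * t ^+ 2.
Proof. by rewrite !exprMn sqr_sqrtr //; ring. Qed.

(** The squared frequency is 12 t^2. The bound 1/4 covers t up to 0.1443, just beyond the upper
    threshold of (i), in four cells of width 1/16. *)
Lemma section_density_incr n t : (12 <= n)%N -> 12 * t ^+ 2 <= 1 / 4 ->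
  section_density n t < section_density n.+1 t.
Proof.
move=> n12 t1; have n2 : (2 <= n)%N by exact: leq_trans n12.
rewrite -(ltr_pM2l (sinc2_int_gt0 R)) (section_density_fourier _ n2) (section_density_fourier _ (leqW n2)).
rewrite ltr_pM2l ?sqrtr_gt0 //.
apply: (@cos_phi_diff_ge _ _ 3) => //; rewrite freq_sqr.
have H : 0 < ev (psub (mweight (Qnat 3) 2 (cosl 3)) [:: total_err]) (12 * t ^+ 2).
  apply: (@ppos_gt0 _ (Qfrac 1 16) _ 3); first by vm_compute.
  rewrite mulr_ge0 ?sqr_ge0 //= Q2R_frac // (le_trans t1) //.
  by rewrite le_eqVlt; apply/orP; left; apply/eqP; field.
by move: H; rewrite ev_sub [ev [:: _] _]/= mulr0 addr0 subr_gt0.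
Qed.

(** The interval [1.99, 3] for 12 t^2 covers t from 0.4073 to 1/2, in ten cells. *)
Lemma section_density_decr n t : (12 <= n)%N -> 199 / 100 <= 12 * t ^+ 2 -> 12 * t ^+ 2 <= 3 ->
  section_density n.+1 t < section_density n t.
Proof.
move=> n12 t0 t1; have n2 : (2 <= n)%N by exact: leq_trans n12.
rewrite -(ltr_pM2l (sinc2_int_gt0 R)) (section_density_fourier _ n2) (section_density_fourier _ (leqW n2)).
rewrite ltr_pM2l ?sqrtr_gt0 //.
apply: (@cos_phi_diff_le _ _ 8) => //; rewrite freq_sqr.
have H : 0 < ev (psub [:: Qopp total_err] (mweight (Qnat 3) 2 (cosl 8))) (12 * t ^+ 2).
  apply: (@ppos_on _ (Qfrac 199 100) (Qfrac 101 1000) _ 9); first by vm_compute.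
  rewrite !Q2R_frac // t0 (le_trans t1) //.
  by rewrite le_eqVlt; apply/orP; left; apply/eqP; field.
by move: H; rewrite ev_sub [ev [:: _] _]/= mulr0 addr0 Q2RN subr_gt0.
Qed.

End large_dim_compare.

(** * Dimensions 4 to 12 by interval computation *)

Section small_dim.
Context (R : realType).
Implicit Types (x y z t w : R) (p : seq Q) (d K : nat).

(** One backward difference on a list of polynomials representing f(s), f(s - 1), ...; after d
    rounds a list of d + 1 entries is reduced to one. *)
Fixpoint dif (L : seq (seq Q)) : seq (seq Q) :=
  if L is p :: L' then
    if L' is q :: _ then psub p q :: dif L' else [::]
  else [::].

Lemma size_dif L : size (dif L) = (size L).-1.
Proof. by elim: L => [|p [|q L] IH] //=; rewrite IH. Qed.

Lemma nth_dif L j : (j.+1 < size L)%N -> nth [::] (dif L) j = psub (nth [::] L j) (nth [::] L j.+1).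
Proof.
elim: L j => [|p [|q L] IH] // [|j] jL //.
exact: (IH j).
Qed.

Lemma ev_iter_dif n L (f : R -> R) s x : (n < size L)%N ->
  (forall j, (j <= n)%N -> ev (nth [::] L j) x = f (s - j%:R)) ->
  ev (nth [::] (iter n dif L) 0) x = iter n (@nabla R) f s.
Proof.
elim: n L f => [|n IH] L f nL H; first by rewrite H // subr0.
rewrite !iterSr; apply: IH; first by rewrite size_dif; case: (L) nL.
move=> j jn; rewrite nth_dif; last exact: leq_ltn_trans nL.
rewrite ev_sub !H //; last exact: leqW.
by rewrite /nabla -natr1 opprD addrA.
Qed.

Fixpoint ifact n : Q := if n is m.+1 then Qred (Qmul (ifact m) (Qfrac 1 n)) else q1.

Lemma Q2R_ifact n : Q2R R (ifact n) = n`!%:R^-1.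
Proof.
elim: n => [|n IH] /=; first by rewrite Q2R1 invr1.
by rewrite Q2R_red Q2RM Q2R_frac // IH factS natrM invfM mul1r mulrC.
Qed.

Definition knot d j : Q := Qadd (Qfrac d 2) (Qopp (Qnat j)).

Lemma Q2R_knot d j : Q2R R (knot d j) = d%:R / 2 - j%:R.
Proof. by rewrite Q2RD Q2RN Q2R_nat Q2R_frac. Qed.

(* The Irwin-Hall density at d/2 - w, as a polynomial in w, when exactly the
   truncated powers of index at most K are active. *)
Definition ihpoly d K : seq Q :=
  nth [::] (iter d dif [seq if (j <= K)%N then pscale (ifact d.-1) (pexp [:: knot d j; Qopp q1] d.-1) else [::] | j <- iota 0 d.+1]) 0.

Definition active d K w := 0 <= d%:R / 2 - K%:R - w /\ d%:R / 2 - K.+1%:R - w <= 0.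

Lemma ev_ihpoly d K w : active d.+2 K w -> ev (ihpoly d.+2 K) w = irwin_hall d.+2 (d.+2%:R / 2 - w).
Proof.
move=> [h1 h2]; apply: ev_iter_dif; first by rewrite size_map size_iota.
move=> j jd; rewrite (nth_map 0%N) ?size_iota // nth_iota // add0n.
rewrite /tpow /pospow.
have E : ev [:: knot d.+2 j; Qopp q1] w = d.+2%:R / 2 - w - j%:R.
  by rewrite /= Q2R_knot Q2RN Q2R1; ring.
case: ifPn => jK.
  rewrite ev_scale ev_exp E Q2R_ifact mulrC (max_idPr _) //.
  have : j%:R <= K%:R :> R by rewrite ler_nat.
  move: h1; lra.
rewrite (max_idPl _) ?expr0n ?mul0r //.
have : K.+1%:R <= j%:R :> R by rewrite ler_nat ltnNge.
move: h2; lra.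
Qed.

(* p (r t) = A t + r B t when r ^ 2 = d. *)
Fixpoint split_sqrt d p : seq Q * seq Q :=
  if p is c :: p' then
    let: (A, B) := split_sqrt d p' in (c :: pscale (Qnat d) B, q0 :: A)
  else ([::], [::]).

Lemma ev_split_sqrt d p r t : r ^+ 2 = d%:R ->
  ev p (r * t) = ev (split_sqrt d p).1 t + r * ev (split_sqrt d p).2 t.
Proof.
move=> r2; elim: p => [|c p IH] /=; first by rewrite mulr0 addr0.
rewrite IH; case: (split_sqrt d p) => A B /=.
rewrite ev_scale Q2R_nat Q2R0 -r2; ring.
Qed.

(** The cosine on the Fourier side is even. This moves the argument to d/2 - w, where fewer
    truncated powers are active. *)
Lemma section_densityN d t : (2 <= d)%N -> section_density d (- t) = section_density d t.
Proof.
move=> d2; apply: (mulfI (lt0r_neq0 (sinc2_int_gt0 R))); rewrite !section_density_fourier //.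
by congr (_ * _); apply: eq_Rintegral => x _; rewrite mulrN mulNr cosN.
Qed.

(** Multiplying A + sqrt d B by the prefactor sqrt d exchanges the two parts and turns B into d
    B. *)
Definition density_parts d K : seq Q * seq Q :=
  let: (A, B) := split_sqrt d (ihpoly d K) in (pscale (Qnat d) B, A).

Lemma section_density_parts d K t : active d.+2 K (t * Num.sqrt d.+2%:R) ->
  section_density d.+2 t = ev (density_parts d.+2 K).1 t + Num.sqrt d.+2%:R * ev (density_parts d.+2 K).2 t.
Proof.
move=> H; rewrite -section_densityN // /section_density mulNr -(ev_ihpoly H) /density_parts.
have r2 : Num.sqrt d.+2%:R ^+ 2 = d.+2%:R :> R by rewrite sqr_sqrtr ?ler0n.
rewrite [t * _]mulrC (ev_split_sqrt _ _ r2); case: (split_sqrt _ _) => A B /=.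
by rewrite ev_scale Q2R_nat mulrDr mulrA -expr2 r2 addrC.
Qed.

Definition ten12 : BinNums.positive := BinPos.Pos.pow (BinPos.Pos.of_nat 10) (BinPos.Pos.of_nat 12).
(** Twelve decimals of sqrt d from an integer square root; [sqrt_ok] certifies the enclosure by
    squaring. *)
Definition sqrt_lo d : Q :=
  Qmake (BinInt.Z.sqrt (BinInt.Z.mul (BinInt.Z.of_nat d) (Zpos (BinPos.Pos.mul ten12 ten12)))) ten12.
Definition sqrt_hi d : Q :=
  if Qle_bool (Qnat d) (Qmul (sqrt_lo d) (sqrt_lo d)) then sqrt_lo d
  else Qadd (sqrt_lo d) (Qmake (Zpos BinNums.xH) ten12).
Definition sqrt_ok d :=
  [&& Qle_bool q0 (sqrt_lo d), Qle_bool (Qmul (sqrt_lo d) (sqrt_lo d)) (Qnat d), Qle_bool q0 (sqrt_hi d) &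
     Qle_bool (Qnat d) (Qmul (sqrt_hi d) (sqrt_hi d))].

Lemma sqrt_bounds d : sqrt_ok d -> Q2R R (sqrt_lo d) <= Num.sqrt d%:R <= Q2R R (sqrt_hi d).
Proof.
move=> /and4P[/(Q2R_le R) l0 /(Q2R_le R) l /(Q2R_le R) h0 /(Q2R_le R) h].
move: l0 l h0 h; rewrite !Q2RM Q2R_nat Q2R0 -!expr2 => l0 l h0 h.
by rewrite -[X in X <= _ <= _](ger0_norm l0) -[X in _ <= _ <= X](ger0_norm h0) -!sqrtr_sqr !ler_wsqrtr.
Qed.

Definition active_check d K (a b : Q) : bool :=
  [&& sqrt_ok d, Qle_bool q0 a, Qle_bool q0 (Qadd (knot d K) (Qopp (Qmul b (sqrt_hi d)))) &
     Qle_bool (Qadd (knot d K.+1) (Qopp (Qmul a (sqrt_lo d)))) q0].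

Lemma active_checkP d K a b t : active_check d K a b -> Q2R R a <= t <= Q2R R b ->
  active d K (t * Num.sqrt d%:R).
Proof.
move=> /and4P[/sqrt_bounds/andP[l h] /(Q2R_le R) a0 /(Q2R_le R) c1 /(Q2R_le R) c2] /andP[ta tb].
move: a0 c1 c2; rewrite !Q2RD !Q2RN !Q2RM Q2R0 !Q2R_frac // !Q2R_nat => a0 c1 c2.
have s0 : 0 <= Num.sqrt d%:R :> R by exact: sqrtr_ge0.
have h1 : t * Num.sqrt d%:R <= Q2R R b * Q2R R (sqrt_hi d).
  by apply: ler_pM => //; exact: le_trans ta.
have h2 : Q2R R a * Q2R R (sqrt_lo d) <= t * Num.sqrt d%:R.
  apply: (@le_trans _ _ (Q2R R a * Num.sqrt d%:R)); first by rewrite ler_wpM2l.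
  by rewrite ler_wpM2r.
by split; [move: c1 h1|move: c2 h2]; lra.
Qed.

(** The endpoint is chosen by the sign of each coefficient, which bounds r p(t) from below for t >=
    0. *)
Definition pscale_lo (l u : Q) p := [seq Qred (Qmul (if Qle_bool q0 b then l else u) b) | b <- p].

Lemma ev_pscale_lo l u p r t : Q2R R l <= r <= Q2R R u -> 0 <= t ->
  ev (pscale_lo l u p) t <= r * ev p t.
Proof.
move=> /andP[lr ru] t0; elim: p => [|b p IH] /=; first by rewrite mulr0.
rewrite mulrDr [r * (t * _)]mulrCA Q2R_red Q2RM; apply: lerD; last exact: ler_wpM2l.
case: ifPn => b0; first by apply: ler_wpM2r => //; rewrite -(Q2R0 R); exact: Q2R_le.
apply: ler_wnM2r => //; rewrite -(Q2R0 R) ltW //; exact: Q2R_lt.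
Qed.

(* Fixed-point arithmetic: coefficients are scaled by fscale = 10^24 and rounded
   down, which keeps the kernel computations small and gives lower bounds for
   nonnegative arguments. *)

Fixpoint evz (p : seq Z) x : R := if p is c :: p' then Z2R R c + x * evz p' x else 0.

Fixpoint zadd (p q : seq Z) : seq Z :=
  match p, q with
  | [::], _ => q
  | _, [::] => p
  | a :: p', b :: q' => BinInt.Z.add a b :: zadd p' q'
  end.

Lemma evz_add (p q : seq Z) x : evz (zadd p q) x = evz p x + evz q x.
Proof.
elim: p q => [|a p IH] [|b q] /=; rewrite ?add0r ?addr0 //.
by rewrite IH Z2RD; ring.
Qed.

Fixpoint zshift1 (p : seq Z) : seq Z :=
  if p is c :: p' then let q := zshift1 p' in zadd (c :: q) q else [::].

Lemma evz_shift1 (p : seq Z) x : evz (zshift1 p) x = evz p (x + 1).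
Proof. by elim: p => // c p IH; rewrite /zshift1 -/(zshift1 p) evz_add /= IH; ring. Qed.

Definition zlb (p : seq Z) : Z := foldr (fun c l => BinInt.Z.add c (BinInt.Z.min BinNums.Z0 l)) BinNums.Z0 p.

Lemma zlb_le (p : seq Z) x : 0 <= x <= 1 -> Z2R R (zlb p) <= evz p x.
Proof.
move=> /andP[x0 x1]; elim: p => [|c p IH] //=.
rewrite Z2RD lerD2l.
have [e0|e0] := leP 0 (evz p x).
  by apply: (@le_trans _ _ 0); [rewrite -[leRHS]/(Z2R R BinNums.Z0) Z2R_le //; lia|rewrite mulr_ge0].
apply: (@le_trans _ _ (evz p x)); last by rewrite ler_niMl // ltW.
by apply: le_trans IH; rewrite Z2R_le //; lia.
Qed.

Fixpoint zpos (p : seq Z) n : bool :=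
  if n is m.+1 then BinInt.Z.ltb BinNums.Z0 (zlb p) && zpos (zshift1 p) m else true.

Lemma zpos_gt0 n (p : seq Z) x : zpos p n.+1 -> 0 <= x <= n.+1%:R -> 0 < evz p x.
Proof.
elim: n p x => [|n IH] p x.
  rewrite /= andbT => /(Z2R_lt R) H xh; exact: lt_le_trans H (zlb_le _ xh).
rewrite -[zpos _ _]/(_ && zpos (zshift1 p) n.+1) => /andP[H1 H2] /andP[x0 xh].
have [xh'|xh'] := leP x 1.
  by move: (Z2R_lt R H1) => H; apply: lt_le_trans H (zlb_le _ _); rewrite x0.
have := IH _ (x - 1) H2; rewrite evz_shift1 subrK; apply.
by move: xh; rewrite -(natr1 n.+1); move: xh'; lra.
Qed.

Definition zmulf (a : Q) (c : Z) : Z := BinInt.Z.div (BinInt.Z.mul (Qnum a) c) (Zpos (Qden a)).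

Lemma zmulf_le a c : Z2R R (zmulf a c) <= Q2R R a * Z2R R c.
Proof.
rewrite /Q2R mulrAC ler_pdivlMr ?Z2R_pos // -!Z2RM; apply: Z2R_le.
apply/BinInt.Z.leb_spec0; rewrite /zmulf BinInt.Z.mul_comm.
exact: BinInt.Z.mul_div_le.
Qed.

Lemma evz_mulf a (p : seq Z) x : 0 <= x -> evz [seq zmulf a c | c <- p] x <= Q2R R a * evz p x.
Proof.
move=> x0; elim: p => [|c p IH] /=; first by rewrite mulr0.
by rewrite mulrDr mulrCA lerD ?zmulf_le // ler_wpM2l.
Qed.

Definition fscale : Z := Zpos (BinPos.Pos.mul ten12 ten12).

(** Horner substitution of a + h x with every product rounded down. Cells then have width 1 in x,
    and passing to the next one with [zshift1] takes additions only. *)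
Fixpoint zcomp (a h : Q) (p : seq Q) : seq Z :=
  if p is c :: p' then
    let q := zcomp a h p' in
    zadd (zmulf c fscale :: [seq zmulf h c | c <- q]) [seq zmulf a c | c <- q]
  else [::].

Lemma evz_comp a h p x : 0 <= Q2R R a -> 0 <= Q2R R h -> 0 <= x ->
  evz (zcomp a h p) x <= Z2R R fscale * ev p (Q2R R a + Q2R R h * x).
Proof.
move=> a0 h0 x0; elim: p => [|c p IH]; first by rewrite /= mulr0.
rewrite /zcomp -/(zcomp a h p) evz_add -[ev _ _]/(Q2R R c + _ * ev p _) -[evz (_ :: _) _]/(Z2R R _ + x * evz _ x).
have H : (Q2R R a + Q2R R h * x) * evz (zcomp a h p) x <= (Q2R R a + Q2R R h * x) * (Z2R R fscale * ev p (Q2R R a + Q2R R h * x)).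
  by apply: ler_wpM2l IH; apply: addr_ge0 => //; exact: mulr_ge0.
have H1 := evz_mulf a (zcomp a h p) x0.
have H2 := ler_wpM2l x0 (evz_mulf h (zcomp a h p) x0).
have H3 := zmulf_le c fscale.
move: H H1 H2 H3; set N := Z2R R fscale; set E := ev p _; set u := evz (zcomp a h p) x.
set v := evz [seq zmulf a c | c <- zcomp a h p] x; set w := evz [seq zmulf h c | c <- zcomp a h p] x.
set z := Z2R R (zmulf c fscale); clearbody N E u v w z.
clear IH a0 h0; move: (Q2R R a) (Q2R R h) (Q2R R c) => ra rh rc; lra.
Qed.

(** Certifies A' - A + r' B' - r B > 0 for r = sqrt d and r' = sqrt d'; the factor -r is enclosed by
    the negated bounds of r in reverse order. *)
Definition density_lt_check d K d' K' (a h : Q) n : bool :=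
  let: (A, B) := density_parts d K in
  let: (A', B') := density_parts d' K' in
  [&& sqrt_ok d, sqrt_ok d', Qle_bool q0 a, Qle_bool q0 h &
    zpos (zcomp a h (padd (psub A' A) (padd (pscale_lo (sqrt_lo d') (sqrt_hi d') B')
      (pscale_lo (Qopp (sqrt_hi d)) (Qopp (sqrt_lo d)) B)))) n.+1].

Lemma density_lt_checkP d K d' K' a h n t : (2 <= d)%N -> (2 <= d')%N ->
  density_lt_check d K d' K' a h n ->
  Q2R R a <= t <= Q2R R a + n.+1%:R * Q2R R h -> 0 < Q2R R h ->
  active d K (t * Num.sqrt d%:R) -> active d' K' (t * Num.sqrt d'%:R) ->
  section_density d t < section_density d' t.
Proof.
case: d => [|[|d]] // _; case: d' => [|[|d']] // _.
move=> C /andP[t1 t2] hp ac ac'; rewrite (section_density_parts ac) (section_density_parts ac').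
move: C; rewrite /density_lt_check.
case: (density_parts d.+2 K) => A B; case: (density_parts d'.+2 K') => A' B'.
move=> /and5P[/sqrt_bounds/andP[l u] /sqrt_bounds lu' /(Q2R_le R) a0 /(Q2R_le R) h0 C].
rewrite Q2R0 in a0; rewrite Q2R0 in h0.
have t0 : 0 <= t := le_trans a0 t1.
pose s := (t - Q2R R a) / Q2R R h.
have s0 : 0 <= s by rewrite divr_ge0 // subr_ge0.
have ts : Q2R R a + Q2R R h * s = t by rewrite mulrCA divff ?gt_eqF // mulr1 addrC subrK.
have sn : 0 <= s <= n.+1%:R by rewrite s0 ler_pdivrMr // lerBlDl.
have := lt_le_trans (zpos_gt0 C sn) (evz_comp _ a0 h0 s0).
rewrite ts (pmulr_rgt0 _ (Z2R_pos _ _)) ev_add ev_sub ev_add [(A, B).1]/= [(A, B).2]/= [(A', B').1]/= [(A', B').2]/=.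
have e1 := ev_pscale_lo B' lu' t0.
have lu : Q2R R (Qopp (sqrt_hi d.+2)) <= - Num.sqrt d.+2%:R <= Q2R R (Qopp (sqrt_lo d.+2)).
  by rewrite !Q2RN !lerN2 u l.
have e2 := ev_pscale_lo B lu t0.
move: e1 e2; rewrite mulNr; move: (ev (pscale_lo _ _ _) _) (ev (pscale_lo _ _ _) _) => x y; clear; lra.
Qed.

Fixpoint pow10 k : BinNums.positive :=
  if k is j.+1 then BinPos.Pos.mul (BinPos.Pos.of_nat 10) (pow10 j) else BinNums.xH.

Definition Qdec m k : Q := Qmake (BinInt.Z.of_nat m) (pow10 k).

Lemma Q2R_dec m k : Q2R R (Qdec m k) = m%:R / 10 ^+ k.
Proof.
have -> : m%:R = Z2R R (BinInt.Z.of_nat m) by rewrite -Q2R_nat /Q2R [Z2R R (Zpos _)]/(1%:~R) divr1.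
rewrite /Q2R /Qdec; congr (_ / _).
elim: k => [|k IH]; first by [].
rewrite -[Qden _]/(BinPos.Pos.mul (BinPos.Pos.of_nat 10) (pow10 k)) BinInt.Pos2Z.inj_mul Z2RM exprS.
by rewrite -[Zpos (pow10 k)]/(Zpos (Qden (Qmake (BinInt.Z.of_nat m) (pow10 k)))) IH.
Qed.

(** For these t and d, t sqrt d stays below 1/2, so a single index K serves the whole interval for
    either parity of d. Twenty cells of width 0.003685 fill [0.0705, 0.1442]. *)
Definition check_incr d :=
  [&& active_check d d.-1./2 (Qdec 705 4) (Qdec 1442 4),
      active_check d.+1 d./2 (Qdec 705 4) (Qdec 1442 4) &
      density_lt_check d d.-1./2 d.+1 d./2 (Qdec 705 4) (Qdec 3685 6) 19].

Lemma check_incr_all : all check_incr (iota 4 8).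
Proof. by vm_compute. Qed.

Lemma section_density_incr_small d t : (4 <= d < 12)%N -> 705 / 10 ^+ 4 <= t <= 1442 / 10 ^+ 4 ->
  section_density d t < section_density d.+1 t.
Proof.
move=> d4 t01; have := allP check_incr_all d; rewrite mem_iota => /(_ d4).
rewrite /check_incr => /and3P[c1 c2 c3].
have d2 : (2 <= d)%N by case/andP: d4 => d4 _; exact: leq_trans d4.
have t01' : Q2R R (Qdec 705 4) <= t <= Q2R R (Qdec 1442 4) by rewrite !Q2R_dec.
apply: (density_lt_checkP d2 (leqW d2) c3) (active_checkP c1 t01') (active_checkP c2 t01').
  have -> : Q2R R (Qdec 705 4) + 20%:R * Q2R R (Qdec 3685 6) = Q2R R (Qdec 1442 4) by rewrite -Q2R_nat -Q2RM -Q2RD; apply: Q2R_eq; vm_compute.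
  exact: t01'.
by rewrite -(Q2R0 R); apply: Q2R_lt; vm_compute.
Qed.

(* On [0.4074, 0.5] the index K is constant, except for d = 6 and d = 11, where
   it changes at t = 1/sqrt 6 and t = 3/(2 sqrt 11). *)
Definition active_index d b : nat :=
  nth 0%N [:: 0; 0; 0; 0; 1; 1; if b then 2 else 1; 2; 2; 3; 3; if b then 4 else 3; 4]%N d.

Definition check_decr b d (a h : Q) n :=
  density_lt_check d.+1 (active_index d.+1 b) d (active_index d b) a h n.

Lemma check_decr_reg : all (fun d => check_decr true d (Qdec 4074 4) (Qdec 463 5) 19) [:: 4; 7; 8; 9]%N.
Proof. by vm_compute. Qed.
(** Pairs involving d = 6, and below those involving d = 11, are checked on both sides of the change
    of index, on slightly overlapping rational intervals because the point itself is irrational. *)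
Lemma check_decr6t : all (fun d => check_decr true d (Qdec 4074 4) (Qdec 9 4) 0) [:: 5; 6]%N.
Proof. by vm_compute. Qed.
Lemma check_decr6f : all (fun d => check_decr false d (Qdec 4082 4) (Qdec 459 5) 19) [:: 5; 6]%N.
Proof. by vm_compute. Qed.
Lemma check_decr11t : all (fun d => check_decr true d (Qdec 4074 4) (Qdec 449 5) 9) [:: 10; 11]%N.
Proof. by vm_compute. Qed.
Lemma check_decr11f : all (fun d => check_decr false d (Qdec 4522 4) (Qdec 478 5) 9) [:: 10; 11]%N.
Proof. by vm_compute. Qed.
Lemma active_check_decr : all (fun d => active_check d (active_index d true) (Qdec 4074 4) (Qdec 5 1)) [:: 4; 5; 7; 8; 9; 10; 12]%N.
Proof. by vm_compute. Qed.

Lemma check_decr_lt b d a h n t : (2 <= d)%N -> check_decr b d a h n -> Q2R R a <= t ->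
  t <= Q2R R (Qadd a (Qmul (Qnat n.+1) h)) -> Qltb q0 h ->
  active d (active_index d b) (t * Num.sqrt d%:R) ->
  active d.+1 (active_index d.+1 b) (t * Num.sqrt d.+1%:R) ->
  section_density d.+1 t < section_density d t.
Proof.
rewrite Q2RD Q2RM Q2R_nat => d2 c ta tb /(Q2R_lt R); rewrite Q2R0 => h0 A A'.
by apply: (density_lt_checkP (leqW d2) d2 c) A' A => //; rewrite ta tb.
Qed.

Lemma sqrt_between a b x : 0 <= a -> 0 <= b -> a ^+ 2 <= x -> x <= b ^+ 2 ->
  a <= Num.sqrt x /\ Num.sqrt x <= b.
Proof.
move=> a0 b0 ax xb; split.
  by rewrite -(ger0_norm a0) -sqrtr_sqr ler_wsqrtr.
by rewrite -[leRHS](ger0_norm b0) -sqrtr_sqr ler_wsqrtr.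
Qed.

(** Converts the position relative to 1/sqrt 6 = 0.40824... into the rational ends 0.4083 and 0.4082
    of the two checks. *)
Lemma knot6 t : 4074 / 10 ^+ 4 <= t -> t <= 1 / 2 ->
  (t * Num.sqrt 6%:R <= 1 -> active 6 2 (t * Num.sqrt 6%:R) /\ t <= 4083 / 10 ^+ 4) /\
  (1 < t * Num.sqrt 6%:R -> active 6 1 (t * Num.sqrt 6%:R) /\ 4082 / 10 ^+ 4 <= t).
Proof.
move=> t0 t1; have tp : 0 <= t by lra.
have [||||] := @sqrt_between (244 / 10 ^+ 2 + 94 / 10 ^+ 4) (244 / 10 ^+ 2 + 95 / 10 ^+ 4) 6%:R; [lra|lra|lra|lra|].
rewrite /active; move: (Num.sqrt _) => s sl su.
have h1 := ler_wpM2l tp sl; have h2 := ler_wpM2l tp su.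
by split=> w; split; [split| |split|]; lra.
Qed.

Lemma knot11 t : 4074 / 10 ^+ 4 <= t -> t <= 1 / 2 ->
  (t * Num.sqrt 11%:R <= 3 / 2 -> active 11 4 (t * Num.sqrt 11%:R) /\ t <= 4523 / 10 ^+ 4) /\
  (3 / 2 < t * Num.sqrt 11%:R -> active 11 3 (t * Num.sqrt 11%:R) /\ 4522 / 10 ^+ 4 <= t).
Proof.
move=> t0 t1; have tp : 0 <= t by lra.
have [||||] := @sqrt_between (331 / 10 ^+ 2 + 66 / 10 ^+ 4) (331 / 10 ^+ 2 + 67 / 10 ^+ 4) 11%:R; [lra|lra|lra|lra|].
rewrite /active; move: (Num.sqrt _) => s sl su.
have h1 := ler_wpM2l tp sl; have h2 := ler_wpM2l tp su.
by split=> w; split; [split| |split|]; lra.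
Qed.

Lemma section_density_decr_small d t : (4 <= d < 12)%N -> 4074 / 10 ^+ 4 <= t <= 1 / 2 ->
  section_density d.+1 t < section_density d t.
Proof.
move=> d4 /andP[t0 t1].
have [k6t k6f] := knot6 t0 t1; have [k11t k11f] := knot11 t0 t1.
have E2 : Q2R R (Qdec 5 1) = 1 / 2 by rewrite Q2R_dec; field.
have t0' : Q2R R (Qdec 4074 4) <= t by rewrite Q2R_dec.
have act k : k \in [:: 4; 5; 7; 8; 9; 10; 12]%N -> active k (active_index k true) (t * Num.sqrt k%:R).
  move=> kin; apply: (active_checkP (allP active_check_decr k kin)).
  by rewrite t0' E2.
have le_end a n h b : t <= Q2R R b -> Qle_bool b (Qadd a (Qmul (Qnat n.+1) h)) ->
    t <= Q2R R (Qadd a (Qmul (Qnat n.+1) h)).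
  by move=> tb /(Q2R_le R); exact: le_trans.
have top : t <= Q2R R (Qdec 5 1) by rewrite E2.
have reg k : k \in [:: 4; 7; 8; 9]%N -> k.+1 \in [:: 5; 8; 9; 10]%N -> section_density k.+1 t < section_density k t.
  move=> kin kin'; have c := allP check_decr_reg k kin.
  apply: (check_decr_lt _ c t0').
  - by move: kin; rewrite !inE => /or4P[] /eqP ->.
  - by apply: (le_end _ _ _ _ top); vm_compute.
  - by vm_compute.
  - by apply: act; move: kin; rewrite !inE => /or4P[] /eqP ->.
  - by apply: act; move: kin'; rewrite !inE => /or4P[] /eqP ->.
have d56 k : k \in [:: 5; 6]%N -> section_density k.+1 t < section_density k t.
  move=> kin; have k2 : (2 <= k)%N by move: kin; rewrite !inE => /orP[] /eqP ->.
  have [w|w] := leP (t * Num.sqrt 6%:R) 1.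
    have [A tu] := k6t w; have tu' : t <= Q2R R (Qdec 4083 4) by rewrite Q2R_dec.
    apply: (check_decr_lt k2 (allP check_decr6t k kin) t0').
    - by apply: (le_end _ _ _ _ tu'); vm_compute.
    - by vm_compute.
    - by move: kin; rewrite !inE => /orP[] /eqP ->; [exact: (act 5)|exact: A].
    - by move: kin; rewrite !inE => /orP[] /eqP ->; [exact: A|exact: (act 7)].
  have [A tl] := k6f w; have tl' : Q2R R (Qdec 4082 4) <= t by rewrite Q2R_dec.
  apply: (check_decr_lt k2 (allP check_decr6f k kin) tl').
  - by apply: (le_end _ _ _ _ top); vm_compute.
  - by vm_compute.
  - by move: kin; rewrite !inE => /orP[] /eqP ->; [exact: (act 5)|exact: A].
  - by move: kin; rewrite !inE => /orP[] /eqP ->; [exact: A|exact: (act 7)].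
have d1011 k : k \in [:: 10; 11]%N -> section_density k.+1 t < section_density k t.
  move=> kin; have k2 : (2 <= k)%N by move: kin; rewrite !inE => /orP[] /eqP ->.
  have [w|w] := leP (t * Num.sqrt 11%:R) (3 / 2).
    have [A tu] := k11t w; have tu' : t <= Q2R R (Qdec 4523 4) by rewrite Q2R_dec.
    apply: (check_decr_lt k2 (allP check_decr11t k kin) t0').
    - by apply: (le_end _ _ _ _ tu'); vm_compute.
    - by vm_compute.
    - by move: kin; rewrite !inE => /orP[] /eqP ->; [exact: (act 10)|exact: A].
    - by move: kin; rewrite !inE => /orP[] /eqP ->; [exact: A|exact: (act 12)].
  have [A tl] := k11f w; have tl' : Q2R R (Qdec 4522 4) <= t by rewrite Q2R_dec.
  apply: (check_decr_lt k2 (allP check_decr11f k kin) tl').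
  - by apply: (le_end _ _ _ _ top); vm_compute.
  - by vm_compute.
  - by move: kin; rewrite !inE => /orP[] /eqP ->; [exact: (act 10)|exact: A].
  - by move: kin; rewrite !inE => /orP[] /eqP ->; [exact: A|exact: (act 12)].
case/andP: d4 => d4 d12.
have : d \in iota 4 8 by rewrite mem_iota d4.
rewrite /= !inE => /or4P[/eqP->|/eqP->|/eqP->|/or4P[/eqP->|/eqP->|/eqP->|/orP[/eqP->|/eqP->]]].
- exact: reg.
- exact: d56.
- exact: d56.
- exact: reg.
- exact: reg.
- exact: reg.
- exact: d1011.
- exact: d1011.
Qed.

End small_dim.

(** * Dimensions 1 to 4, the thresholds, and the assembly *)

Section low_dim.
Context (R : realType).
Implicit Types (x y t w : R).
Local Notation s2 := (Num.sqrt 2 : R).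
Local Notation s3 := (Num.sqrt 3 : R).
Local Notation s6 := (Num.sqrt 6 : R).

Lemma section_volume_density d t : (2 <= d)%N -> 0 <= t -> section_volume d t = (section_density d t)%:E.
Proof.
case: d => [|[|k]] // _ t0; rewrite section_volumeE // slab_irwin_hall -EFinM.
by rewrite /section_density.
Qed.

Lemma section_volume1 t : 0 <= t -> t <= 1 / 2 -> section_volume 1 t = 1%E.
Proof.
move=> t0 t1; rewrite section_volumeE // sqrtr1 mulr1 slab0 mul1e ifT //.
apply/andP; split; lra.
Qed.

(** The closed form [p] is supplied by hand, and its equality with [ihpoly d K] is settled by
    computation. *)
Lemma section_density_active d K p t : (2 <= d)%N -> active d K (t * Num.sqrt d%:R) -> ihpoly d K = p ->
  section_density d t = Num.sqrt d%:R * ev p (t * Num.sqrt d%:R).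
Proof.
case: d => [|[|d]] // _ H <-; rewrite (ev_ihpoly H) -section_densityN //.
by rewrite /section_density mulNr.
Qed.

Lemma sqrt2_bounds : 1414 / 10 ^+ 3 <= s2 /\ s2 <= 1415 / 10 ^+ 3.
Proof. by apply: (@sqrt_between R (1414 / 10 ^+ 3) (1415 / 10 ^+ 3)); lra. Qed.

Lemma sqrt3_bounds : 1732 / 10 ^+ 3 + 50 / 10 ^+ 6 + 807 / 10 ^+ 9 + 568 / 10 ^+ 12 <= s3 /\
  s3 <= 1732 / 10 ^+ 3 + 50 / 10 ^+ 6 + 807 / 10 ^+ 9 + 569 / 10 ^+ 12.
Proof.
by apply: (@sqrt_between R (1732 / 10 ^+ 3 + 50 / 10 ^+ 6 + 807 / 10 ^+ 9 + 568 / 10 ^+ 12)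
  (1732 / 10 ^+ 3 + 50 / 10 ^+ 6 + 807 / 10 ^+ 9 + 569 / 10 ^+ 12)); lra.
Qed.

Lemma sqrt6_bounds : 2449 / 10 ^+ 3 + 489 / 10 ^+ 6 + 742 / 10 ^+ 9 + 783 / 10 ^+ 12 <= s6 /\
  s6 <= 2449 / 10 ^+ 3 + 489 / 10 ^+ 6 + 742 / 10 ^+ 9 + 784 / 10 ^+ 12.
Proof.
by apply: (@sqrt_between R (2449 / 10 ^+ 3 + 489 / 10 ^+ 6 + 742 / 10 ^+ 9 + 783 / 10 ^+ 12)
  (2449 / 10 ^+ 3 + 489 / 10 ^+ 6 + 742 / 10 ^+ 9 + 784 / 10 ^+ 12)); lra.
Qed.

Lemma sqrt3_sqr : s3 * s3 = 3.
Proof. by rewrite -expr2 sqr_sqrtr // ler0n. Qed.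

Lemma section_density2 t : 0 <= t -> t <= 1 / 2 -> section_density 2 t = s2 - 2 * t.
Proof.
move=> t0 t1; have [l u] := sqrt2_bounds.
have w : t * s2 <= 1 / 2 * (1415 / 10 ^+ 3) by apply: ler_pM => //; exact: sqrtr_ge0.
have w0 : 0 <= t * s2 by rewrite mulr_ge0 ?sqrtr_ge0.
rewrite (@section_density_active 2 0 [:: q1; Qopp q1]) //; last first.
  by rewrite /active; split; lra.
rewrite /= Q2RN Q2R1 mulr0 addr0 mulrN1 mulrBr mulr1 mulrCA -expr2 sqr_sqrtr ?ler0n //.
by rewrite [t * _]mulrC.
Qed.

(** For d = 3 the index changes at t = 1/(2 sqrt 3) = 0.288..., between the two ranges of interest,
    hence the separate formulas for small and large t. *)
Lemma section_density3_in t : 0 <= t -> t <= 1 / 4 -> section_density 3 t = s3 * (3 / 4 - 3 * t ^+ 2).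
Proof.
move=> t0 t1; have [_ u] := sqrt3_bounds.
have u' : s3 <= 1733 / 10 ^+ 3 by lra.
have w : t * s3 <= 1 / 4 * (1733 / 10 ^+ 3) by apply: ler_pM => //; exact: sqrtr_ge0.
have w0 : 0 <= t * s3 by rewrite mulr_ge0 ?sqrtr_ge0.
rewrite (@section_density_active 3 1 [:: Qfrac 3 4; q0; Qopp q1]) //; last first.
  by rewrite /active; clear u u'; split; lra.
rewrite /= Q2RN Q2R1 Q2R0 Q2R_frac //; congr (_ * _).
have -> : 3 * t ^+ 2 = (s3 * s3) * t ^+ 2 by rewrite sqrt3_sqr.
by ring.
Qed.

Lemma section_density3_out t : 4 / 10 <= t -> t <= 1 / 2 ->
  section_density 3 t = 9 / 8 * s3 - 9 / 2 * t + 3 / 2 * s3 * t ^+ 2.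
Proof.
move=> t0 t1; have [l u] := sqrt3_bounds.
have u' : s3 <= 1733 / 10 ^+ 3 by lra.
have l' : 1732 / 10 ^+ 3 <= s3 by lra.
clear l u.
have w : t * s3 <= 1 / 2 * (1733 / 10 ^+ 3) by apply: ler_pM => //; (exact: sqrtr_ge0 || lra).
have w0 : 4 / 10 * (1732 / 10 ^+ 3) <= t * s3 by apply: ler_pM; lra.
rewrite (@section_density_active 3 0 [:: Qfrac 9 8; Qopp (Qfrac 3 2); Qfrac 1 2]) //; last first.
  by rewrite /active; clear u' l'; split; lra.
rewrite /= Q2RN !Q2R_frac //.
have -> : s3 * (9 / 8 + t * s3 * (- (3 / 2) + t * s3 * (1 / 2 + t * s3 * 0))) =
  9 / 8 * s3 - 3 / 2 * (s3 * s3) * t + 1 / 2 * (s3 * s3) * s3 * t ^+ 2 by field.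
by rewrite sqrt3_sqr; field.
Qed.

Lemma section_density4 t : 0 <= t -> t <= 1 / 2 -> section_density 4 t = 4 / 3 - 8 * t ^+ 2 + 8 * t ^+ 3.
Proof.
move=> t0 t1.
have s4 : Num.sqrt 4%:R = 2 :> R.
  have -> : 4%:R = 2 ^+ 2 :> R by ring.
  by rewrite sqrtr_sqr ger0_norm.
rewrite (@section_density_active 4 1 [:: Qfrac 2 3; q0; Qopp q1; Qfrac 1 2]) //; last first.
  by rewrite /active s4; split; lra.
by rewrite s4 /= Q2RN Q2R1 Q2R0 !Q2R_frac //; field.
Qed.

Lemma unique_root (f : R -> R) a b : a < b -> continuous f ->
  (forall x y, a <= x -> x < y -> y <= b -> f y < f x) -> 0 < f a -> f b < 0 ->
  exists c, unique (fun x => f x = 0 /\ a < x < b) c.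
Proof.
move=> ab cf mono fa fb.
have [||c] := @IVT R f a b 0 (ltW ab); first exact: continuous_subspaceT.
  by rewrite ge_min (ltW fb) orbT /= le_max (ltW fa).
rewrite in_itv /= => /andP[ac cb] fc; exists c.
have ac' : a < c by rewrite lt_neqAle ac andbT; apply/eqP => E; move: fa; rewrite E fc ltxx.
have cb' : c < b by rewrite lt_neqAle cb andbT; apply/eqP => E; move: fb; rewrite -E fc ltxx.
split; first by rewrite ac'.
move=> y [fy /andP[ay yb]]; have [h|h|//] := ltgtP c y.
  by have := mono c y ac h (ltW yb); rewrite fc fy ltxx.
by have := mono y c (ltW ay) h cb; rewrite fc fy ltxx.
Qed.

(** By the closed forms, [cubic_in] is 12 (I_4 - I_3) on [0, 1/4] and [cubic_out] is 24 (I_4 - I_3)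
    on [4/10, 1/2]. *)
Definition cubic_in x := 16 - 9 * s3 - 12 * (8 - 3 * s3) * x ^+ 2 + 96 * x ^+ 3.
Definition cubic_out x := 32 - 27 * s3 + 108 * x - 12 * (16 + 3 * s3) * x ^+ 2 + 192 * x ^+ 3.

Lemma cubic_in_decr x y : 0 <= x -> x < y -> y <= 145 / 10 ^+ 3 -> cubic_in y < cubic_in x.
Proof.
move=> x0 xy y1; have [_ u] := sqrt3_bounds; have u' : s3 <= 1733 / 10 ^+ 3 by lra.
rewrite -subr_gt0 /cubic_in; move: s3 u' {u} => s u.
have -> : 16 - 9 * s - 12 * (8 - 3 * s) * x ^+ 2 + 96 * x ^+ 3 - (16 - 9 * s - 12 * (8 - 3 * s) * y ^+ 2 + 96 * y ^+ 3) =
  (y - x) * ((12 * (8 - 3 * s) - 96 * (x + y)) * (x + y) + 96 * (x * y)) by ring.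
rewrite mulr_gt0 ?subr_gt0 // ltr_wpDr ?mulr_ge0 ?(ltW (le_lt_trans x0 xy)) //.
by rewrite mulr_gt0 //; lra.
Qed.

Lemma cubic_out_decr x y : 407 / 10 ^+ 3 <= x -> x < y -> y <= 1 / 2 -> cubic_out y < cubic_out x.
Proof.
move=> x0 xy y1; have [l u] := sqrt3_bounds; have l' : 1732 / 10 ^+ 3 <= s3 by lra.
rewrite -subr_lt0 /cubic_out; move: s3 l' {u l} => s l.
have -> : 32 - 27 * s + 108 * y - 12 * (16 + 3 * s) * y ^+ 2 + 192 * y ^+ 3 - (32 - 27 * s + 108 * x - 12 * (16 + 3 * s) * x ^+ 2 + 192 * x ^+ 3) =
  (y - x) * (108 - 12 * (16 + 3 * s) * (x + y) + 144 * (x + y) ^+ 2 + 48 * (y - x) ^+ 2) by ring.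
rewrite pmulr_rlt0 ?subr_gt0 //.
have h1 : (y - x) ^+ 2 <= (1 / 10) ^+ 2 by rewrite lerXn2r ?nnegrE; lra.
(* A chord bound for (x + y)^2, as x + y lies in [0.814, 1]. *)
have h2 : 0 <= (x + y - 814 / 10 ^+ 3) * (1 - (x + y)) by apply: mulr_ge0; lra.
have h3 : 0 <= (s - 1732 / 10 ^+ 3) * (x + y) by apply: mulr_ge0; lra.
have z1 : x + y <= 1 by lra.
by move: h1 h2 h3 z1; move: (x + y) ((y - x) ^+ 2) => z v; rewrite expr2; clear; lra.
Qed.

Lemma continuous_cubic a b c d : continuous (fun x : R => a + b * x - c * x ^+ 2 + d * x ^+ 3).
Proof.
have cX n : continuous (fun x : R => x ^+ n) by exact: exprn_continuous.
apply: continuous_add_fun; last by apply: continuous_mul_fun (cX 3%N); exact: continuous_cst_fun.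
apply: continuous_sub_fun; last by apply: continuous_mul_fun (cX 2%N); exact: continuous_cst_fun.
apply: continuous_add_fun; first exact: continuous_cst_fun.
by apply: continuous_mul_fun; [exact: continuous_cst_fun|exact: continuous_id_fun].
Qed.

Lemma root_in : exists c, unique (fun x => cubic_in x = 0 /\
  144 / 10 ^+ 3 + 137 / 10 ^+ 6 < x < 144 / 10 ^+ 3 + 138 / 10 ^+ 6) c.
Proof.
have [l u] := sqrt3_bounds.
apply: unique_root.
- lra.
- have -> : cubic_in = fun x => (16 - 9 * s3) + 0 * x - 12 * (8 - 3 * s3) * x ^+ 2 + 96 * x ^+ 3.
    by apply/funext => x; rewrite /cubic_in mul0r addr0.
  exact: continuous_cubic.
- move=> x y ax xy yb; apply: cubic_in_decr => //; clear -ax yb; lra.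
- rewrite /cubic_in; move: s3 l u => s l u; lra.
- rewrite /cubic_in; move: s3 l u => s l u; lra.
Qed.

Lemma root_out : exists c, unique (fun x => cubic_out x = 0 /\
  407 / 10 ^+ 3 + 452 / 10 ^+ 6 < x < 407 / 10 ^+ 3 + 453 / 10 ^+ 6) c.
Proof.
have [l u] := sqrt3_bounds.
apply: unique_root.
- lra.
- exact: continuous_cubic.
- move=> x y ax xy yb; apply: cubic_out_decr => //; clear -ax yb; lra.
- rewrite /cubic_out; move: s3 l u => s l u; lra.
- rewrite /cubic_out; move: s3 l u => s l u; lra.
Qed.

(** The smaller root of I_2 = I_3: multiplied by 12 sqrt 3 and completed to a square, the equation
    reads (2 - 6 sqrt 3 t)^2 = 31 - 12 sqrt 6. *)
Definition alpha23 := (2 - Num.sqrt (31 - 12 * s6)) / (6 * s3).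

Lemma sqrt_disc_lt y : 0 < y -> 31 - 12 * s6 < y ^+ 2 -> Num.sqrt (31 - 12 * s6) < y.
Proof.
move=> y0 h; rewrite -(ger0_norm (ltW y0)) -sqrtr_sqr ltr_sqrt // exprn_gt0 //.
Qed.

Lemma lt_sqrt_disc y : 0 < y -> y ^+ 2 < 31 - 12 * s6 -> y < Num.sqrt (31 - 12 * s6).
Proof.
move=> y0 h; rewrite -{1}(ger0_norm (ltW y0)) -sqrtr_sqr ltr_sqrt //.
by rewrite (lt_trans _ h) // exprn_gt0.
Qed.

Let sqr_affine x : (2 - 6 * s3 * x) ^+ 2 = 4 - 24 * s3 * x + 108 * x ^+ 2.
Proof.
have -> : 108 * x ^+ 2 = 36 * (s3 * s3) * x ^+ 2 by rewrite sqrt3_sqr; ring.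
by ring.
Qed.

Lemma alpha23_bounds : 705 / 10 ^+ 4 + 12 / 10 ^+ 7 < alpha23 < 705 / 10 ^+ 4 + 13 / 10 ^+ 7.
Proof.
have [l u] := sqrt3_bounds; have [l6 u6] := sqrt6_bounds.
have s30 : 0 < 6 * s3 by rewrite mulr_gt0 // sqrtr_gt0.
pose x1 : R := 705 / 10 ^+ 4 + 12 / 10 ^+ 7; pose x2 : R := 705 / 10 ^+ 4 + 13 / 10 ^+ 7.
have h1 : Num.sqrt (31 - 12 * s6) < 2 - 6 * s3 * x1.
  apply: sqrt_disc_lt; first by rewrite /x1; move: s3 l u => s l u; clear -l u; lra.
  by rewrite sqr_affine /x1; move: s3 s6 l u l6 u6 => s s' l u l6 u6; clear -l u l6 u6; lra.
have h2 : 2 - 6 * s3 * x2 < Num.sqrt (31 - 12 * s6).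
  apply: lt_sqrt_disc; first by rewrite /x2; move: s3 l u => s l u; clear -l u; lra.
  by rewrite sqr_affine /x2; move: s3 s6 l u l6 u6 => s s' l u l6 u6; clear -l u l6 u6; lra.
rewrite /alpha23 ltr_pdivlMr // ltr_pdivrMr // -/x1 -/x2.
move: (Num.sqrt (31 - _)) s3 x1 x2 h1 h2 => D s x1 x2 h1 h2; apply/andP; split; clear -h1 h2; lra.
Qed.

(** For t < 0.145 the number 2 - 6 sqrt 3 t is still positive, so t > alpha23 is equivalent to its
    square being below the discriminant. *)
Lemma density2_lt3 t : alpha23 < t -> t < 145 / 10 ^+ 3 -> section_density 2 t < section_density 3 t.
Proof.
move=> t0 t1; have [l u] := sqrt3_bounds; have [l6 u6] := sqrt6_bounds.
have u' : s3 <= 1733 / 10 ^+ 3 by clear -u; lra.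
have s30 : 0 < s3 by rewrite sqrtr_gt0.
have a0 : 705 / 10 ^+ 4 < t.
  by have /andP[a _] := alpha23_bounds; apply: le_lt_trans (lt_trans a t0); lra.
have tp : 0 < t by clear -a0; lra.
rewrite section_density2 ?section_density3_in ?(ltW tp) //; [|by clear -t1; lra|by clear -t1; lra].
have s23 : s2 * s3 = s6 by rewrite -sqrtrM ?ler0n // -natrM.
have y0 : 0 < 2 - 6 * s3 * t.
  have : s3 * t <= 1733 / 10 ^+ 3 * (145 / 10 ^+ 3) by apply: ler_pM; [exact: ltW|exact: ltW|exact: u'|exact: ltW].
  have -> : 6 * s3 * t = 6 * (s3 * t) by rewrite mulrA.
  by move: (s3 * t) => z h; clear -h; lra.
have D0 : 0 <= 31 - 12 * s6 by move: s6 l6 u6 => s l6 u6; clear -u6; lra.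
have yD : (2 - 6 * s3 * t) ^+ 2 < 31 - 12 * s6.
  rewrite -(sqr_sqrtr D0) ltrXn2r ?nnegrE ?sqrtr_ge0 ?(ltW y0) //.
  move: t0; rewrite /alpha23 ltr_pdivrMr ?mulr_gt0 //.
  by move: (Num.sqrt (31 - _)) => D h; clear -h; lra.
have s120 : 0 < 12 * s3 by rewrite mulr_gt0.
rewrite -(ltr_pM2l s120).
have -> : 12 * s3 * (s2 - 2 * t) = 12 * s6 - 24 * s3 * t by rewrite -s23; ring.
have -> : 12 * s3 * (s3 * (3 / 4 - 3 * t ^+ 2)) = 27 - 108 * t ^+ 2.
  have -> : 12 * s3 * (s3 * (3 / 4 - 3 * t ^+ 2)) = 12 * (s3 * s3) * (3 / 4 - 3 * t ^+ 2) by ring.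
  by rewrite sqrt3_sqr; field.
by move: yD; rewrite sqr_affine; move: s3 s6 (t ^+ 2) => s s' v h; clear -h; lra.
Qed.

Lemma density3_lt4 t c : 0 <= t -> t < c -> c <= 145 / 10 ^+ 3 -> cubic_in c = 0 ->
  section_density 3 t < section_density 4 t.
Proof.
move=> t0 tc c1 E; have t1 : t < 145 / 10 ^+ 3 := lt_le_trans tc c1.
have := cubic_in_decr t0 tc c1.
rewrite E section_density3_in ?section_density4 //; [|by clear -t1; lra|by clear -t1; lra].
by rewrite /cubic_in; move: s3 (t ^+ 3) => s v h; clear -h; lra.
Qed.

Lemma density4_lt3 t c : 407 / 10 ^+ 3 <= c -> c < t -> t <= 1 / 2 -> cubic_out c = 0 ->
  section_density 4 t < section_density 3 t.
Proof.
move=> c0 ct t1 E; have t0 : 407 / 10 ^+ 3 <= t := le_trans c0 (ltW ct).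
have := cubic_out_decr c0 ct t1.
rewrite E section_density3_out ?section_density4 //; [|by clear -t0; lra|by clear -t0; lra].
by rewrite /cubic_out; move: s3 (t ^+ 3) => s v h; clear -h; lra.
Qed.

Lemma density3_lt2 t : 407 / 10 ^+ 3 <= t -> t <= 1 / 2 -> section_density 3 t < section_density 2 t.
Proof.
move=> t0 t1; have [l u] := sqrt3_bounds; have [l2 u2] := sqrt2_bounds.
have u' : s3 <= 1733 / 10 ^+ 3 by clear -u; lra.
rewrite section_density3_out ?section_density2 //; [|by clear -t0; lra|by clear -t0; lra].
(* A chord bound for t^2 on [0.407, 1/2], which makes the comparison linear in t. *)
have h : (t - 407 / 10 ^+ 3) * (1 / 2 - t) >= 0 by apply: mulr_ge0; lra.
have h2 : s3 * t ^+ 2 <= 1733 / 10 ^+ 3 * t ^+ 2 by rewrite ler_wpM2r ?sqr_ge0.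
have hv : t ^+ 2 <= 907 / 10 ^+ 3 * t - 2035 / 10 ^+ 4 by move: h; clear; lra.
by move: s3 s2 u' l2 (t ^+ 2) hv h2 => s s' u' l2 v hv h2; clear -t0 t1 u' l2 hv h2; lra.
Qed.

(** The pair (2,3) consumes t > alpha23 sharply and the pair (3,4) consumes t < c sharply; all other
    pairs use only rational bounds on t. *)
Lemma section_volume_incr d t c : (0 < d)%N -> alpha23 < t -> t < c ->
  c < 144 / 10 ^+ 3 + 138 / 10 ^+ 6 -> cubic_in c = 0 ->
  (section_volume d t < section_volume d.+1 t)%E.
Proof.
move=> d0 t0 tc c1 E.
have t1 : 705 / 10 ^+ 4 <= t.
  by have /andP[a _] := alpha23_bounds; apply: ltW; apply: le_lt_trans (lt_trans a t0); clear; lra.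
have tp : 0 <= t by clear -t1; lra.
have c2 : c <= 145 / 10 ^+ 3 by clear -c1; lra.
have t2 : t < 145 / 10 ^+ 3 by exact: lt_le_trans tc c2.
have t3 : t <= 1442 / 10 ^+ 4 by have := lt_trans tc c1; clear; lra.
have t4 : t <= 1 / 2 by clear -t2; lra.
case: d d0 => [|[|[|[|d]]]] // _.
- rewrite section_volume1 // section_volume_density // lte_fin section_density2 //.
  by have [l _] := sqrt2_bounds; clear -l t2; lra.
- by rewrite !section_volume_density // lte_fin density2_lt3.
- by rewrite !section_volume_density // lte_fin (density3_lt4 tp tc c2 E).
rewrite !section_volume_density // lte_fin.
have [d12|d12] := ltnP d.+4 12.
  by apply: section_density_incr_small; rewrite ?d12 ?t1 ?t3.
apply: section_density_incr => //.
have t5 : t <= 144 / 10 ^+ 3 + 138 / 10 ^+ 6 by rewrite ltW // (lt_trans tc).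
have : t ^+ 2 <= (144 / 10 ^+ 3 + 138 / 10 ^+ 6) ^+ 2 by rewrite lerXn2r ?nnegrE //; exact: le_trans t5.
by move: (t ^+ 2) => v; clear; lra.
Qed.

(** Only the pair (3,4) consumes c < t sharply. For the other pairs it suffices that t lies between
    a rational lower bound of c and 1/2. *)
Lemma section_volume_decr d t c : (0 < d)%N -> c < t -> t <= 1 / 2 ->
  407 / 10 ^+ 3 + 452 / 10 ^+ 6 < c -> cubic_out c = 0 ->
  (section_volume d.+1 t < section_volume d t)%E.
Proof.
move=> d0 ct t4 c1 E.
have t1 : 407 / 10 ^+ 3 + 452 / 10 ^+ 6 <= t by exact: ltW (lt_trans c1 ct).
have c2 : 407 / 10 ^+ 3 <= c by clear -c1; lra.
have t2 : 407 / 10 ^+ 3 <= t by clear -t1; lra.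
have t3 : 4074 / 10 ^+ 4 <= t by clear -t1; lra.
have tp : 0 <= t by clear -t2; lra.
case: d d0 => [|[|[|[|d]]]] // _.
- rewrite section_volume1 // section_volume_density // lte_fin section_density2 //.
  by have [_ u] := sqrt2_bounds; clear -u t2; lra.
- by rewrite !section_volume_density // lte_fin density3_lt2.
- by rewrite !section_volume_density // lte_fin (density4_lt3 c2 ct t4 E).
rewrite !section_volume_density // lte_fin.
have [d12|d12] := ltnP d.+4 12.
  by apply: section_density_decr_small; rewrite ?d12 ?t3 ?t4.
apply: section_density_decr => //.
  have : (407 / 10 ^+ 3 + 452 / 10 ^+ 6) ^+ 2 <= t ^+ 2.
    have hp : 0 <= 407 / 10 ^+ 3 + 452 / 10 ^+ 6 :> R by clear; lra.
    by apply: lerXn2r t1; rewrite ?nnegrE.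
  by move: (t ^+ 2) => v; clear; lra.
have hp : 0 <= 1 / 2 :> R by clear; lra.
have : t ^+ 2 <= (1 / 2) ^+ 2 by apply: lerXn2r t4; rewrite ?nnegrE.
by move: (t ^+ 2) => v; clear; lra.
Qed.

Lemma chain_lt (f : nat -> \bar R) : (forall d, (0 < d)%N -> (f d < f d.+1)%E) ->
  forall d e, (0 < d)%N -> (d < e)%N -> (f d < f e)%E.
Proof.
move=> H d e d0; elim: e => // e IH; rewrite ltnS leq_eqVlt => /predU1P[<-|de]; first exact: H.
by apply: lt_trans (IH de) (H _ _); exact: leq_trans de.
Qed.

Lemma chain_gt (f : nat -> \bar R) : (forall d, (0 < d)%N -> (f d.+1 < f d)%E) ->
  forall d e, (0 < d)%N -> (d < e)%N -> (f e < f d)%E.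
Proof.
move=> H d e d0; elim: e => // e IH; rewrite ltnS leq_eqVlt => /predU1P[<-|de]; first exact: H.
by apply: lt_trans (H _ _) (IH de); exact: leq_trans de.
Qed.

End low_dim.

Theorem theorem1p3 (R : realType) :
  (let alpha23 : R :=
     (2 - Num.sqrt (31 - 12 * Num.sqrt 6)) / (6 * Num.sqrt 3) in
   705 / 10 ^+ 4 + 12 / 10 ^+ 7 < alpha23 <
     705 / 10 ^+ 4 + 13 / 10 ^+ 7 /\
   exists alpha34 : R,
     unique (fun a : R =>
       16 - 9 * Num.sqrt 3 - 12 * (8 - 3 * Num.sqrt 3) * a ^+ 2 +
         96 * a ^+ 3 = 0 /\
       144 / 10 ^+ 3 + 137 / 10 ^+ 6 < a
         < 144 / 10 ^+ 3 + 138 / 10 ^+ 6) alpha34 /\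
     forall t : R, alpha23 < t < alpha34 ->
       forall d e : nat, (0 < d)%N -> (d < e)%N ->
         (section_volume d t < section_volume e t)%E)
  /\
  (exists alpha34 : R,
     unique (fun a : R =>
       32 - 27 * Num.sqrt 3 + 108 * a - 12 * (16 + 3 * Num.sqrt 3) * a ^+ 2 +
         192 * a ^+ 3 = 0 /\
       407 / 10 ^+ 3 + 452 / 10 ^+ 6 < a
         < 407 / 10 ^+ 3 + 453 / 10 ^+ 6) alpha34 /\
     forall t : R, alpha34 < t <= 1 / 2 ->
       forall d e : nat, (0 < d)%N -> (d < e)%N ->
         (section_volume e t < section_volume d t)%E).
Proof.
split.
  split; first exact: alpha23_bounds.
  have [c cu] := root_in R; exists c; split=> // t /andP[t0 tc].
  have [[c0 /andP[_ c1]] _] := cu.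
  by apply: (@chain_lt R (fun d => section_volume d t)) => d d0; exact: (section_volume_incr d0 t0 tc c1 c0).
have [c cu] := root_out R; exists c; split=> // t /andP[ct t1].
have [[c0 /andP[c1 _]] _] := cu.
by apply: (@chain_gt R (fun d => section_volume d t)) => d d0; exact: (section_volume_decr d0 ct t1 c1 c0).
Qed.
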